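(* Let $m\in\mathbb{N}$, let $X$ be a Hausdorff space, $\gamma:X\times X\to(0,\infty)$ a continuous conditionally negative definite kernel and $A:X\times X\to\mathbb{C}$ a continuous kernel such that the kernel $C(u,v):=A(u,v)\gamma(u,v)^{m/2}$ on $X$ is positive definite. Define $G_{A,\gamma}:(X\times\mathbb{R}^{m})\times(X\times\mathbb{R}^{m})\to\mathbb{C}$ by $$G_{A,\gamma}((u,x),(v,y)):=A(u,v)\,e^{-\|x-y\|^{2}/\gamma(u,v)}.$$ (1) If $\gamma$ is metrizable, the function $x\in X\mapsto\gamma(x,x)\in\mathbb{R}$ is bounded from below and $C$ is bounded, then $G_{A,\gamma}$ is integrally strictly positive definite (ISPD) if and only if $A(u,u)>0$ for every $u\in X$. (2) If $X$ is locally compact, then $\mathcal{H}_{G_{A,\gamma}}\subset C_{0}(X\times\mathbb{R}^{m})$ if and only if $\mathcal{H}_{A}\subset C_{0}(X)$.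
   Context: A kernel $\gamma:X\times X\to\mathbb{R}$ is conditionally negative definite if $\gamma(x,y)=\gamma(y,x)$ and $\sum_{\mu,\nu=1}^{n}c_{\mu}c_{\nu}\gamma(x_{\mu},x_{\nu})\le 0$ for all finitely many distinct points $x_{1},\dots,x_{n}$ and $c_{1},\dots,c_{n}\in\mathbb{R}$ with $\sum_{\mu}c_{\mu}=0$. Such a kernel is metrizable if $2\gamma(x,y)>\gamma(x,x)+\gamma(y,y)$ for all $x\neq y$ in $X$. A kernel $K:Y\times Y\to\mathbb{C}$ is positive definite if $\sum_{\mu,\nu=1}^{n}c_{\mu}\overline{c_{\nu}}K(x_{\mu},x_{\nu})\ge 0$ for all finitely many distinct points $x_{\mu}\in Y$ and scalars $c_{\mu}\in\mathbb{C}$. Its reproducing kernel Hilbert space $\mathcal{H}_{K}$ is the Hilbert space of functions $F:Y\to\mathbb{C}$ that contains $K_{y}:=K(\cdot,y)$ for every $y\in Y$, satisfies $\langle F,K_{y}\rangle_{\mathcal{H}_{K}}=F(y)$, and in which $\mathrm{span}\{K_{y}:y\in Y\}$ is dense. (Under the standing hypotheses on $\gamma$, $A$ and $C$ both $G_{A,\gamma}$ and $A$ are positive definite, so $\mathcal{H}_{G_{A,\gamma}}$ and $\mathcal{H}_{A}$ make sense.) $\mathcal{M}(Y)$ denotes the finite complex-valued Radon measures on $Y$: complex Borel measures $\lambda$ with $|\lambda|$ finite and, for every Borel $E$, $|\lambda|(E)=\sup\{|\lambda|(K):K\subset E\text{ compact}\}=\inf\{|\lambda|(U):U\supset E\text{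 open}\}$. A bounded positive definite kernel $K$ on a Hausdorff space $Y$ with $\mathcal{H}_{K}\subset C(Y)$ (the continuous complex-valued functions on $Y$) is ISPD if the only $\lambda\in\mathcal{M}(Y)$ with $\int_{Y}\int_{Y}K(x,y)\,d\lambda(x)\,d\overline{\lambda}(y)=0$ is the zero measure. For locally compact $Y$, $C_{0}(Y)$ is the space of continuous $f:Y\to\mathbb{C}$ such that for every $\epsilon>0$ there is a compact set outside of which $|f|<\epsilon$.
   Formalization: In (1), ''bounded from below'' is taken to mean that γ(x,x) ≥ c for some constant c > 0; read literally (automatic, as γ > 0) the claim fails, e.g. X=(0,1), γ=2max(u,v), C=1, where G is unbounded. *)

(* Defs.v *)
From HB Require Import structures.
From mathcomp Require Import all_boot all_order all_algebra.
From mathcomp Require Import all_classical all_reals all_analysis.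
From mathcomp.real_closed Require Import complex.

Set Implicit Arguments.
Unset Strict Implicit.
Unset Printing Implicit Defensive.
Import Order.TTheory GRing.Theory Num.Theory.
Import numFieldNormedType.Exports.
Import ComplexField.Normc.
Local Open Scope classical_set_scope.
Local Open Scope ring_scope.
Local Open Scope complex_scope.

(* [R[i]] carries no topology of its own; [R[i]^o] is the same type with the
   topology of the modulus. *)

Section kernels.
Variable R : realType.

Definition cond_neg_def_kernel (X : Type) (gamma : X -> X -> R) : Prop :=
  (forall x y, gamma x y = gamma y x) /\
  forall (n : nat) (x : 'I_n -> X) (c : 'I_n -> R),
    injective x -> \sum_mu c mu = 0 ->
    \sum_mu \sum_nu c mu * c nu * gamma (x mu) (x nu) <= 0.

Definition metrizable_kernel (X : Type) (gamma : X -> X -> R) : Prop :=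
  forall x y, x <> y -> gamma x x + gamma y y < 2 * gamma x y.

(* In [R[i]], [0 <= z] says that [z] is real and nonnegative. *)
Definition pos_def_kernel (Y : Type) (K : Y -> Y -> R[i]) : Prop :=
  forall (n : nat) (x : 'I_n -> Y) (c : 'I_n -> R[i]),
    injective x ->
    0 <= \sum_mu \sum_nu c mu * (c nu)^* * K (x mu) (x nu).

Definition bounded_kernel (Y : Type) (K : Y -> Y -> R[i]) : Prop :=
  exists M : R, forall x y, normc (K x y) <= M.

Definition continuous_kernel (Y : topologicalType) (K : Y -> Y -> R[i]) : Prop :=
  continuous (fun p : Y * Y => K p.1 p.2 : R[i]^o).

(* The library norm on ['rV[R]_m] is the sup norm, so the squared Euclidean norm
   is written out. *)
Definition Gker (m : nat) (X : Type) (A : X -> X -> R[i]) (gamma : X -> X -> R)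
    (p q : X * 'rV[R]_m) : R[i] :=
  A p.1 q.1 *
  (expR (- ((\sum_(i < m) (p.2 0 i - q.2 0 i) ^+ 2) / gamma p.1 q.1)))%:C.

Definition Cker (m : nat) (X : Type) (A : X -> X -> R[i]) (gamma : X -> X -> R)
    (u v : X) : R[i] :=
  A u v * (gamma u v `^ (m%:R / 2))%:C.

End kernels.
Arguments Gker {R} m {X} A gamma p q.
Arguments Cker {R} m {X} A gamma u v.

Section function_spaces.
Variables (R : realType) (Y : topologicalType).

Definition cont_funs : set (Y -> R[i]) :=
  [set f | continuous (f : Y -> R[i]^o)].

Definition C0_funs : set (Y -> R[i]) :=
  [set f | cont_funs f /\
    forall eps : R, 0 < eps ->
      exists2 B : set Y, compact B & forall y, ~ B y -> normc (f y) < eps].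

End function_spaces.
Arguments cont_funs : clear implicits.
Arguments C0_funs : clear implicits.

Section rkhs.
Variables (R : realType) (Y : Type).
Implicit Types (F G : Y -> R[i]) (H : set (Y -> R[i])).

Definition ipnorm (ip : (Y -> R[i]) -> (Y -> R[i]) -> R[i]) F : R :=
  Num.sqrt (complex.Re (ip F F)).

(* [ip] is only meaningful on the subspace [H] of [Y -> R[i]]; its values
   elsewhere are irrelevant. *)
Record is_rkhs (K : Y -> Y -> R[i]) H
    (ip : (Y -> R[i]) -> (Y -> R[i]) -> R[i]) : Prop := {
  rkhs_zero : H (fun=> 0) ;
  rkhs_lin : forall (a : R[i]) F G, H F -> H G -> H (fun y => a * F y + G y) ;
  rkhs_ip_lin : forall (a : R[i]) F G L, H F -> H G -> H L ->
    ip (fun y => a * F y + G y) L = a * ip F L + ip G L ;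
  rkhs_ip_herm : forall F G, H F -> H G -> ip G F = (ip F G)^* ;
  rkhs_ip_ge0 : forall F, H F -> 0 <= ip F F ;
  rkhs_ip_def : forall F, H F -> ip F F = 0 -> F = (fun=> 0) ;
  rkhs_complete : forall u : nat -> (Y -> R[i]), (forall n, H (u n)) ->
    (forall eps : R, 0 < eps -> exists N, forall p q,
      (N <= p)%N -> (N <= q)%N -> ipnorm ip (fun y => u p y - u q y) < eps) ->
    exists2 F, H F &
      (fun n => ipnorm ip (fun y => u n y - F y)) @ \oo --> (0 : R) ;
  rkhs_section : forall y, H (fun x => K x y) ;
  rkhs_reproducing : forall F y, H F -> ip F (fun x => K x y) = F y ;
  rkhs_dense : forall F, H F -> forall eps : R, 0 < eps ->
    exists (n : nat) (c : 'I_n -> R[i]) (y : 'I_n -> Y),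
      ipnorm ip (fun x => F x - \sum_i c i * K x (y i)) < eps
}.

(* By Moore-Aronszajn, for a positive definite [K] there is exactly one such
   space; [rkhs K] is its underlying set of functions. *)
Definition rkhs (K : Y -> Y -> R[i]) : set (Y -> R[i]) :=
  [set F | exists H ip, is_rkhs K H ip /\ H F].

End rkhs.

(* Measurable types must be pointed. So as not to exclude the empty space, the
   point is added here as a parameter; nothing else depends on it. *)
Definition pointed_at (Y : choiceType) (y0 : Y) : Type := Y.
HB.instance Definition _ (Y : choiceType) (y0 : Y) :=
  Choice.on (pointed_at y0).
HB.instance Definition _ (Y : choiceType) (y0 : Y) :=
  isPointed.Build (pointed_at y0) (y0 : pointed_at y0).

Notation borel y0 :=
  (g_sigma_algebraType (open : set (set (pointed_at y0)))).

(* The image of a charge under a continuous additive map. *)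
Section charge_map.
Context d (T : measurableType d) (K L : numFieldType).
Variables (nu : {charge set T -> \bar K}) (phi : {additive K -> L}).

Definition charge_map & continuous (phi : K^o -> L^o) : set T -> \bar L :=
  fun E => (phi (fine (nu E)))%:E.

Hypothesis phi_cont : continuous (phi : K^o -> L^o).
Local Notation mu := (charge_map phi_cont).

Let mu_finite : fin_num_fun mu. Proof. by []. Qed.

Let mu_sum (F : (set T)^nat) n : (forall k, measurable (F k)) ->
  (\sum_(i < n) mu (F i))%E = (phi (fine (\sum_(i < n) nu (F i))%E))%:E.
Proof.
move=> mF; rewrite /charge_map sumEFin -raddf_sum; congr (phi _)%:E.
by rewrite sum_fine// => i _; exact: fin_num_measure.
Qed.

Let mu_additive : measure_function.semi_additive mu.
Proof.
by move=> F n mF tF mUF; rewrite mu_sum// {1}/charge_map charge_semi_additive.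
Qed.

Let mu_sigma_additive : semi_sigma_additive mu.
Proof.
move=> F mF tF mUF; have := @charge_semi_sigma_additive _ _ _ nu F mF tF mUF.
rewrite -[X in _ --> X -> _]fineK; last exact: fin_num_measure.
move=> /fine_cvg cvF; rewrite /charge_map; apply/fine_cvgP; split.
  by near=> n; rewrite sumEFin.
rewrite (_ : _ \o _ = phi \o (fine \o (fun n => \sum_(0 <= i < n) nu (F i))%E)).
  by apply: continuous_cvg cvF; exact: phi_cont.
by apply/funext => n /=; rewrite !big_mkord mu_sum.
Unshelve. all: by end_near. Qed.

HB.instance Definition _ := isFinite.Build d T L mu mu_finite.
HB.instance Definition _ := isAdditiveCharge.Build d T L mu mu_additive.
HB.instance Definition _ :=
  isSemiSigmaAdditive.Build d T L mu mu_sigma_additive.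

End charge_map.

Section complex_parts.
Variable R : realType.

Lemma normc_Re (z : R[i]) : `|complex.Re z| <= normc z.
Proof.
by case: z => a b /=; rewrite -sqrtr_sqr ler_wsqrtr// lerDl sqr_ge0.
Qed.

Lemma normc_Im (z : R[i]) : `|complex.Im z| <= normc z.
Proof.
by case: z => a b /=; rewrite -sqrtr_sqr ler_wsqrtr// lerDr sqr_ge0.
Qed.

Let normc_near (z : R[i]^o) (e : R) : 0 < e ->
  nbhs z [set w | normc ((z : R[i]) - w) < e].
Proof.
move=> e0; have := @nbhsx_ballx R[i] R[i]^o z e%:C; rewrite ltcR => /(_ e0).
by apply: filterS => w; rewrite -ball_normE /= ltcR.
Qed.

Lemma Re_continuous : continuous (@complex.Re R : R[i]^o -> R^o).
Proof.
move=> z; have Fz := @nbhs_filter R[i]^o z.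
apply/cvgrPdist_lt => e e0; apply: filterS (normc_near z e0) => w.
by rewrite -raddfB; apply: le_lt_trans (normc_Re _).
Qed.

Lemma Im_continuous : continuous (@complex.Im R : R[i]^o -> R^o).
Proof.
move=> z; have Fz := @nbhs_filter R[i]^o z.
apply/cvgrPdist_lt => e e0; apply: filterS (normc_near z e0) => w.
by rewrite -raddfB; apply: le_lt_trans (normc_Im _).
Qed.

Lemma conjc_continuous : continuous (@conjc R : R[i]^o -> R[i]^o).
Proof.
move=> z; have Fz := @nbhs_filter R[i]^o z.
apply/(@cvgrPdist_lt _ R[i]^o) => -[e e'].
rewrite ltcE /= => /andP[/eqP-> e0].
apply: filterS (normc_near z e0) => w.
by case: z w {Fz} => a b [c d]; rewrite ltcR /= -opprD sqrrN.
Qed.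

End complex_parts.

(* A [{charge set T -> \bar R[i]}] takes finite values on measurable sets and
   is countably additive for the topology of [R[i]]: it is a complex measure. *)
Section complex_measure.
Context d (T : measurableType d) (R : realType).
Implicit Types (nu : {charge set T -> \bar R}) (f : T -> R).
Implicit Types (lambda : {charge set T -> \bar R[i]}) (g : T -> R[i]).

Definition Re_charge lambda : {charge set T -> \bar R} :=
  charge_map lambda (@Re_continuous R).
Definition Im_charge lambda : {charge set T -> \bar R} :=
  charge_map lambda (@Im_continuous R).
Definition conj_charge lambda : {charge set T -> \bar R[i]} :=
  charge_map lambda (@conjc_continuous R).

(* The Jordan parts of [nu] do not depend on the Hahn decomposition chosen. *)
Definition charge_integral nu f : R :=
  let nuPN := svalP (cid (svalP (cid (Hahn_decomposition nu)))) in
  \int[jordan_pos nuPN]_x f x - \int[jordan_neg nuPN]_x f x.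

Definition cintegral lambda g : R[i] :=
  (charge_integral (Re_charge lambda) (fun x => complex.Re (g x)) -
   charge_integral (Im_charge lambda) (fun x => complex.Im (g x))) +i*
  (charge_integral (Re_charge lambda) (fun x => complex.Im (g x)) +
   charge_integral (Im_charge lambda) (fun x => complex.Re (g x))).

Definition total_variation lambda (E : set T) : \bar R :=
  ereal_sup [set (\sum_(0 <= k <oo) (normc (fine (lambda (F k))))%:E)%E |
    F in [set F : (set T)^nat | [/\ forall k, measurable (F k),
                                   trivIset setT F & \bigcup_k F k = E]]].

End complex_measure.

Section ispd.
Variables (R : realType) (Y : topologicalType).

Definition finite_radon (y0 : Y)
    (lambda : {charge set (borel y0) -> \bar R[i]}) : Prop :=
  [/\ (total_variation lambda setT < +oo)%E,
    forall E : set (borel y0), measurable E ->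
      total_variation lambda E =
        ereal_sup [set total_variation lambda B |
                   B in [set B : set Y | compact B /\ B `<=` E]] &
    forall E : set (borel y0), measurable E ->
      total_variation lambda E =
        ereal_inf [set total_variation lambda U |
                   U in [set U : set Y | open U /\ E `<=` U]]].

Definition ISPD (K : Y -> Y -> R[i]) : Prop :=
  [/\ bounded_kernel K, pos_def_kernel K, rkhs K `<=` cont_funs R Y &
    forall (y0 : Y) (lambda : {charge set (borel y0) -> \bar R[i]}),
      finite_radon lambda ->
      cintegral (conj_charge lambda)
        (fun y => cintegral lambda (fun x => K x y)) = 0 ->
      forall E : set (borel y0), measurable E -> lambda E = 0%E].

End ispd.

(* Main.v *)
(* The kernels [e^(-s gamma)], [s >= 0], are positive definite (Schoenberg), and the
   Fourier formula for the Gaussian writes [G] as an average over [xi] of the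
   positive definite kernels
     W_xi = C(u,v) e^(-|xi|^2 gamma(u,v)) prod_i cos (2 xi_i (x_i - y_i)).
   A measure [lambda] with [int int K dlambda dlambda^* = 0] annihilates the
   functions of the reproducing kernel space of [K], and the latter are recognised
   by domination: [f] belongs to it as soon as [M K - f f^*] is positive definite
   for some [M]. For [K = G], averages of [W_xi (., q)] over small frequency windows
   qualify, so in the limit [lambda] annihilates every [W_xi (., q)] and thus has
   zero energy for [W_xi]. For [K = W_xi] with [xi <> 0] the functions
     C(.,v) e^(-|xi|^2 gamma(.,v)) prod_a sin (b_a k(.,a)) prod_i cos (2 xi_i (x_i - y_i))
   qualify, where [k] is the Gram kernel of [gamma] based at [v], because
   [e^(-t gamma)] is [e^(t k)] up to a rank one factor. When [gamma] is metrizable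
   the [k(.,a)] separate the points of [X]; by a Stone-Weierstrass argument they can
   be traded for any bounded Borel function of [u], and the factors [C(.,v)] and
   [e^(-t gamma(.,v))] can be divided out near [v], where [C(v,v) > 0]. The
   remaining cosines separate the points of [R^m], so [lambda] vanishes near every
   fibre, and by tightness everywhere. Conversely, if [A(u,u) = 0] the Dirac mass at
   [(u,0)] has zero energy.

   For the second part, the reproducing kernel space of [K] lies in [C_0] if and
   only if [K] is bounded and has its sections in [C_0]: a gliding hump gives the
   boundedness, uniform approximation by combinations of sections the converse.
   Both properties pass between [A] and [G] since [gamma(.,v)] is bounded on compact
   sets. *)
Require Import Defs.
From HB Require Import structures.
From mathcomp Require Import all_boot all_order all_algebra.
From mathcomp Require Import all_classical all_reals all_analysis.
From mathcomp.real_closed Require Import complex.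
From mathcomp Require Import measurable_realfun ring lra.
Set Implicit Arguments.
Unset Strict Implicit.
Unset Printing Implicit Defensive.
Import Order.TTheory GRing.Theory Num.Theory.
Import numFieldNormedType.Exports.
Import ComplexField.Normc.
Local Open Scope classical_set_scope.
Local Open Scope ring_scope.
Local Open Scope complex_scope.
Local Notation "x ^c" := (conjc x) (at level 1, format "x ^c").

(** * Positive definite kernels *)

(** Domination is phrased as positive definiteness of [M K - f f^*], hence can be tested on finite
    combinations: a measure enters only through its approximation by point masses, and Hilbert
    spaces of functions matter only for the inclusions in spaces of continuous functions. In part
    (1) the space [X] is merely Hausdorff, so the Stone-Weierstrass step does not proceed by uniform
    approximation. The set of annihilated functions is closed under bounded pointwise limits
    instead, and a Borel set is reached by separating compact subsets of it and of its complement,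
    which inner regularity provides. Sines of [k(.,a)] replace [k(.,a)] itself because multipliers
    have to be bounded, and because multiplication by one more sine only lengthens a list. Each sine
    consumes a share of the exponent [|xi|^2]. The frequency zero is therefore excluded at first and
    returns as a limit of nonzero frequencies, which is where [0 < m] enters. *)

Section psd.
Variable R : realType.

Lemma conjcD (x y : R[i]) : (x + y)^c = x^c + y^c.
Proof. exact: rmorphD. Qed.

Lemma conjcN (x : R[i]) : (- x)^c = - x^c.
Proof. exact: rmorphN. Qed.

Lemma conjcM (x y : R[i]) : (x * y)^c = x^c * y^c.
Proof. exact: rmorphM. Qed.

Lemma conjc_sum (I : Type) (r : seq I) (P : pred I) (F : I -> R[i]) :
  (\sum_(i <- r | P i) F i)^c = \sum_(i <- r | P i) (F i)^c.
Proof. exact: rmorph_sum. Qed.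

(** A finite combination is a list of weighted points, repetitions allowed: addition is then
    concatenation, and no injectivity has to be carried along. *)
Definition sesq (Y : Type) (K : Y -> Y -> R[i]) (s t : seq (R[i] * Y)) : R[i] :=
  \sum_(a <- s) \sum_(b <- t) a.1 * b.1^c * K a.2 b.2.

Definition psd (Y : Type) (K : Y -> Y -> R[i]) : Prop :=
  forall s, 0 <= sesq K s s.

Lemma big_undup_snd (C : eqType) (V : nmodType) (Y : choiceType) (s : seq (C * Y))
    (F : C * Y -> V) :
  \sum_(a <- s) F a =
  \sum_(y <- undup [seq a.2 | a <- s]) \sum_(a <- s | a.2 == y) F a.
Proof.
rewrite (exchange_big_dep predT)//=; apply: eq_big_seq => a sa.
rewrite big_mkcond (bigD1_seq a.2) ?undup_uniq ?mem_undup ?map_f//= eqxx.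
by rewrite big1 ?addr0// => y; rewrite eq_sym => /negPf->.
Qed.

(** Summing the coefficients at each repeated point turns a list into a combination of the distinct
    points of [undup]. *)
Lemma psd_pos_def (Y : choiceType) (K : Y -> Y -> R[i]) :
  pos_def_kernel K <-> psd K.
Proof.
split=> [pK s|pK n x c injx].
- set u := undup [seq a.2 | a <- s].
  pose c y := \sum_(a <- s | a.2 == y) a.1.
  have E (f : Y -> R[i]) : \sum_(a <- s) a.1 * f a.2 = \sum_(y <- u) c y * f y.
    rewrite big_undup_snd; apply: eq_bigr => y _; rewrite /c big_distrl.
    by apply: eq_bigr => a /eqP->.
  have E' (f : Y -> R[i]) :
      \sum_(a <- s) a.1^c * f a.2 = \sum_(y <- u) (c y)^c * f y.
    rewrite big_undup_snd; apply: eq_bigr => y _; rewrite /c conjc_sum big_distrl.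
    by apply: eq_bigr => a /eqP->.
  have -> : sesq K s s = \sum_(y <- u) \sum_(z <- u) c y * (c z)^c * K y z.
    rewrite /sesq; under eq_bigr => a _.
      under eq_bigr do rewrite -mulrA; rewrite -big_distrr/=.
      rewrite (E' (fun y => K a.2 y)); over.
    rewrite (E (fun y => \sum_(z <- u) (c z)^c * K y z)); apply: eq_bigr => y _.
    by rewrite big_distrr/=; apply: eq_bigr => z _; rewrite mulrA.
  have : uniq u by exact: undup_uniq.
  case: (u) => [|y0 t]; first by rewrite !big_nil.
  move=> tu; rewrite (big_nth y0) big_mkord.
  under eq_bigr do rewrite (big_nth y0) big_mkord.
  apply: (pK _ (fun i : 'I_(size (y0 :: t)) => nth y0 (y0 :: t) i) (fun i => c _)) => i j.
  by move/eqP; rewrite nth_uniq// => /eqP/val_inj.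
- have := pK [seq (c i, x i) | i <- enum 'I_n]; rewrite /sesq big_map big_enum/=.
  by under eq_bigr do rewrite big_map big_enum/=.
Qed.

Section basics.
Variable Y : Type.
Implicit Types (K L : Y -> Y -> R[i]) (s t : seq (R[i] * Y)).

Lemma sesq_catl K s s' t : sesq K (s ++ s') t = sesq K s t + sesq K s' t.
Proof. by rewrite /sesq big_cat. Qed.

Lemma sesq_catr K s t t' : sesq K s (t ++ t') = sesq K s t + sesq K s t'.
Proof.
rewrite /sesq -big_split; apply: eq_bigr => a _.
by rewrite big_cat.
Qed.

Definition coef_scale (c : R[i]) s := [seq (c * a.1, a.2) | a <- s].

Lemma sesq_scalel K c s t : sesq K (coef_scale c s) t = c * sesq K s t.
Proof.
rewrite /sesq big_map big_distrr; apply: eq_bigr => a _ /=.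
by rewrite big_distrr; apply: eq_bigr => b _ /=; rewrite !mulrA.
Qed.

Lemma sesq_scaler K c s t : sesq K s (coef_scale c t) = c^c * sesq K s t.
Proof.
rewrite /sesq big_distrr; apply: eq_bigr => a _ /=; rewrite big_map.
by rewrite big_distrr; apply: eq_bigr => b _ /=; rewrite conjcM; ring.
Qed.

Lemma sesq1r K c x s : sesq K s [:: (c, x)] = c^c * \sum_(b <- s) b.1 * K b.2 x.
Proof.
rewrite /sesq big_distrr; apply: eq_bigr => b _ /=.
by rewrite big_seq1; ring.
Qed.

Lemma sesq11 K c d x y : sesq K [:: (c, x)] [:: (d, y)] = c * d^c * K x y.
Proof. by rewrite /sesq !big_seq1. Qed.

Lemma conj_num (z : R[i]) : 0 <= z -> z^c = z.
Proof. by case: z => a b; rewrite lecE /= => /andP[/eqP-> _]; rewrite oppr0. Qed.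

Lemma psd_diag K x : psd K -> 0 <= K x x.
Proof.
by move=> /(_ [:: (1, x)]); rewrite !sesq11 conjc1 !mul1r.
Qed.

(** Polarisation: the form at [s + c t] is real for every [c], and the choices [c = 1] and [c = 'i]
    determine both parts of [sesq K t s]. Hermitian symmetry is thus a consequence of positivity
    over the complex numbers. *)
Lemma psd_hermS K s t : psd K -> sesq K t s = (sesq K s t)^c.
Proof.
move=> pK.
have H c : (sesq K s s + c^c * sesq K s t + c * sesq K t s + c * c^c * sesq K t t)^c
    = sesq K s s + c^c * sesq K s t + c * sesq K t s + c * c^c * sesq K t t.
  have := pK (s ++ coef_scale c t); rewrite sesq_catl !sesq_catr !sesq_scalel.
  rewrite !sesq_scaler => /conj_num h.
  by rewrite (_ : _ + _ = sesq K s s + c^c * sesq K s t + (c * sesq K t s + c * (c^c * sesq K t t)))//; ring.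
have {}H c : c * (sesq K s t)^c + c^c * (sesq K t s)^c = c^c * sesq K s t + c * sesq K t s.
  have := H c; rewrite !conjcD !conjcM !conjcK.
  rewrite !(conj_num (pK _)).
  move=> h; apply: (addrI (sesq K s s)); apply: (addIr (c * c^c * sesq K t t)).
  by rewrite (mulrC c^c c) -!addrA in h; rewrite -!addrA; exact: h.
have h1 := H 1; have h2 := H 'i; rewrite conjc1 !mul1r in h1.
move: h1 h2; case: (sesq K s t) => a b; case: (sesq K t s) => c d h1 h2.
have := congr1 (@complex.Re R) h1; have := congr1 (@complex.Im R) h1.
have := congr1 (@complex.Re R) h2; have := congr1 (@complex.Im R) h2 => /= e1 e2 e3 e4.
by apply/eqP; rewrite eq_complex /=; apply/andP; split; apply/eqP; lra.
Qed.

Lemma psd_herm K x y : psd K -> K y x = (K x y)^c.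
Proof.
move=> /(psd_hermS [:: (1, x)] [:: (1, y)]).
by rewrite !sesq11 conjc1 !mul1r.
Qed.

Lemma psd_CS K s t : psd K ->
  sesq K s t * (sesq K s t)^c <= sesq K s s * sesq K t t.
Proof.
move=> pK; have hst := psd_hermS s t pK.
set p := sesq K s s; set q := sesq K t t; set r := sesq K s t.
have H c d : 0 <= c * c^c * p + c * d^c * r + d * c^c * r^c + d * d^c * q.
  have := pK (coef_scale c s ++ coef_scale d t).
  by rewrite !sesq_catl !sesq_catr !sesq_scalel !sesq_scaler hst -/p -/q -/r !mulrA !addrA.
have p0 : 0 <= p := pK s; have q0 : 0 <= q := pK t.
have [pz|pnz] := eqVneq p 0.
  have [rz|rnz] := eqVneq r 0; first by rewrite rz mul0r mulr_ge0.
  have rr : 0 < r * r^c by rewrite lt_neqAle mulcJ_ge0 andbT eq_sym mulf_neq0// conjc_eq0.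
  exfalso.
  (* With [p = 0] the form is affine in [w]; this value makes it [- (q + 2) < 0]. *)
  pose w := (q + 1) / (r * r^c).
  have w0 : 0 <= w by rewrite mulr_ge0 ?addr_ge0// invr_ge0 ltW.
  have := H (- w * r^c) 1; rewrite pz mulr0 add0r conjc1.
  rewrite !conjcM conjcN conjcK (conj_num w0) !(mulr1,mul1r).
  rewrite (_ : _ + _ = - 2 * (w * (r * r^c)) + q); last by ring.
  rewrite /w divfK ?gt_eqF// (_ : _ + q = - (q + 2)); last by ring.
  have q2 : 0 < q + 2 by rewrite ltr_wpDl// ltr0n.
  by rewrite oppr_ge0 => /(lt_le_trans q2); rewrite ltxx.
have pp : 0 < p by rewrite lt_neqAle eq_sym pnz.
(* The minimiser of the form, up to scaling; the value there is [p (p q - |r|^2)]. *)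
have := H (- r^c) p; rewrite conjcN conjcK (conj_num p0).
rewrite (_ : _ + _ = p * (p * q - r * r^c)); last by ring.
by rewrite pmulr_rge0// subr_ge0.
Qed.

Lemma sesqD K L s t :
  sesq (fun x y => K x y + L x y) s t = sesq K s t + sesq L s t.
Proof.
rewrite /sesq -big_split; apply: eq_bigr => a _; rewrite -big_split.
by apply: eq_bigr => b _; rewrite mulrDr.
Qed.

Lemma sesqZ K c s t : sesq (fun x y => c * K x y) s t = c * sesq K s t.
Proof.
rewrite /sesq big_distrr; apply: eq_bigr => a _; rewrite big_distrr/=.
by apply: eq_bigr => b _; ring.
Qed.

Lemma sesq_rank1 (f g : Y -> R[i]) s t : sesq (fun x y => f x * (g y)^c) s t =
  (\sum_(a <- s) a.1 * f a.2) * (\sum_(a <- t) a.1 * g a.2)^c.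
Proof.
rewrite /sesq conjc_sum big_distrl; apply: eq_bigr => a _; rewrite big_distrr/=.
by apply: eq_bigr => b _; rewrite conjcM; ring.
Qed.

Lemma eq_psd K L : (forall x y, K x y = L x y) -> psd K -> psd L.
Proof.
move=> KL; rewrite (_ : K = L)//.
by apply/funext => x; apply/funext => y.
Qed.

Lemma psdD K L : psd K -> psd L -> psd (fun x y => K x y + L x y).
Proof. by move=> pK pL s; rewrite sesqD addr_ge0. Qed.

Lemma psdZ K c : 0 <= c -> psd K -> psd (fun x y => c * K x y).
Proof. by move=> c0 pK s; rewrite sesqZ mulr_ge0. Qed.

Lemma psd_rank1 (f : Y -> R[i]) : psd (fun x y => f x * (f y)^c).
Proof. by move=> s; rewrite sesq_rank1 mulcJ_ge0. Qed.

Lemma psd0 : psd (fun _ _ : Y => 0).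
Proof. by apply: eq_psd (psd_rank1 (fun=> 0)) => x y; rewrite mul0r. Qed.

Lemma psd_conj_weight K (f : Y -> R[i]) : psd K ->
  psd (fun x y => f x * (f y)^c * K x y).
Proof.
move=> pK s; have := pK [seq (a.1 * f a.2, a.2) | a <- s].
rewrite /sesq big_map; under eq_bigr do rewrite big_map/=.
congr (_ <= _); apply: eq_bigr => a _; apply: eq_bigr => b _ /=.
by rewrite conjcM; ring.
Qed.

Lemma sesq_map (Z : Type) (f : Z -> Y) K (s t : seq (R[i] * Z)) :
  sesq (fun x y => K (f x) (f y)) s t =
  sesq K [seq (a.1, f a.2) | a <- s] [seq (a.1, f a.2) | a <- t].
Proof.
rewrite /sesq big_map; apply: eq_bigr => a _.
by rewrite big_map.
Qed.

End basics.

Lemma psd_pull (Y Z : Type) (f : Z -> Y) (K : Y -> Y -> R[i]) :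
  psd K -> psd (fun x y => K (f x) (f y)).
Proof. by move=> pK s; rewrite sesq_map. Qed.

Section schur.
Variable Y : choiceType.
Implicit Types (K L : Y -> Y -> R[i]).

(* Schur complement of the point [a]; when [K a a = 0] the junk value
   [x / 0 = 0] is harmless since then [K x a = 0]. *)
Lemma psd_schur_complement K a : psd K ->
  psd (fun x y => K x y - K x a * (K y a)^c / K a a).
Proof.
move=> pK s; have ka0 := psd_diag a pK.
rewrite (_ : sesq _ s s = sesq K s s - (K a a)^-1 *
    sesq (fun x y => K x a * (K y a)^c) s s); last first.
  rewrite -sesqZ -[in RHS]mulN1r -sesqZ -sesqD; congr sesq.
  by apply/funext => x; apply/funext => y; rewrite mulN1r mulrC.
have := psd_CS s [:: (1, a)] pK.
rewrite sesq_rank1 !sesq1r !conjc1 !mul1r big_seq1 mul1r /=.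
set r := _ * _; set p := sesq K s s => h.
have [z|nz] := eqVneq (K a a) 0; first by rewrite z invr0 mul0r subr0 pK.
by rewrite subr_ge0 mulrC ler_pdivrMr// lt_neqAle eq_sym nz.
Qed.

(** Schur's product theorem. Schur complements remove the points of the combination one at a time
    and write [K] on them as a sum of rank one kernels; a rank one kernel times [L] is only a
    reweighting of [L]. *)
Lemma psdM K L : psd K -> psd L -> psd (fun x y => K x y * L x y).
Proof.
move=> pK pL s.
pose u := [seq a.2 | a <- s].
have : {subset [seq a.2 | a <- s] <= u} by [].
(* The list [v] holds the points still to be removed: the rows of [K] at all other points of [u]
   already vanish. *)
have : forall v : seq Y, forall K, psd K -> (forall x y, x \in u -> x \notin v -> K x y = 0) ->
    0 <= sesq (fun x y => K x y * L x y) s s.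
  elim=> [|a v IH] {pK}K pK K0.
    rewrite (_ : sesq _ s s = 0)// /sesq big_seq big1// => x xs.
    by rewrite big1// => b _; rewrite K0 ?mul0r ?mulr0//; apply: map_f.
  pose K' x y := K x y - K x a * (K y a)^c / K a a.
  have pK' : psd K' by apply: psd_schur_complement.
  rewrite (_ : sesq _ s s = sesq (fun x y => K' x y * L x y) s s +
      (K a a)^-1 * sesq (fun x y => K x a * (K y a)^c * L x y) s s); last first.
    rewrite -sesqZ -sesqD; congr sesq.
    by apply/funext => x; apply/funext => y; rewrite /K'; ring.
  rewrite addr_ge0//; last first.
    apply: mulr_ge0; first by rewrite invr_ge0; exact: psd_diag.
    exact: (psd_conj_weight (fun x => K x a)).
  apply: IH => // x y xu xv; rewrite /K'.
  have [xa|xa] := eqVneq x a; last first.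
    have nv : x \notin a :: v by rewrite inE negb_or xa.
    by rewrite !(K0 _ _ xu nv) !mul0r subrr.
  rewrite xa; have [z|nz] := eqVneq (K a a) 0.
    have h := psd_CS [:: (1, a)] [:: (1, y)] pK.
    move: h; rewrite !sesq11 conjc1 !mul1r z mul0r.
    move=> h; have /eqP : K a y * (K a y)^c = 0 by apply/eqP; rewrite eq_le h mulcJ_ge0.
    by rewrite mulf_eq0 conjc_eq0 orbb => /eqP->; rewrite mul0r mul0r subrr.
  by rewrite (psd_herm y a pK) mulrAC divff// mul1r subrr.
move=> H _; apply: (H u) => // x y ->.
by [].
Qed.

End schur.
End psd.

(** * Real kernels and Schoenberg theory *)

Section rpsd.
Variable R : realType.

Definition rpsd (Y : Type) (k : Y -> Y -> R) : Prop :=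
  psd (fun x y => (k x y)%:C).

Definition bil (Y : Type) (k : Y -> Y -> R) (s t : seq (R * Y)) : R :=
  \sum_(a <- s) \sum_(b <- t) a.1 * b.1 * k a.2 b.2.

Lemma bilC (Y : Type) (k : Y -> Y -> R) s t : (forall x y, k x y = k y x) ->
  bil k s t = bil k t s.
Proof.
move=> kC; rewrite /bil exchange_big; apply: eq_bigr => a _.
by apply: eq_bigr => b _; rewrite kC (mulrC b.1).
Qed.

Lemma sesq_bil (Y : Type) (k : Y -> Y -> R) (s : seq (R[i] * Y)) :
  let re := [seq (complex.Re a.1, a.2) | a <- s] in
  let im := [seq (complex.Im a.1, a.2) | a <- s] in
  sesq (fun x y => (k x y)%:C) s s =
  (bil k re re + bil k im im) +i* (bil k im re - bil k re im).
Proof.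
move=> re im; rewrite /bil /re /im !big_map.
under [in RHS]eq_bigr do rewrite big_map.
under [X in (_ + X) +i* _]eq_bigr do rewrite big_map.
under [X in _ +i* (X - _)]eq_bigr do rewrite big_map.
under [X in _ +i* (_ - X)]eq_bigr do rewrite big_map.
rewrite -big_split -sumrB /sesq /=.
have E (I : Type) (r : seq I) (f g : I -> R) :
    (\sum_(i <- r) f i) +i* (\sum_(i <- r) g i) = \sum_(i <- r) (f i +i* g i).
  elim: r => [|i r IH]; first by rewrite !big_nil.
  by rewrite !big_cons -IH.
rewrite E; apply: eq_bigr => a _; rewrite -big_split -sumrB E.
apply: eq_bigr => b _ /=; case: a.1 => ? ?; case: b.1 => ? ?.
by apply/eqP; rewrite eq_complex /=; apply/andP; split; apply/eqP; ring.
Qed.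

(** For a symmetric real kernel the cross terms between real and imaginary parts of the coefficients
    cancel, so real coefficients suffice. *)
Lemma rpsdP (Y : Type) (k : Y -> Y -> R) :
  rpsd k <-> (forall x y, k x y = k y x) /\ (forall s, 0 <= bil k s s).
Proof.
split=> [pk|[kC k0] s].
  split=> [x y|s].
    by have /(congr1 (@complex.Re R)) := psd_herm y x pk.
  have := pk [seq (a.1%:C, a.2) | a <- s].
  rewrite sesq_bil -!map_comp /= lecE /= => /andP[_].
  have -> : bil k [seq (0, a.2) | a <- s] [seq (0, a.2) | a <- s] = 0.
    rewrite /bil big_map big1// => a _; rewrite big_map big1// => b _.
    by rewrite !mul0r.
  by rewrite addr0 (_ : map _ s = s)// -[RHS]map_id; apply: eq_map => -[].
by rewrite sesq_bil lecE /= addr_ge0// andbT (bilC _ _ kC) subrr.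
Qed.

Section basics.
Variable Y : choiceType.
Implicit Types k l : Y -> Y -> R.

Lemma eq_rpsd k l : (forall x y, k x y = l x y) -> rpsd k -> rpsd l.
Proof. by move=> kl; apply: eq_psd => x y; rewrite kl. Qed.

Lemma rpsdD k l : rpsd k -> rpsd l -> rpsd (fun x y => k x y + l x y).
Proof.
by move=> pk pl; apply: eq_psd (psdD pk pl) => x y; rewrite rmorphD.
Qed.

Lemma rpsdM k l : rpsd k -> rpsd l -> rpsd (fun x y => k x y * l x y).
Proof.
by move=> pk pl; apply: eq_psd (psdM pk pl) => x y; rewrite rmorphM.
Qed.

Lemma rpsdZ k c : 0 <= c -> rpsd k -> rpsd (fun x y => c * k x y).
Proof.
move=> c0 pk; have c0' : 0 <= c%:C by rewrite lecR.
by apply: eq_psd (psdZ c0' pk) => x y; rewrite rmorphM.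
Qed.

Lemma rpsd_rank1 (f : Y -> R) : rpsd (fun x y => f x * f y).
Proof.
apply: eq_psd (psd_rank1 (fun x => (f x)%:C)) => x y.
by rewrite conjc_real rmorphM.
Qed.

Lemma rpsd_cst c : 0 <= c -> rpsd (fun _ _ : Y => c).
Proof.
move=> c0; apply: eq_rpsd (rpsdZ c0 (rpsd_rank1 (fun=> 1))) => x y.
by rewrite !mulr1.
Qed.

Lemma rpsdX k n : rpsd k -> rpsd (fun x y => k x y ^+ n).
Proof.
move=> pk; elim: n => [|n IH].
  by apply: eq_rpsd (rpsd_cst ler01) => x y; rewrite expr0.
by apply: eq_rpsd (rpsdM pk IH) => x y; rewrite exprS.
Qed.

Lemma rpsd_sum I (r : seq I) (k_ : I -> Y -> Y -> R) :
  (forall i, rpsd (k_ i)) -> rpsd (fun x y => \sum_(i <- r) k_ i x y).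
Proof.
move=> pk; elim: r => [|i r IH].
  by apply: eq_rpsd (rpsd_cst (lexx 0)) => x y; rewrite big_nil.
by apply: eq_rpsd (rpsdD (pk i) IH) => x y; rewrite big_cons.
Qed.

Lemma rpsd_prod I (r : seq I) (k_ : I -> Y -> Y -> R) :
  (forall i, rpsd (k_ i)) -> rpsd (fun x y => \prod_(i <- r) k_ i x y).
Proof.
move=> pk; elim: r => [|i r IH].
  by apply: eq_rpsd (rpsd_cst ler01) => x y; rewrite big_nil.
by apply: eq_rpsd (rpsdM (pk i) IH) => x y; rewrite big_cons.
Qed.

Lemma cvg_sum_seq I (r : seq I) (f : nat -> I -> R) (l : I -> R) :
  (forall i, f ^~ i @ \oo --> l i) ->
  (fun n => \sum_(i <- r) f n i) @ \oo --> \sum_(i <- r) l i.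
Proof.
move=> fl; elim: r => [|i r IH].
  rewrite big_nil; under eq_fun do rewrite big_nil; exact: cvg_cst.
rewrite big_cons; under eq_fun do rewrite big_cons; exact: cvgD.
Qed.

Lemma rpsd_lim (k_ : nat -> Y -> Y -> R) k :
  (forall x y, (fun n => k_ n x y) @ \oo --> k x y) ->
  (forall n, rpsd (k_ n)) -> rpsd k.
Proof.
move=> kk pk; apply/rpsdP; split=> [x y|s].
  have e : (fun n => k_ n x y) = (fun n => k_ n y x).
    by apply/funext => n; have /rpsdP[->] := pk n.
  have <- := cvg_lim (@Rhausdorff R) (kk x y); rewrite e.
  exact: (cvg_lim (@Rhausdorff R) (kk y x)).
have h : (fun n => bil (k_ n) s s) @ \oo --> bil k s s.
  apply: cvg_sum_seq => a; apply: cvg_sum_seq => b.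
  by apply: cvgM; [exact: cvg_cst|exact: kk].
apply: (cvgr_to_ge h); near=> n.
by have /rpsdP[_] := pk n; exact.
Unshelve. all: by end_near. Qed.

(** The exponential series without its constant term has nonnegative coefficients. The form with
    [- 1] lets an exponential dominate the constant kernel [1]. *)
Lemma rpsd_expB1 k : rpsd k -> rpsd (fun x y => expR (k x y) - 1).
Proof.
move=> pk; apply: (@rpsd_lim
  (fun n x y => \sum_(i <- iota 1 n) (i`!%:R)^-1 * k x y ^+ i)).
  move=> x y; rewrite (_ : (fun n => _) =
      (fun n => series (exp_coeff (k x y)) n.+1 - 1)); last first.
    apply/funext => n; rewrite /series/= big_nat_recl//= /exp_coeff/=.
    rewrite expr0 fact0 divr1 addrAC subrr add0r -[1%N]/(1 + 0)%N iotaDl big_map.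
    rewrite /index_iota subn0; apply: eq_bigr => i _.
    by rewrite mulrC.
  apply: cvgB; last exact: cvg_cst.
  rewrite (@cvg_shiftS _ (series (exp_coeff (k x y)))).
  exact: is_cvg_series_exp_coeff.
move=> n; apply: rpsd_sum => i; apply: rpsdZ; first by rewrite invr_ge0.
exact: rpsdX.
Qed.

Lemma rpsd_exp k : rpsd k -> rpsd (fun x y => expR (k x y)).
Proof.
move=> pk; apply: eq_rpsd (rpsdD (rpsd_expB1 pk) (rpsd_cst ler01)) => x y.
by rewrite subrK.
Qed.

End basics.

Lemma rpsd_pull (Y Z : Type) (f : Z -> Y) (k : Y -> Y -> R) :
  rpsd k -> rpsd (fun x y => k (f x) (f y)).
Proof. exact: psd_pull. Qed.

(* [rdom k M f] : [f] belongs to the reproducing kernel Hilbert space of [k],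
   with squared norm at most [M]. *)
Definition rdom (Y : Type) (k : Y -> Y -> R) (M : R) (f : Y -> R) :=
  rpsd (fun x y => M * k x y - f x * f y).

Section rdom.
Variable Y : choiceType.
Implicit Types (k l : Y -> Y -> R) (f g : Y -> R).

(** Telescoping: [M k N l - (f g) (f g)] equals [(M k - f f) N l + f f (N l - g g)]. *)
Lemma rdomM k l M N f g : 0 <= N -> rpsd l -> rdom k M f -> rdom l N g ->
  rdom (fun x y => k x y * l x y) (M * N) (fun x => f x * g x).
Proof.
move=> N0 pl kf lg.
apply: eq_rpsd (rpsdD (rpsdM kf (rpsdZ N0 pl)) (rpsdM (rpsd_rank1 f) lg)) => x y.
ring.
Qed.

(** The mixed terms [f g] are absorbed by the square of [h], at the price of multiplying the two
    hypotheses by [1 + N / M] and [1 + M / N]; these weights produce the constant [M + N]. *)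
Lemma rdomD k l M N f g : 0 < M -> 0 < N -> rdom k M f -> rdom l N g ->
  rdom (fun x y => k x y + l x y) (M + N) (fun x => f x + g x).
Proof.
move=> M0 N0 kf lg.
have a0 : 0 <= M / N by rewrite ltW// divr_gt0.
have b0 : 0 <= N / M by rewrite ltW// divr_gt0.
pose h x := Num.sqrt (N / M) * f x - Num.sqrt (M / N) * g x.
apply: eq_rpsd (rpsdD (rpsdD (rpsdD kf lg) (rpsdD (rpsdZ b0 kf) (rpsdZ a0 lg)))
  (rpsd_rank1 h)) => x y.
rewrite /h; set p := Num.sqrt (N / M); set q := Num.sqrt (M / N).
have pp : p * p = N / M by rewrite -expr2 sqr_sqrtr.
have qq : q * q = M / N by rewrite -expr2 sqr_sqrtr.
have pq : p * q = 1.
  by rewrite -sqrtrM// mulrA divfK ?gt_eqF// divff ?gt_eqF// sqrtr1.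
rewrite (_ : (p * f x - q * g x) * (p * f y - q * g y) =
  (p * p) * (f x * f y) + (q * q) * (g x * g y)
  - (p * q) * (f x * g y + g x * f y)); last by ring.
rewrite pp qq pq; field.
by rewrite !gt_eqF.
Qed.

(** This is the Schur complement at [a] multiplied by [k a a], the squared norm of the section. *)
Lemma rdom_section k a : rpsd k -> rdom k (k a a) (k a).
Proof.
move=> pk; have /rpsdP[kC _] := pk.
have ka0 : 0 <= k a a by have := psd_diag a pk; rewrite ler0c.
have [z|nz] := eqVneq (k a a) 0.
  apply: eq_rpsd (rpsd_cst (lexx 0)) => x y.
  have := psd_CS [:: (1, a)] [:: (1, x)] pk.
  rewrite !sesq11 conjc1 !mul1r z mul0r conjc_real -rmorphM lecR => h.
  have /eqP : k a x * k a x = 0.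
    by apply/eqP; rewrite eq_le h -expr2 sqr_ge0.
  by rewrite mulf_eq0 orbb => /eqP->; rewrite !mul0r subrr.
have kC0 : 0 <= (k a a)%:C by rewrite lecR.
apply: eq_psd (psdZ kC0 (psd_schur_complement a pk)) => x y.
rewrite conjc_real -rmorphM -fmorphV -rmorphM -rmorphB -rmorphM; congr (_%:C).
by rewrite mulrBr (kC x a) (kC y a) mulrCA divff// mulr1.
Qed.

Lemma rdom_lim (k_ : nat -> Y -> Y -> R) (M_ : nat -> R) (f_ : nat -> Y -> R) k M f :
  (forall x y, (fun n => k_ n x y) @ \oo --> k x y) ->
  M_ @ \oo --> M -> (forall x, (fun n => f_ n x) @ \oo --> f x) ->
  (forall n, rdom (k_ n) (M_ n) (f_ n)) -> rdom k M f.
Proof.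
move=> kk MM ff; apply: rpsd_lim => x y.
by apply: cvgB; apply: cvgM.
Qed.

Lemma rdom_prod I (r : seq I) (k_ : I -> Y -> Y -> R) (M_ : I -> R) (f_ : I -> Y -> R) :
  (forall i, 0 <= M_ i) -> (forall i, rpsd (k_ i)) -> (forall i, rdom (k_ i) (M_ i) (f_ i)) ->
  rdom (fun x y => \prod_(i <- r) k_ i x y) (\prod_(i <- r) M_ i)
    (fun x => \prod_(i <- r) f_ i x).
Proof.
move=> M0 pk kf; elim: r => [|i r IH].
  apply: eq_rpsd (rpsd_cst (lexx 0)) => x y.
  by rewrite !big_nil !mul1r subrr.
have P0 : 0 <= \prod_(i <- r) M_ i by apply: prodr_ge0 => j _; exact: M0.
apply: eq_rpsd (rdomM P0 (rpsd_prod r pk) (kf i) IH) => x y.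
by rewrite !big_cons.
Qed.

End rdom.

(* With [t > 0], the function [s |-> sin (b s)] lies in the reproducing kernel
   Hilbert space of [exp (t s s')], as its Taylor coefficients decay fast enough. *)
Lemma rdom_sin_exp (t b : R) : 0 < t -> exists2 M, 0 <= M &
  rdom (fun x y : R => expR (t * (x * y))) M (fun x => sin (b * x)).
Proof.
(* The i-th Taylor term of [sin (b x)] is dominated by [(t x y)^i / i!] with constant at most
   [(B^2 / t)^i / i!], and these constants sum to [exp (B^2 / t)]. The [+ 1] keeps them positive
   when [b = 0], as [rdomD] requires. *)
move=> t0; pose B := `|b| + 1; have B0 : 0 < B by rewrite ltr_wpDl.
pose M := B ^+ 2 / t; have M0 : 0 < M by rewrite divr_gt0// exprn_gt0.
exists (expR M); first exact: expR_ge0.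
have H n : rdom (fun x y : R => series (exp_coeff (t * (x * y))) n.+1)
    (series (exp_coeff M) n.+1) (fun x => series (sin_coeff (b * x)) n.+1).
  have H1 i : rdom (fun x y : R => exp_coeff (t * (x * y)) i) (exp_coeff M i)
      (fun x => sin_coeff (b * x) i).
    pose a : R := (odd i)%:R * (-1) ^+ i.-1./2 * b ^+ i / i`!%:R.
    have a2 : 0 <= B ^+ i.*2 / (i`!%:R ^+ 2) - a ^+ 2.
      rewrite subr_ge0 -[leRHS]ger0_norm; last first.
        by rewrite divr_ge0// exprn_ge0// ltW.
      rewrite -mul2n mulnC exprM -expr_div_n -[leLHS]ger0_norm ?sqr_ge0//.
      rewrite !normrX lerXn2r ?nnegrE// /a !normrM !normfV normr_nat.
      rewrite !normrX normrN1 expr1n mulr1 normr_nat (ger0_norm (ltW B0)).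
      rewrite ler_pM2r ?invr_gt0 ?ltr0n ?fact_gt0//.
      case: odd; rewrite ?mul1r ?mul0r ?exprn_ge0 ?(ltW B0)//.
      by rewrite lerXn2r ?nnegrE// ?(ltW B0)// lerDl.
    apply: eq_rpsd (rpsdZ a2 (rpsd_rank1 (fun x => x ^+ i))) => x y.
    have Es z : sin_coeff (b * z) i = a * z ^+ i.
      by rewrite /sin_coeff /= /a exprMn; ring.
    have EM : exp_coeff M i = B ^+ i.*2 / t ^+ i / i`!%:R.
      by rewrite /exp_coeff /= /M expr_div_n -exprM mul2n.
    have Ek : exp_coeff (t * (x * y)) i = t ^+ i * (x ^+ i * y ^+ i) / i`!%:R.
      by rewrite /exp_coeff /= !exprMn.
    rewrite !Es EM Ek; field.
    by rewrite expf_neq0 ?gt_eqF// pnatr_eq0 -lt0n fact_gt0.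
  elim: n => [|n IH].
    apply: eq_rpsd (H1 0%N) => x y.
    by rewrite /series /= !big_nat1.
  apply: eq_rpsd (rdomD _ _ IH (H1 n.+1)) => [x y||].
  - by rewrite /series /= !(big_nat_recr n.+1).
  - rewrite /series /= big_nat_recl//= ltr_pwDl//.
      by rewrite /exp_coeff /= expr0 divr1.
    by apply: sumr_ge0 => i _; rewrite exp_coeff_ge0// ltW.
  - by rewrite /exp_coeff /= divr_gt0// ?exprn_gt0// ltr0n fact_gt0.
apply: rdom_lim H => [x y||x].
- rewrite (@cvg_shiftS _ (series (exp_coeff (t * (x * y))))).
  exact: is_cvg_series_exp_coeff.
- rewrite (@cvg_shiftS _ (series (exp_coeff M))).
  exact: is_cvg_series_exp_coeff.
- rewrite (@cvg_shiftS _ (series (sin_coeff (b * x)))) sin.unlock.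
  exact: is_cvg_series_sin_coeff.
Qed.

(** Splitting off the direction of [a]: [k = s s + rest] with [s = k(.,a) / sqrt (k a a)] and [rest]
    positive definite. Since [e^(t rest) - 1] is positive definite, [e^(t k)] dominates [e^(t s s)],
    to which the one-dimensional [rdom_sin_exp] applies. *)
Lemma rdom_sin (Y : choiceType) (k : Y -> Y -> R) (a : Y) (t b : R) :
  0 < t -> rpsd k -> exists2 M, 0 <= M &
  rdom (fun x y => expR (t * k x y)) M (fun x => sin (b * k x a)).
Proof.
move=> t0 pk; have /rpsdP[kC _] := pk.
have ka0 : 0 <= k a a by have := psd_diag a pk; rewrite ler0c.
have tk : rpsd (fun x y => t * k x y) by apply: rpsdZ => //; exact: ltW.
have [z|nz] := eqVneq (k a a) 0.
  exists 1 => //; apply: eq_rpsd (rpsd_exp tk) => x y.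
  have := psd_CS [:: (1, a)] [:: (1, x)] pk.
  rewrite !sesq11 conjc1 !mul1r z mul0r conjc_real -rmorphM lecR => h.
  have /eqP : k a x * k a x = 0.
    by apply/eqP; rewrite eq_le h -expr2 sqr_ge0.
  by rewrite mulf_eq0 orbb => /eqP e; rewrite (kC x a) e mulr0 sin0 mul0r subr0.
have kp : 0 < k a a by rewrite lt_neqAle eq_sym nz.
pose r := Num.sqrt (k a a); have r0 : 0 < r by rewrite sqrtr_gt0.
have rr : r * r = k a a by rewrite -expr2 sqr_sqrtr.
have [M M0 HM] := rdom_sin_exp (b * r) t0.
exists M => //; pose s x := k x a / r.
have ps : rpsd (fun x y => expR (t * (s x * s y))).
  by apply: rpsd_exp; apply: rpsdZ; [exact: ltW|exact: rpsd_rank1].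
have pk' : rpsd (fun x y => t * (k x y - s x * s y)).
  have tka : 0 <= t / k a a by rewrite divr_ge0// ltW.
  apply: eq_rpsd (rpsdZ tka (rdom_section a pk)) => x y.
  rewrite /s (kC x a) (kC y a) -rr; field.
  by rewrite gt_eqF.
apply: eq_rpsd (rpsdD (rpsdZ M0 (rpsdM ps (rpsd_expB1 pk'))) (rpsd_pull s HM)) => x y.
rewrite mulrBr mulr1 -expRD /s.
rewrite (_ : t * _ + t * _ = t * k x y); last by ring.
rewrite (_ : b * r * (k x a / r) = b * k x a); last by field; rewrite gt_eqF.
rewrite (_ : b * r * (k y a / r) = b * k y a); last by field; rewrite gt_eqF.
ring.
Qed.

(** * Conditionally negative definite kernels *)

Section cnd.
Variables (X : choiceType) (gamma : X -> X -> R).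
Hypothesis gamma_cnd : cond_neg_def_kernel gamma.

Lemma cnd_bil (s : seq (R * X)) : \sum_(a <- s) a.1 = 0 -> bil gamma s s <= 0.
Proof.
move=> s0; set u := undup [seq a.2 | a <- s].
pose c y := \sum_(a <- s | a.2 == y) a.1.
have E (f : X -> R) : \sum_(a <- s) a.1 * f a.2 = \sum_(y <- u) c y * f y.
  rewrite big_undup_snd; apply: eq_bigr => y _; rewrite /c big_distrl.
  by apply: eq_bigr => a /eqP->.
have -> : bil gamma s s = \sum_(y <- u) \sum_(z <- u) c y * c z * gamma y z.
  rewrite /bil; under eq_bigr => a _.
    under eq_bigr do rewrite -mulrA; rewrite -big_distrr/=.
    rewrite (E (fun y => gamma a.2 y)); over.
  rewrite (E (fun y => \sum_(z <- u) c z * gamma y z)); apply: eq_bigr => y _.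
  by rewrite big_distrr/=; apply: eq_bigr => z _; rewrite mulrA.
have : \sum_(y <- u) c y = 0 by apply: etrans s0; rewrite (big_undup_snd s fst).
have : uniq u by exact: undup_uniq.
case: (u) => [|y0 t]; first by rewrite !big_nil.
move=> tu; rewrite !(big_nth y0) !big_mkord => c0.
under eq_bigr do rewrite (big_nth y0) big_mkord.
apply: (gamma_cnd.2 _ (fun i : 'I_(size (y0 :: t)) => nth y0 (y0 :: t) i) (fun i => c _)) => // i j.
by move/eqP; rewrite nth_uniq// => /eqP/val_inj.
Qed.

(* Schoenberg: the Gram kernel of the embedding of [(X, gamma)] based at [w]. *)
Definition cnd_gram (w u v : X) : R :=
  gamma u w + gamma v w - gamma u v - gamma w w.

(** Adding the point [w] with minus the sum of the coefficients makes a combination neutral, and the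
    form of [gamma] on the enlarged combination is exactly minus the form of the Gram kernel. *)
Lemma rpsd_cnd_gram w : rpsd (cnd_gram w).
Proof.
have gC := gamma_cnd.1; apply/rpsdP; split=> [x y|s].
  by rewrite /cnd_gram (gC x y); ring.
pose S := \sum_(a <- s) a.1; pose T := \sum_(a <- s) a.1 * gamma a.2 w.
have := @cnd_bil ((- S, w) :: s); rewrite big_cons addrC subrr => /(_ erefl).
have -> : bil gamma ((- S, w) :: s) ((- S, w) :: s) =
    S * S * gamma w w - 2 * S * T + bil gamma s s.
  rewrite /bil big_cons big_cons/=.
  under [X in _ + X]eq_bigr do rewrite big_cons/=.
  rewrite big_split/=.
  have -> : \sum_(j <- s) (- S) * j.1 * gamma w j.2 = - S * T.
    by rewrite big_distrr/=; apply: eq_bigr => a _; rewrite gC mulrA.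
  have -> : \sum_(j <- s) j.1 * (- S) * gamma j.2 w = - S * T.
    by rewrite big_distrr/=; apply: eq_bigr => a _; ring.
  by ring.
have -> : bil (cnd_gram w) s s = 2 * S * T - bil gamma s s - S * S * gamma w w.
  have E1 : \sum_(a <- s) \sum_(b <- s) a.1 * b.1 * gamma a.2 w = S * T.
    rewrite mulrC /T big_distrl/=; apply: eq_bigr => a _; rewrite big_distrr/=.
    by apply: eq_bigr => b _; ring.
  have E2 : \sum_(a <- s) \sum_(b <- s) a.1 * b.1 * gamma b.2 w = S * T.
    rewrite big_distrl/=; apply: eq_bigr => a _; rewrite big_distrr/=.
    by apply: eq_bigr => b _; ring.
  have E3 : \sum_(a <- s) \sum_(b <- s) a.1 * b.1 * gamma w w = S * S * gamma w w.
    rewrite /S -mulrA big_distrl/=; apply: eq_bigr => a _.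
    rewrite big_distrl big_distrr/=.
    by apply: eq_bigr => b _; ring.
  rewrite [2 * S * T](_ : _ = S * T + S * T); last by ring.
  rewrite -[X in X + _ - _ - _]E1 -E2 -E3 -big_split/= -!sumrB; apply: eq_bigr => a _.
  rewrite -big_split/= -!sumrB; apply: eq_bigr => b _.
  by rewrite /cnd_gram; ring.
lra.
Qed.

Lemma exp_cndE (t : R) w u v : expR (- (t * gamma u v)) =
  expR (t * gamma w w) * (expR (- (t * gamma u w)) * expR (- (t * gamma v w))) *
  expR (t * cnd_gram w u v).
Proof. by rewrite -!expRD /cnd_gram; congr expR; ring. Qed.

Lemma rpsd_exp_cnd (t : R) : 0 <= t -> rpsd (fun u v => expR (- (t * gamma u v))).
Proof.
move=> t0; apply/rpsdP; split=> [x y|s]; first by rewrite gamma_cnd.1.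
(* The base point of the Gram kernel is taken from the combination being tested. *)
case: s => [|[c w] s]; first by rewrite /bil big_nil.
have /rpsdP[_] : rpsd (fun u v => expR (- (t * gamma u v))); last exact.
apply: eq_rpsd (rpsdM (rpsdZ (expR_ge0 (t * gamma w w)) (rpsd_rank1 (fun u => expR (- (t * gamma u w)))))
  (rpsd_exp (rpsdZ t0 (rpsd_cnd_gram w)))) => u v.
by rewrite (exp_cndE t w u v).
Qed.

(** The Gram kernel based at [v] is nonnegative at [(u, u)]. This spreads a lower bound on the
    diagonal of [gamma] to all pairs. *)
Lemma cnd_diag_le u v : gamma u u + gamma v v <= 2 * gamma u v.
Proof.
have := psd_diag u (rpsd_cnd_gram v); rewrite /cnd_gram lecR.
lra.
Qed.

End cnd.
End rpsd.

(** * The Fourier transform of the Gaussian *)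

Section dct.
Context d (T : measurableType d) (R : realType) (mu : {measure set T -> \bar R}).

Lemma Rintegral_dct (f_ : nat -> T -> R) (f g : T -> R) :
  (forall n, measurable_fun setT (f_ n)) -> measurable_fun setT f ->
  (forall x, (fun n => f_ n x) @ \oo --> f x) ->
  mu.-integrable setT (EFin \o g) -> (forall n x, `|f_ n x| <= g x) ->
  mu.-integrable setT (EFin \o f) /\
  (fun n => \int[mu]_x f_ n x) @ \oo --> \int[mu]_x f x.
Proof.
move=> mf_ mf ff ig fg.
have [|||||i_f _ h] := @dominated_convergence _ _ _ mu setT measurableT
  (fun n => EFin \o f_ n) (EFin \o f) (EFin \o g).
- by move=> n; apply/measurable_EFinP.
- exact/measurable_EFinP.
- by apply: aeW => x _; apply: cvg_EFin; [exact: nearW|exact: ff].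
- exact: ig.
- by apply: aeW => x n _; rewrite lee_fin.
split => //; apply: fine_cvg; rewrite fineK//; exact: integrable_fin_num.
Qed.

End dct.

Section gauss_fourier.
Variable R : realType.
Local Notation mu := (@lebesgue_measure R).

Lemma derive_continuous (f f' : R -> R) :
  (forall x, is_derive x (1 : R) f (f' x)) -> continuous f.
Proof.
move=> df x; apply/differentiable_continuous/derivable1_diffP.
by have [] := df x.
Qed.

Lemma derive_LRcontinuous (f f' : R -> R) (a b : R) :
  (forall x, is_derive x (1 : R) f (f' x)) -> derivable_oo_LRcontinuous f a b.
Proof.
move=> df; have cf := derive_continuous df; split.
- by move=> x _; have [] := df x.
- by apply: cvg_at_right_filter; exact: cf.
- by apply: cvg_at_left_filter; exact: cf.
Qed.

Variable g : R.
Hypothesis g0 : 0 < g.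

Let gs (s : R) := expR (- (g * s ^+ 2)).

(** With variance [1 / (2 g)] the normal density is [sqrt (g / pi)] times [gs], which gives
    integrability and the total integral. *)
Let sigma := Num.sqrt ((g *+ 2)^-1).

Let sigma0 : sigma != 0.
Proof. by rewrite gt_eqF// sqrtr_gt0 invr_gt0 mulrn_wgt0. Qed.

Let sigma2 : sigma ^+ 2 = (g *+ 2)^-1.
Proof. by rewrite sqr_sqrtr// invr_ge0 mulrn_wge0// ltW. Qed.

Let normal_gs s : normal_pdf 0 sigma s = Num.sqrt (g / pi) * gs s.
Proof.
rewrite normal_pdfE// /normal_peak /normal_fun sigma2 subr0; congr (_ * _).
  rewrite -sqrtrV; last by rewrite mulrn_wge0// mulr_ge0 ?pi_ge0// invr_ge0 mulrn_wge0// ltW.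
  congr Num.sqrt; move: (pi : R) (pi_gt0 R) => p p0; rewrite !mulr2n; field.
  by rewrite !gt_eqF// addr_gt0.
congr expR; rewrite !mulr2n; field.
by rewrite !gt_eqF// addr_gt0.
Qed.

Let gpi0 : 0 < Num.sqrt (g / pi).
Proof. by rewrite sqrtr_gt0 divr_gt0// pi_gt0. Qed.

Lemma integrable_gauss : mu.-integrable setT (EFin \o (fun s => expR (- (g * s ^+ 2)))).
Proof.
have := integrableZl measurableT (Num.sqrt (g / pi))^-1 (integrable_normal_pdf 0 sigma).
apply: eq_integrable => // x _ /=.
by rewrite normal_gs -EFinM mulKf// gt_eqF.
Qed.

Lemma Rintegral_gauss : \int[mu]_s expR (- (g * s ^+ 2)) = Num.sqrt (pi / g).
Proof.
have := integral_normal_pdf 0 sigma.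
under eq_integral do rewrite normal_gs EFinM.
rewrite integralZl//; last exact: integrable_gauss.
move=> /(congr1 fine); rewrite fineM//; last exact: integrable_fin_num integrable_gauss.
rewrite -/(Rintegral _ _ _) /= => h.
rewrite -[RHS]mulr1 -h mulrA -sqrtrM; last by rewrite divr_ge0 ?pi_ge0// ltW.
rewrite (_ : pi / g * (g / pi) = 1) ?sqrtr1 ?mul1r//.
move: (pi : R) (pi_gt0 R) => p p0; field.
by rewrite !gt_eqF.
Qed.

Lemma integrable_dom_gauss (f : R -> R) (c : R) : measurable_fun setT f ->
  (forall s, `|f s| <= c * expR (- (g * s ^+ 2))) -> mu.-integrable setT (EFin \o f).
Proof.
move=> mf fc.
apply: (le_integrable measurableT _ _ (integrableZl measurableT c integrable_gauss)).
  exact/measurable_EFinP.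
move=> s _ /=; rewrite lee_fin (le_trans (fc s))//.
by rewrite ler_norm.
Qed.

End gauss_fourier.

Section gauss_fourier2.
Variable R : realType.
Local Notation mu := (@lebesgue_measure R).
Variable g : R.
Hypothesis g0 : 0 < g.

Let G z (s : R) := expR (- (g * s ^+ 2)) * cos (2 * s * z).
Let G' z (s : R) := - (2 * s * (expR (- (g * s ^+ 2)) * sin (2 * s * z))).

Let derG z s : is_derive z (1 : R) (G ^~ s) (G' z s).
Proof. by apply: is_derive_eq; rewrite /GRing.scale/= /G'; ring. Qed.

Let contG z : continuous (G z).
Proof.
apply: derive_continuous.
Qed.

Let contG' z : continuous (G' z).
Proof.
apply: derive_continuous.
Qed.

Let G_le z s : `|G z s| <= 1 * expR (- (g * s ^+ 2)).
Proof.
rewrite /G normrM ger0_norm ?expR_ge0// mulrC ler_wpM2r ?expR_ge0//.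
by rewrite ler_norml cos_geN1 cos_le1.
Qed.

Lemma integrable_gauss_cos z : mu.-integrable setT (EFin \o (fun s => expR (- (g * s ^+ 2)) * cos (2 * s * z))).
Proof.
apply: (integrable_dom_gauss g0 _ (G_le z)).
by apply: continuous_measurable_fun; exact: contG.
Qed.

(** Half of the Gaussian absorbs the factor [s]: with [e = exp (- g s^2 / 2)] one has
    [|s| <= 1 + s^2], [e <= 1] and [s^2 e <= 2 / g]. *)
Let c : R := 2 * (1 + 2 / g).

Let G'_le z s : `|G' z s| <= c * expR (- (g / 2 * s ^+ 2)).
Proof.
set e := expR (- (g / 2 * s ^+ 2)); have e0 : 0 < e by apply: expR_gt0.
have ee : expR (- (g * s ^+ 2)) = e * e by rewrite -expRD; congr expR; field.
rewrite /G' ee normrN !normrM (ger0_norm (ltW e0)) (ger0_norm (ler0n R 2)).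
have h1 : 1 + g / 2 * s ^+ 2 <= e^-1.
  by rewrite /e expRN invrK; exact: expR_ge1Dx.
have h2 : `|s| <= 1 + s ^+ 2.
  have := sqr_ge0 (`|s| - 1); rewrite -(real_normK (num_real s)).
  have := normr_ge0 s; nra.
have h3 : s ^+ 2 <= 2 / g * e^-1.
  rewrite (_ : 2 / g * e^-1 = 2 * e^-1 / g); last by ring.
  by rewrite (ler_pdivlMr _ _ g0); move: h1; lra.
have h4 : 1 <= e^-1.
  by apply: le_trans h1; rewrite lerDl mulr_ge0 ?sqr_ge0// divr_ge0// ltW.
have h5 : `|s| * e <= 1 + 2 / g.
  by rewrite -ler_pdivlMr// (le_trans h2)// mulrDl mul1r lerD.
have h6 : `|sin (2 * s * z)| <= 1 by rewrite ler_norml sin_geN1 sin_le1.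
move: h6; move: `|sin _| (normr_ge0 (sin (2 * s * z))) => w w0 h6.
rewrite (_ : 2 * `|s| * _ = (2 * e) * (`|s| * e * w)); last by ring.
rewrite /c (_ : 2 * _ * e = (2 * e) * (1 + 2 / g)); last by ring.
rewrite ler_pM2l ?mulr_gt0//; apply: le_trans h5.
by rewrite ler_piMr// mulr_ge0// ltW.
Qed.

Let g20 : 0 < g / 2. Proof. by rewrite divr_gt0. Qed.

Let integrableG' z : mu.-integrable setT (EFin \o G' z).
Proof.
apply: (integrable_dom_gauss g20 _ (G'_le z)).
by apply: continuous_measurable_fun; exact: contG'.
Qed.

Let F z := \int[mu]_s G z s.

Let derF z : is_derive z (1 : R) F (\int[mu]_s G' z s).
Proof.
have Iz : [set` `]z - 1, z + 1[] z by rewrite /= in_itv/=; lra.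
have E x y : partial1of2 G x y = G' x y.
  by rewrite partial1of2E; have [_ ->] := derG x y.
have H1 : forall x, [set` `]z - 1, z + 1[] x -> mu.-integrable setT (EFin \o G x).
  by move=> x _; exact: integrable_gauss_cos.
have H2 : forall x y, [set` `]z - 1, z + 1[] x -> [set: R] y -> derivable (G ^~ y) x 1.
  by move=> x y _ _; have [] := derG x y.
have H3 : forall y : R, 0 <= c * expR (- (g / 2 * y ^+ 2)).
  by move=> y; apply: le_trans (G'_le 0 y).
have H4 : mu.-integrable setT (EFin \o (fun y => c * expR (- (g / 2 * y ^+ 2)))).
  exact: (integrableZl measurableT c (integrable_gauss g20)).
have H5 : forall x y, [set` `]z - 1, z + 1[] x -> [set: R] y ->
    `|partial1of2 G x y| <= c * expR (- (g / 2 * y ^+ 2)).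
  by move=> x y _ _; rewrite E.
split; first exact: (derivable_under_integral measurableT Iz H1 H2 H3 H4 H5).
rewrite -derive1E (differentiation_under_integral measurableT Iz H1 H2 H3 H4 H5).
by apply: eq_Rintegral => y _; rewrite -E.
Qed.

(** A primitive in [s] of [g G' + 2 z G]; as it vanishes at infinity, it performs the integration by
    parts behind the differential equation for [F]. *)
Let P z (s : R) := expR (- (g * s ^+ 2)) * sin (2 * s * z).

Let derP z s : is_derive s (1 : R) (P z) (g * G' z s + 2 * z * G z s).
Proof. by apply: is_derive_eq; rewrite /GRing.scale/= /G' /G; ring. Qed.

Let intP z : mu.-integrable setT (EFin \o (fun s => g * G' z s + 2 * z * G z s)).
Proof.
have := integrableD measurableT (integrableZl measurableT g (integrableG' z))
  (integrableZl measurableT (2 * z) (integrable_gauss_cos z)).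
exact: eq_integrable.
Qed.

Let by_parts z : \int[mu]_s (g * G' z s + 2 * z * G z s) = 0.
Proof.
set h := fun s => g * G' z s + 2 * z * G z s.
have ch : continuous h.
  by move=> s; apply: cvgD; apply: cvgM; first [exact: cvg_cst|exact: contG'|exact: contG].
have mh : measurable_fun setT h by exact: continuous_measurable_fun.
pose I n := `[- n.+1%:R, n.+1%:R : R]%classic.
have := @Rintegral_dct _ _ _ mu (fun n => h \_ (I n)) h (fun s => `|h s|).
case => //.
- move=> n; apply/(measurable_restrictT _ _).1.
    exact: measurable_itv.
  exact: measurable_funTS.
- move=> s; apply: cvg_near_cst; near=> n; rewrite patchE mem_set// /I /= in_itv/=.
  rewrite -ler_norml; apply: (@le_trans _ _ n%:R); last by rewrite ler_nat.
  by near: n; exact: nbhs_infty_ger.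
- exact: (integrable_norm (intP z)).
- by move=> n s; rewrite patchE; case: ifP => // _; rewrite normr0.
move=> _ /(cvg_lim (@Rhausdorff R)) <-; apply: cvg_lim; first exact: Rhausdorff.
have E n : \int[mu]_s (h \_ (I n)) s = 2 * P z n.+1%:R.
  rewrite -Rintegral_mkcond /Rintegral.
  rewrite (@continuous_FTC2 _ h (P z)).
  - by rewrite /= /P sqrrN mulrN mulNr sinN; ring.
  - by rewrite ltrN10 || (rewrite (@lt_trans _ _ 0)// ?oppr_lt0 ltr0n).
  - exact: continuous_subspaceT.
  - exact: (derive_LRcontinuous _ _ (derP z)).
  - by move=> s _; rewrite derive1E; have [_ ->] := derP z s.
under eq_fun do rewrite E.
(* The crude bound [exp (- g N^2) <= 1 / (g N)] with [N = n + 1] already makes the boundary terms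
   tend to zero. *)
apply: (@squeeze_cvgr _ _ _ _ (fun n => - (2 / g) * harmonic n) (fun n => (2 / g) * harmonic n)).
- near=> n; rewrite mulNr -ler_norml normrM ger0_norm// -mulrA ler_pM2l//.
  rewrite /P normrM (ger0_norm (expR_ge0 _)) /harmonic/=.
  rewrite (@le_trans _ _ (expR (- (g * n.+1%:R ^+ 2))))//.
    by rewrite ler_piMr ?expR_ge0// ler_norml sin_geN1 sin_le1.
  rewrite expRN -invfM lef_pV2 ?posrE ?expR_gt0 ?mulr_gt0 ?ltr0n//.
  apply: le_trans (expR_ge1Dx _).
  rewrite ler_wpDl// ler_pM2l// expr2 ler_peMr//; last by rewrite ler1n.
- rewrite -[X in _ --> X](mulr0 (- (2 / g))); apply: cvgM; [exact: cvg_cst|exact: cvg_harmonic].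
- rewrite -[X in _ --> X](mulr0 (2 / g)); apply: cvgM; [exact: cvg_cst|exact: cvg_harmonic].
Unshelve. all: by end_near. Qed.

(** The integral [F] satisfies [F' = - (2 z / g) F], so [F e^(z^2 / g)] is constant, and its value
    at [0] is the Gaussian integral. *)
Lemma gauss_fourier z :
  \int[mu]_s (expR (- (g * s ^+ 2)) * cos (2 * s * z)) =
  Num.sqrt (pi / g) * expR (- (z ^+ 2 / g)).
Proof.
rewrite -/(F z).
have dF x : is_derive x (1 : R) F (- (2 * x / g) * F x).
  have -> : - (2 * x / g) * F x = \int[mu]_s G' x s; last exact: derF.
  have := by_parts x.
  rewrite RintegralD//.
  - rewrite !RintegralZl//; last exact: integrable_gauss_cos.
    rewrite -/(F x) => h; apply: (mulfI (lt0r_neq0 g0)).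
    have -> : g * (- (2 * x / g) * F x) = - (2 * x * F x).
      by field; rewrite gt_eqF.
    by rewrite -(addr0_eq h) opprK.
  - exact: (integrableZl measurableT g (integrableG' x)).
  - exact: (integrableZl measurableT (2 * x) (integrable_gauss_cos x)).
pose H x := F x * expR (x ^+ 2 / g).
have dH x : is_derive x (1 : R) H 0.
  have := dF x => dFx.
  by apply: is_derive_eq; rewrite /GRing.scale/=; field; rewrite gt_eqF.
have := is_derive_0_is_cst z 0 dH; rewrite /H expr0n/= mul0r expR0 mulr1.
have -> : F 0 = Num.sqrt (pi / g).
  rewrite -(Rintegral_gauss g0) /F; apply: eq_Rintegral => s _.
  by rewrite /G mulr0 cos0 mulr1.
move=> <-; rewrite -mulrA -expRD subrr expR0 mulr1.
by [].
Qed.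

End gauss_fourier2.

(** * Frequency windows *)

Section rpsd_integral.
Context d (T : measurableType d) (R : realType) (mu : {measure set T -> \bar R}).
Variables (Y : choiceType) (h : T -> Y -> Y -> R) (D : set T).
Hypothesis mD : measurable D.
Hypothesis ih : forall x y, mu.-integrable D (EFin \o (fun s => h s x y)).

Let integrable_sum I (r : seq I) (f : I -> T -> R) :
  (forall i, mu.-integrable D (EFin \o f i)) ->
  mu.-integrable D (EFin \o (fun s => \sum_(i <- r) f i s)) /\
  \int[mu]_(s in D) (\sum_(i <- r) f i s) = \sum_(i <- r) \int[mu]_(s in D) f i s.
Proof.
move=> fi; elim: r => [|i r [IH1 IH2]].
  rewrite big_nil (_ : (fun _ => _) = cst 0); last by apply/funext => s; rewrite big_nil.
  split; first exact: integrable0.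
  by rewrite Rintegral_cst// mul0r.
have E : (fun s => \sum_(j <- i :: r) f j s) = (fun s => f i s + \sum_(j <- r) f j s).
  by apply/funext => s; rewrite big_cons.
rewrite E big_cons; split; first exact: (integrableD mD (fi i) IH1).
by rewrite RintegralD// IH2.
Qed.

Lemma rpsd_Rintegral : (forall s, D s -> rpsd (h s)) ->
  rpsd (fun x y => \int[mu]_(s in D) h s x y).
Proof.
move=> ph; apply/rpsdP; split=> [x y|l].
  by apply: eq_Rintegral => s /set_mem Ds; have /rpsdP[->] := ph s Ds.
have H (a b : R * Y) : mu.-integrable D (EFin \o (fun s => a.1 * b.1 * h s a.2 b.2)).
  exact: (integrableZl mD (a.1 * b.1) (ih _ _)).
have H' (a : R * Y) : mu.-integrable D (EFin \o (fun s => \sum_(b <- l) a.1 * b.1 * h s a.2 b.2)).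
  by have [] := integrable_sum l (H a).
rewrite (_ : bil _ _ _ = \int[mu]_(s in D) bil (h s) l l); last first.
  rewrite (integrable_sum l H').2; apply: eq_bigr => a _.
  rewrite (integrable_sum l (H a)).2; apply: eq_bigr => b _.
  by rewrite RintegralZl.
by apply: Rintegral_ge0 => s Ds; have /rpsdP[_] := ph s Ds.
Qed.

End rpsd_integral.

Section lipschitz.
Variable R : realType.

Lemma expRN_lip (a b : R) : 0 <= a -> 0 <= b -> `|expR (- a) - expR (- b)| <= `|a - b|.
Proof.
wlog ab : a b / a <= b => [H a0 b0|a0 b0].
  have [ab|/ltW ab] := leP a b; first exact: H.
  by rewrite distrC (distrC a); exact: H.
rewrite ger0_norm; last by rewrite subr_ge0 ler_expR lerN2.
rewrite distrC ger0_norm ?subr_ge0//.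
have h := expR_ge1Dx (a - b).
have -> : expR (- b) = expR (- a) * expR (a - b) by rewrite -expRD; congr expR; ring.
have e1 : expR (- a) <= 1 by rewrite -expR0 ler_expR oppr_le0.
have e0 := expR_ge0 (- a).
have e2 : expR (a - b) <= 1 by rewrite -expR0 ler_expR subr_le0.
nra.
Qed.

Lemma cos_lip (a b : R) : `|cos a - cos b| <= `|a - b|.
Proof.
wlog ab : a b / a <= b => [H|].
  have [ab|/ltW ab] := leP a b; first exact: H.
  by rewrite distrC (distrC a); exact: H.
rewrite distrC (distrC a).
have dcos (x : R) : is_derive x (1 : R) cos (- sin x) by exact: is_derive_cos.
have cc : {within `[a, b], continuous (@cos R)}.
  by apply: continuous_subspaceT; exact: (derive_continuous dcos).
have [c _ ->] := MVT_segment ab (fun x _ => dcos x) cc.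
rewrite normrM normrN ler_piMl//.
by rewrite ler_norml sin_geN1 sin_le1.
Qed.

End lipschitz.

Section wave.
Variable R : realType.
Local Notation mu := (@lebesgue_measure R).

Definition wave (s g z : R) := expR (- (g * s ^+ 2)) * cos (2 * s * z).

Lemma wave_le1 s g z : 0 <= g -> `|wave s g z| <= 1.
Proof.
move=> g0; rewrite /wave normrM (ger0_norm (expR_ge0 _)).
have h1 : expR (- (g * s ^+ 2)) <= 1.
  by rewrite -expR0 ler_expR oppr_le0 mulr_ge0// sqr_ge0.
have h2 : `|cos (2 * s * z)| <= 1 by rewrite ler_norml cos_geN1 cos_le1.
by rewrite mulr_ile1// expR_ge0.
Qed.

(** The addition formula writes the cosine of a difference as a sum of two rank one kernels. *)
Lemma rpsd_wave (Y : choiceType) (G : Y -> Y -> R) (x : Y -> R) (s : R) :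
  (forall t, 0 <= t -> rpsd (fun p q => expR (- (t * G p q)))) ->
  rpsd (fun p q => wave s (G p q) (x p - x q)).
Proof.
move=> pG; apply: eq_rpsd (rpsdM (pG _ (sqr_ge0 s))
  (rpsdD (rpsd_rank1 (fun p => cos (2 * s * x p)))
         (rpsd_rank1 (fun p => sin (2 * s * x p))))) => p q.
by rewrite /wave (mulrC (G p q)) mulrBr cosB.
Qed.

Lemma wave_continuous g z : continuous (wave ^~ g ^~ z).
Proof. exact: derive_continuous. Qed.

Lemma wave_lip (c s g g' z z' : R) : `|s| <= c -> 0 <= g -> 0 <= g' ->
  `|wave s g z - wave s g' z'| <= (c ^+ 2 + 2 * c) * (`|g - g'| + `|z - z'|).
Proof.
move=> sc g0 g0'; have c0 : 0 <= c by apply: le_trans sc.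
have -> : wave s g z - wave s g' z' =
   (expR (- (g * s ^+ 2)) - expR (- (g' * s ^+ 2))) * cos (2 * s * z) +
   expR (- (g' * s ^+ 2)) * (cos (2 * s * z) - cos (2 * s * z')).
  by rewrite /wave; ring.
apply: le_trans (ler_normD _ _) _; rewrite !normrM.
have h1 : `|expR (- (g * s ^+ 2)) - expR (- (g' * s ^+ 2))| <= c ^+ 2 * `|g - g'|.
  have p1 : 0 <= g * s ^+ 2 by rewrite mulr_ge0// sqr_ge0.
  have p2 : 0 <= g' * s ^+ 2 by rewrite mulr_ge0// sqr_ge0.
  apply: le_trans (expRN_lip p1 p2) _.
  rewrite -mulrBl normrM mulrC ler_wpM2r// normrX.
  by rewrite lerXn2r ?nnegrE.
have h2 : `|cos (2 * s * z) - cos (2 * s * z')| <= 2 * c * `|z - z'|.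
  apply: le_trans (cos_lip _ _) _; rewrite -mulrBr normrM ler_wpM2r//.
  by rewrite normrM (ger0_norm (ler0n R 2)) ler_pM2l.
have h3 : `|cos (2 * s * z)| <= 1 by rewrite ler_norml cos_geN1 cos_le1.
have h4 : `|expR (- (g' * s ^+ 2))| <= 1.
  by rewrite ger0_norm ?expR_ge0// -expR0 ler_expR oppr_le0 mulr_ge0// sqr_ge0.
apply: (@le_trans _ _ (c ^+ 2 * `|g - g'| + 2 * c * `|z - z'|)).
  apply: lerD.
    by rewrite -[leRHS]mulr1 ler_pM.
  by rewrite -[leRHS]mul1r ler_pM.
rewrite mulrDr; have := normr_ge0 (g - g'); have := normr_ge0 (z - z').
have := sqr_ge0 c; nra.
Qed.

(* Averages of [wave] over short frequency windows belong to the kernel whose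
   spectral density is the Gaussian, while a single frequency does not. *)
Definition window (s0 d g z : R) := \int[mu]_(s in `[s0, s0 + d]) wave s g z.

Variables (s0 d : R).
Hypothesis d0 : 0 < d.

Lemma integrable_wave_itv g z :
  mu.-integrable `[s0, s0 + d] (EFin \o (fun s => wave s g z)).
Proof.
apply: continuous_compact_integrable; first exact: segment_compact.
by apply: continuous_subspaceT; exact: wave_continuous.
Qed.

Lemma Rintegral_itv_le (f : R -> R) (c : R) :
  mu.-integrable `[s0, s0 + d] (EFin \o f) ->
  (forall s, s0 <= s <= s0 + d -> `|f s| <= c) ->
  `|\int[mu]_(s in `[s0, s0 + d]) f s| <= c * d.
Proof.
move=> fi fc; have E : fine (@lebesgue_measure R `[s0, s0 + d]%classic) = d.
  by rewrite lebesgue_measure_itv/= lte_fin ltrDl d0 -EFinD/= addrAC subrr add0r.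
have mI : measurable (`[s0, s0 + d]%classic : set (measurableTypeR R)) by exact: measurable_itv.
have ic : mu.-integrable `[s0, s0 + d] (EFin \o cst c).
  apply: continuous_compact_integrable; first exact: segment_compact.
  by apply: continuous_subspaceT; exact: cst_continuous.
apply: le_trans (le_normr_Rintegral mI fi) _.
have -> : c * d = \int[mu]_(s in `[s0, s0 + d]) (cst c s).
  by rewrite Rintegral_cst//; congr (_ * _); exact/esym/E.
apply: (le_Rintegral mI (integrable_norm fi) ic) => s /=.
by rewrite in_itv/=; exact: fc.
Qed.

Lemma window_lip (c g g' z z' : R) : `|s0| + d <= c -> 0 <= g -> 0 <= g' ->
  `|window s0 d g z - window s0 d g' z'| <=
  (c ^+ 2 + 2 * c) * (`|g - g'| + `|z - z'|) * d.
Proof.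
move=> sc g0 g0'; have mI : measurable (`[s0, s0 + d]%classic : set (measurableTypeR R)) by exact: measurable_itv.
rewrite /window -RintegralB//; try exact: integrable_wave_itv.
apply: Rintegral_itv_le.
  exact: (integrableB mI (integrable_wave_itv g z) (integrable_wave_itv g' z')).
move=> s /andP[s1 s2]; apply: wave_lip => //; apply: le_trans sc.
have := ler_norm s0; have := ler_norm (- s0); rewrite normrN => h1 h2.
rewrite ler_norml; apply/andP; split; have := ltW d0; lra.
Qed.

Lemma window_le g z : 0 <= g -> `|window s0 d g z| <= d.
Proof.
move=> g0; rewrite -[leRHS]mul1r; apply: Rintegral_itv_le.
  exact: integrable_wave_itv.
by move=> s _; exact: wave_le1.
Qed.

Lemma window_continuous (T : topologicalType) (f h : T -> R) :
  (forall t, 0 <= f t) -> continuous f -> continuous h ->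
  continuous (fun t => window s0 d (f t) (h t)).
Proof.
move=> f0 cf ch t; set c := `|s0| + d.
have H : (fun u => (c ^+ 2 + 2 * c) * (`|f t - f u| + `|h t - h u|) * d) u @[u --> t] --> (0 : R).
  have -> : 0 = (c ^+ 2 + 2 * c) * (`|f t - f t| + `|h t - h t|) * d.
    by rewrite !subrr normr0 addr0 mulr0 mul0r.
  apply: cvgM; last exact: cvg_cst.
  apply: cvgM; first exact: cvg_cst.
  by apply: cvgD; apply: cvg_norm; apply: cvgB; first [exact: cvg_cst|exact: cf|exact: ch].
apply/cvgrPdist_le => e e0.
move/cvgrPdist_le : H => /(_ _ e0); apply: filterS => u.
rewrite sub0r normrN => h1.
apply: le_trans (window_lip (h t) (h u) (lexx c) (f0 t) (f0 u)) _.
by apply: le_trans h1; rewrite ler_norm.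
Qed.

Lemma rpsd_window (Y : choiceType) (G : Y -> Y -> R) (x : Y -> R) :
  (forall t, 0 <= t -> rpsd (fun p q => expR (- (t * G p q)))) ->
  rpsd (fun p q => window s0 d (G p q) (x p - x q)).
Proof.
move=> pG; apply: rpsd_Rintegral => [|p q|s _]; first exact: measurable_itv.
- exact: integrable_wave_itv.
- exact: rpsd_wave.
Qed.

(** The factor [g^(-1/2)] comes from the Fourier transform of the Gaussian. Over [m] coordinates it
    amounts to [gamma^(-m/2)], which is why the positivity hypothesis concerns [A gamma^(m/2)]. *)
Definition gauss_peak (g z : R) : R := (Num.sqrt g)^-1 * expR (- (z ^+ 2 / g)).

Lemma gauss_peakE g z : 0 < g -> Num.sqrt pi * gauss_peak g z = \int[mu]_s wave s g z.
Proof.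
move=> g0; rewrite gauss_fourier// sqrtrM ?pi_ge0// sqrtrV ?ltW//.
by rewrite /gauss_peak mulrA.
Qed.

Lemma rpsd_gauss_peak (Y : choiceType) (G : Y -> Y -> R) (x : Y -> R) :
  (forall t, 0 <= t -> rpsd (fun p q => expR (- (t * G p q)))) ->
  (forall p q, 0 < G p q) ->
  rpsd (fun p q => Num.sqrt pi * gauss_peak (G p q) (x p - x q)).
Proof.
move=> pG G0; apply: (@eq_rpsd _ _ (fun p q => \int[mu]_s wave s (G p q) (x p - x q))).
  by move=> p q; rewrite gauss_peakE.
apply: rpsd_Rintegral => // [p q|s _]; last exact: rpsd_wave.
exact: integrable_gauss_cos.
Qed.

(** The difference is the integral of the same positive definite waves over the complement of the
    window. *)
Lemma rpsd_gauss_peak_window (Y : choiceType) (G : Y -> Y -> R) (x : Y -> R) :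
  (forall t, 0 <= t -> rpsd (fun p q => expR (- (t * G p q)))) ->
  (forall p q, 0 < G p q) ->
  rpsd (fun p q => Num.sqrt pi * gauss_peak (G p q) (x p - x q) -
                   window s0 d (G p q) (x p - x q)).
Proof.
move=> pG G0; have mI : measurable (`[s0, s0 + d]%classic : set (measurableTypeR R)) by exact: measurable_itv.
have iw p q : mu.-integrable setT (EFin \o (fun s => wave s (G p q) (x p - x q))).
  exact: integrable_gauss_cos.
apply: (@eq_rpsd _ _ (fun p q => \int[mu]_(s in ~` `[s0, s0 + d]) wave s (G p q) (x p - x q))).
  move=> p q; rewrite gauss_peakE// -(setUv `[s0, s0 + d]) Rintegral_setU//.
  - by rewrite addrAC /window subrr add0r.
  - exact: measurableC.
  - by rewrite setUv.
  - by apply/disj_setPS; rewrite setICr.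
apply: rpsd_Rintegral => [|p q|s _]; last exact: rpsd_wave.
  exact: measurableC.
apply: integrableS (iw p q) => //; exact: measurableC.
Qed.

End wave.

Lemma window_cvg (R : realType) (s0 g z : R) :
  (fun n => n.+1%:R * window s0 n.+1%:R^-1 g z) @ \oo --> wave s0 g z.
Proof.
apply/cvgrPdist_le => e e0.
have /cvgrPdist_le /(_ _ e0) := @wave_continuous R g z s0.
rewrite near_nbhs => /nbhs_ballP[r /= r0 H].
near=> n.
have n0 : 0 < n.+1%:R^-1 :> R by rewrite invr_gt0 ltr0n.
have nr : n.+1%:R^-1 < r.
  near: n; have := @near_infty_natSinv_lt R (PosNum r0); apply: filterS => n.
  by [].
set d := n.+1%:R^-1 in n0 nr *; have -> : n.+1%:R = d^-1 by rewrite invrK.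
have mI : measurable (`[s0, s0 + d]%classic : set (measurableTypeR R)) by exact: measurable_itv.
have E : fine (@lebesgue_measure R `[s0, s0 + d]%classic) = d.
  by rewrite lebesgue_measure_itv/= lte_fin ltrDl n0 -EFinD/= addrAC subrr add0r.
have ic : (@lebesgue_measure R).-integrable `[s0, s0 + d] (EFin \o cst (wave s0 g z)).
  apply: continuous_compact_integrable; first exact: segment_compact.
  by apply: continuous_subspaceT; exact: cst_continuous.
have -> : wave s0 g z = d^-1 * \int[@lebesgue_measure R]_(s in `[s0, s0 + d]) (cst (wave s0 g z) s).
  rewrite Rintegral_cst// [X in _ * X](_ : _ = wave s0 g z * d); last first.
    by congr (_ * _); exact: E.
  by rewrite mulrC mulfK// gt_eqF.
have id0 : 0 < d^-1 by rewrite invr_gt0.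
rewrite -mulrBr normrM (gtr0_norm id0) (ler_pdivrMl _ _ n0) mulrC.
rewrite /window -RintegralB//; last exact: integrable_wave_itv.
apply: Rintegral_itv_le => //.
  exact: (integrableB mI ic (integrable_wave_itv s0 d g z)).
move=> s /andP[s1 s2]; apply: H => /=.
by rewrite -ball_normE /= distrC ger0_norm ?subr_ge0//; apply: le_lt_trans nr; rewrite lerBlDl.
Unshelve. all: by end_near. Qed.

(** * Domination for the Gaussian kernel *)

Section cdom.
Variables (R : realType) (Y : choiceType).
Implicit Types (K : Y -> Y -> R[i]) (k l : Y -> Y -> R).

(* [cdom K M f] : [f] belongs to the reproducing kernel Hilbert space of [K],
   with squared norm at most [M]. *)
Definition cdom K (M : R) (f : Y -> R[i]) :=
  psd (fun x y => M%:C * K x y - f x * (f y)^c).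

Lemma psd_diagE K a : psd K -> K a a = (complex.Re (K a a))%:C.
Proof.
by move=> /(psd_diag a); case: (K a a) => b c; rewrite lecE /= => /andP[/eqP-> _].
Qed.

Lemma psd_Re_diag_ge0 K a : psd K -> 0 <= complex.Re (K a a).
Proof. by move=> /(psd_diag a); rewrite lecE => /andP[]. Qed.

Lemma psd_diag0 K a x : psd K -> K a a = 0 -> K x a = 0.
Proof.
move=> pK z; have := psd_CS [:: (1, x)] [:: (1, a)] pK.
rewrite !sesq11 conjc1 !mul1r z mulr0 => h.
have /eqP : K x a * (K x a)^c = 0 by apply/eqP; rewrite eq_le h mulcJ_ge0.
by rewrite mulf_eq0 conjc_eq0 orbb => /eqP.
Qed.

Lemma cdom_section K a : psd K -> cdom K (complex.Re (K a a)) (fun x => K x a).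
Proof.
move=> pK; rewrite /cdom -psd_diagE//.
have [z|nz] := eqVneq (K a a) 0.
  apply: eq_psd (@psd0 R Y) => x y.
  by rewrite z (psd_diag0 x pK z) !mul0r subrr.
apply: eq_psd (psdZ (psd_diag a pK) (psd_schur_complement a pK)) => x y.
by rewrite mulrBr mulrCA divff// mulr1.
Qed.

Lemma cdomM_real K k (M N : R) f g : 0 <= M -> psd K ->
  cdom K M f -> rdom k N g ->
  cdom (fun x y => K x y * (k x y)%:C) (M * N) (fun x => f x * (g x)%:C).
Proof.
move=> M0 pK Kf kg.
have M0' : 0 <= M%:C by rewrite lecR.
apply: eq_psd (psdD (psdM Kf (rpsd_rank1 g)) (psdM (psdZ M0' pK) kg)) => x y.
rewrite conjcM conjc_real rmorphB !rmorphM; ring.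
Qed.

Lemma cdom_le K L (c M : R) f : 0 <= M ->
  psd (fun x y => c%:C * L x y - K x y) -> cdom K M f -> cdom L (M * c) f.
Proof.
move=> M0 LK Kf; have M0' : 0 <= M%:C by rewrite lecR.
apply: eq_psd (psdD (psdZ M0' LK) Kf) => x y.
by rewrite rmorphM; ring.
Qed.

(** Telescoping one factor at a time. This carries the comparison of peaks and windows from one
    coordinate to [m]. *)
Lemma rpsd_prod_le I (r : seq I) (k_ l_ : I -> Y -> Y -> R) :
  (forall i, rpsd (k_ i)) -> (forall i, rpsd (l_ i)) ->
  (forall i, rpsd (fun x y => k_ i x y - l_ i x y)) ->
  rpsd (fun x y => \prod_(i <- r) k_ i x y - \prod_(i <- r) l_ i x y).
Proof.
move=> pk pl pkl; elim: r => [|i r IH].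
  by apply: eq_rpsd (rpsd_cst (lexx 0)) => x y; rewrite !big_nil subrr.
apply: eq_rpsd (rpsdD (rpsdM (pkl i) (rpsd_prod r pk)) (rpsdM (pl i) IH)) => x y.
by rewrite !big_cons; ring.
Qed.

End cdom.

Section gaussian_kernel.
Variables (R : realType) (m : nat) (X : choiceType).
Variables (gamma : X -> X -> R) (A : X -> X -> R[i]).
Hypothesis gamma_gt0 : forall u v, 0 < gamma u v.
Local Notation Y := (X * 'rV[R]_m)%type.

Definition peaks (p q : Y) : R :=
  \prod_(i < m) gauss_peak (gamma p.1 q.1) (p.2 0 i - q.2 0 i).

Lemma CkerE u v : Cker m A gamma u v = A u v * (Num.sqrt (gamma u v) ^+ m)%:C.
Proof.
rewrite /Cker; congr (_ * _%:C).
by rewrite -powR12_sqrt ?ltW// -powR_mulrn ?powR_ge0// -powRrM mulrC.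
Qed.

Lemma GkerE p q : Gker m A gamma p q = Cker m A gamma p.1 q.1 * (peaks p q)%:C.
Proof.
rewrite CkerE /Gker -mulrA -rmorphM /peaks /gauss_peak big_split/=.
rewrite prodr_const card_ord exprVn mulrA divff ?mul1r; last first.
  by rewrite expf_neq0// gt_eqF// sqrtr_gt0.
by rewrite -expR_sum sumrN mulr_suml.
Qed.

Hypothesis gamma_cnd : cond_neg_def_kernel gamma.
Hypothesis C_pd : pos_def_kernel (Cker m A gamma).

Lemma rpsd_exp_gamma_fst t : 0 <= t ->
  rpsd (fun p q : Y => expR (- (t * gamma p.1 q.1))).
Proof.
move=> t0; have := rpsd_exp_cnd gamma_cnd t0.
exact: (rpsd_pull (fun p : Y => p.1)).
Qed.

Lemma psd_Cker : psd (Cker m A gamma).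
Proof. exact/psd_pos_def. Qed.

Lemma psd_Cker_fst : psd (fun p q : Y => Cker m A gamma p.1 q.1).
Proof. exact: psd_pull psd_Cker. Qed.

Let pG i : rpsd (fun p q : Y =>
  Num.sqrt pi * gauss_peak (gamma p.1 q.1) (p.2 0 i - q.2 0 i)).
Proof.
apply: (@rpsd_gauss_peak _ _ (fun p q : Y => gamma p.1 q.1) (fun p => p.2 0 i)) => //.
exact: rpsd_exp_gamma_fst.
Qed.

Let sqrtpi : 0 < Num.sqrt pi :> R. Proof. by rewrite sqrtr_gt0 pi_gt0. Qed.

Let prod_peaks (p q : Y) : \prod_(i < m) (Num.sqrt pi * gauss_peak (gamma p.1 q.1) (p.2 0 i - q.2 0 i))
  = Num.sqrt pi ^+ m * peaks p q.
Proof. by rewrite big_split/= prodr_const card_ord. Qed.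

Lemma psd_Gker : psd (Gker m A gamma).
Proof.
have c0 : 0 <= (Num.sqrt pi ^+ m)^-1 :> R by rewrite invr_ge0 exprn_ge0// ltW.
apply: eq_psd (psdM psd_Cker_fst (rpsdZ c0 (rpsd_prod (index_enum 'I_m) pG))) => p q.
rewrite GkerE prod_peaks mulKf// expf_neq0// gt_eqF//.
Qed.

(** [A] is the restriction of [Gker] to the slice [x = 0]. *)
Lemma psd_A : psd A.
Proof.
apply: eq_psd (psd_pull (fun u => (u, 0 : 'rV[R]_m)) psd_Gker) => u v.
rewrite /Gker /= big1 ?mul0r ?oppr0 ?expR0 ?mulr1//.
by move=> i _; rewrite subrr expr0n.
Qed.

Definition windows (s0 : 'I_m -> R) (d : R) (p q : Y) : R :=
  \prod_(i < m) window (s0 i) d (gamma p.1 q.1) (p.2 0 i - q.2 0 i).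

(** The windowed kernel lies below [pi^(m/2)] times [Gker] in the order of positive definite
    kernels, so whatever it dominates, in particular its own sections, is dominated by [Gker] as
    well. *)
Lemma cdom_windows (s0 : 'I_m -> R) (d : R) (q : Y) : 0 < d -> exists2 M, 0 <= M &
  cdom (Gker m A gamma) M (fun p => Cker m A gamma p.1 q.1 * (windows s0 d p q)%:C).
Proof.
move=> d0.
have pW i : rpsd (fun p q : Y => window (s0 i) d (gamma p.1 q.1) (p.2 0 i - q.2 0 i)).
  apply: (@rpsd_window _ _ _ _ (fun p q : Y => gamma p.1 q.1) (fun p => p.2 0 i)).
  exact: rpsd_exp_gamma_fst.
have pGW i : rpsd (fun p q : Y =>
    Num.sqrt pi * gauss_peak (gamma p.1 q.1) (p.2 0 i - q.2 0 i) -
    window (s0 i) d (gamma p.1 q.1) (p.2 0 i - q.2 0 i)).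
  apply: (@rpsd_gauss_peak_window _ _ _ _ (fun p q : Y => gamma p.1 q.1) (fun p => p.2 0 i)) => //.
  exact: rpsd_exp_gamma_fst.
pose L (p q : Y) := Cker m A gamma p.1 q.1 * (windows s0 d p q)%:C.
have pL : psd L by exact: psdM psd_Cker_fst (rpsd_prod (index_enum 'I_m) pW).
have LG : psd (fun p q => (Num.sqrt pi ^+ m)%:C * Gker m A gamma p q - L p q).
  apply: eq_psd (psdM psd_Cker_fst (rpsd_prod_le (index_enum 'I_m) pG pW pGW)) => p p'.
  by rewrite prod_peaks GkerE /L /windows rmorphB !rmorphM; ring.
exists (complex.Re (L q q) * Num.sqrt pi ^+ m).
  by rewrite mulr_ge0 ?psd_Re_diag_ge0// exprn_ge0// ltW.
apply: (cdom_le (psd_Re_diag_ge0 q pL) LG).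
exact: cdom_section.
Qed.

(* [waves xi] is the kernel [e^(-|xi|^2 gamma) prod_i cos (2 xi_i (x_i - y_i))]. *)
Definition waves (xi : 'I_m -> R) (p q : Y) : R :=
  \prod_(i < m) wave (xi i) (gamma p.1 q.1) (p.2 0 i - q.2 0 i).

Lemma wavesE xi p q : waves xi p q =
  expR (- ((\sum_(i < m) xi i ^+ 2) * gamma p.1 q.1)) *
  \prod_(i < m) cos (2 * xi i * (p.2 0 i - q.2 0 i)).
Proof.
rewrite /waves big_split/= -expR_sum sumrN mulr_suml.
by congr (expR (- _) * _); apply: eq_bigr => i _; rewrite mulrC.
Qed.

Lemma rpsd_cos (xi : R) (Z : choiceType) (x : Z -> R) :
  rpsd (fun p q => cos (xi * (x p - x q))).
Proof.
apply: eq_rpsd (rpsdD (rpsd_rank1 (fun p => cos (xi * x p)))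
         (rpsd_rank1 (fun p => sin (xi * x p)))) => p q.
by rewrite mulrBr cosB.
Qed.

Lemma psd_Cker_waves xi : psd (fun p q => Cker m A gamma p.1 q.1 * (waves xi p q)%:C).
Proof.
apply: psdM psd_Cker_fst _; apply: (rpsd_prod (index_enum 'I_m)) => i.
apply: (@rpsd_wave _ _ (fun p q : Y => gamma p.1 q.1) (fun p => p.2 0 i)).
exact: rpsd_exp_gamma_fst.
Qed.

Lemma cdom_waves (xi : 'I_m -> R) (l : seq (R * X)) (q : Y) :
  0 < \sum_(i < m) xi i ^+ 2 -> exists2 M, 0 <= M &
  cdom (fun p q => Cker m A gamma p.1 q.1 * (waves xi p q)%:C) M
    (fun p => Cker m A gamma p.1 q.1 *
      (expR (- ((\sum_(i < m) xi i ^+ 2) * gamma p.1 q.1)) *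
       \prod_(a <- l) sin (a.1 * cnd_gram gamma q.1 p.1 a.2) *
       \prod_(i < m) cos (2 * xi i * (p.2 0 i - q.2 0 i)))%:C).
Proof.
set t := \sum_(i < m) _ => t0.
pose w := q.1; pose k (p p' : Y) := cnd_gram gamma w p.1 p'.1.
have pk0 := rpsd_cnd_gram gamma_cnd w.
have pk : rpsd k := rpsd_pull (fun p : Y => p.1) pk0.
(* The exponent [t] is divided evenly: one share for each sine and a spare one, which dominates the
   constant [1] and keeps the division meaningful when [l] is empty. *)
pose n : R := (size l).+1%:R; have n0 : 0 < n by rewrite ltr0n.
have tn0 : 0 < t / n by rewrite divr_gt0.
have ptn : rpsd (fun p p' => expR (t / n * k p p')).
  by apply: rpsd_exp; apply: rpsdZ pk; exact: ltW.
have D1 : exists2 M1, 0 <= M1 & rdom (fun p p' => \prod_(a <- l) expR (t / n * k p p')) M1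
    (fun p : Y => \prod_(a <- l) sin (a.1 * cnd_gram gamma w p.1 a.2)).
  have H (a : R * X) : {M | 0 <= M & rdom (fun p p' => expR (t / n * k p p')) M
      (fun p => sin (a.1 * cnd_gram gamma w p.1 a.2))}.
    apply: cid2; have [M M0 HM] := rdom_sin a.2 a.1 tn0 pk0.
    exists M => //; exact: (rpsd_pull (fun p : Y => p.1) HM).
  pose M_ a := s2val (H a).
  exists (\prod_(a <- l) M_ a); first by apply: prodr_ge0 => a _; exact: s2valP (H a).
  apply: (@rdom_prod _ _ _ l (fun _ p p' => expR (t / n * k p p')) M_) => //.
  - by move=> a; exact: s2valP (H a).
  - by move=> a; exact: s2valP' (H a).
have [M1 M10 {}D1] := D1.
have D2 : rdom (fun p p' => \prod_(a <- l) expR (t / n * k p p') * expR (t / n * k p p')) (M1 * 1)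
    (fun p : Y => \prod_(a <- l) sin (a.1 * cnd_gram gamma w p.1 a.2) * 1).
  apply: rdomM => //; apply: eq_rpsd (rpsd_expB1 (rpsdZ (ltW tn0) pk)) => p p'.
  by rewrite !mul1r.
have Et p p' : \prod_(a <- l) expR (t / n * k p p') * expR (t / n * k p p') = expR (t * k p p').
  rewrite big_const_seq count_predT iter_mulr_1 -exprSr -expRM_natl.
  by rewrite -/n mulrA (mulrC n) divfK// gt_eqF.
pose e (p : Y) := expR (- (t * gamma p.1 w)).
have D3 : rdom (fun p p' => expR (t * gamma w w) * (e p * e p') * expR (t * k p p'))
    (M1 / expR (t * gamma w w))
    (fun p : Y => e p * \prod_(a <- l) sin (a.1 * cnd_gram gamma w p.1 a.2)).
  apply: eq_rpsd (rpsdM (rpsd_rank1 e) D2) => p p'.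
  rewrite Et; field.
  by rewrite gt_eqF// expR_gt0.
have D4 : rdom (fun p p' => expR (- (t * gamma p.1 p'.1))) (M1 / expR (t * gamma w w))
    (fun p : Y => e p * \prod_(a <- l) sin (a.1 * cnd_gram gamma w p.1 a.2)).
  by apply: eq_rpsd D3 => p p'; rewrite [in RHS](exp_cndE gamma t w).
have pc : rpsd (fun p p' : Y => \prod_(i < m) cos (2 * xi i * (p.2 0 i - p'.2 0 i))).
  by apply: (rpsd_prod (index_enum 'I_m)) => i; exact: (rpsd_cos _ (fun p : Y => p.2 0 i)).
have D5 := rdom_section q pc.
have c0 : 0 <= \prod_(i < m) cos (2 * xi i * (q.2 0 i - q.2 0 i)).
  by have := psd_diag q pc; rewrite lecR.
have D6 := rdomM c0 pc D4 D5.
have D7 := cdomM_real (psd_Re_diag_ge0 q psd_Cker_fst) psd_Cker_fst (cdom_section q psd_Cker_fst) D6.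
have pcC (p : Y) : \prod_(i < m) cos (2 * xi i * (q.2 0 i - p.2 0 i)) =
    \prod_(i < m) cos (2 * xi i * (p.2 0 i - q.2 0 i)).
  by have /rpsdP[h _] := pc; exact: (h q p).
eexists; last first.
  by apply: eq_psd D7 => p p'; rewrite wavesE -/t !pcC.
rewrite mulr_ge0 ?psd_Re_diag_ge0//; first exact: psd_Cker.
by rewrite mulr_ge0// divr_ge0// expR_ge0.
Qed.

End gaussian_kernel.

(** * Integrals against complex measures *)

Section charge_integral.
Context d (T : measurableType d) (R : realType).
Implicit Types (nu : {charge set T -> \bar R}) (f g : T -> R).

Definition bmeas f : Prop :=
  measurable_fun setT f /\ exists M : R, forall x, `|f x| <= M.

Lemma bmeas_integrable (mu : {finite_measure set T -> \bar R}) f :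
  bmeas f -> mu.-integrable setT (EFin \o f).
Proof.
move=> [mf [M fM]]; apply: measurable_bounded_integrable => //.
  by rewrite ltey_eq fin_num_measure.
exists M; split; first exact: num_real.
by move=> y My x _; apply: le_trans (fM x) (ltW My).
Qed.

Lemma bmeas_cst c : bmeas (fun=> c).
Proof. by split; [exact: measurable_cst|exists `|c|]. Qed.

Lemma bmeasD f g : bmeas f -> bmeas g -> bmeas (fun x => f x + g x).
Proof.
move=> [mf [M fM]] [mg [N gN]]; split; first exact: measurable_funD.
exists (M + N) => x; apply: le_trans (ler_normD _ _) _; exact: lerD.
Qed.

Lemma bmeasM f g : bmeas f -> bmeas g -> bmeas (fun x => f x * g x).
Proof.
move=> [mf [M fM]] [mg [N gN]]; split; first exact: measurable_funM.
by exists (M * N) => x; rewrite normrM ler_pM.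
Qed.

Lemma bmeasN f : bmeas f -> bmeas (fun x => - f x).
Proof.
move=> bf; have := bmeasM (bmeas_cst (-1)) bf.
by rewrite (_ : (fun x => -1 * f x) = (fun x => - f x))//; apply/funext => x; rewrite mulN1r.
Qed.

Lemma bmeasB f g : bmeas f -> bmeas g -> bmeas (fun x => f x - g x).
Proof. by move=> bf bg; apply: bmeasD => //; exact: bmeasN. Qed.

Lemma bmeas_indic E : measurable E -> bmeas (\1_E : T -> R).
Proof.
move=> mE; split; first exact: measurable_indic.
by exists 1 => x; rewrite indicE; case: (x \in E); rewrite ?normr1 ?normr0.
Qed.

(** The same choice of Hahn sets as in [charge_integral], so that [charge_integralE] holds by
    conversion. *)
Definition hahn nu := svalP (cid (svalP (cid (Hahn_decomposition nu)))).
Definition jpos nu : {finite_measure set T -> \bar R} := jordan_pos (hahn nu).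
Definition jneg nu : {finite_measure set T -> \bar R} := jordan_neg (hahn nu).

Lemma charge_integralE nu f :
  charge_integral nu f = \int[jpos nu]_x f x - \int[jneg nu]_x f x.
Proof. by []. Qed.

Lemma charge_integral_lin nu a f g : bmeas f -> bmeas g ->
  charge_integral nu (fun x => a * f x + g x) =
  a * charge_integral nu f + charge_integral nu g.
Proof.
move=> bf bg; have baf := bmeasM (bmeas_cst a) bf.
rewrite !charge_integralE !RintegralD ?RintegralZl//; try exact: bmeas_integrable.
ring.
Qed.

Lemma charge_integral0 nu : charge_integral nu (fun=> 0) = 0.
Proof.
have b0 := bmeas_cst 0.
by have := charge_integral_lin nu (-1) b0 b0; rewrite !mulN1r !addNr.
Qed.

Lemma charge_integral_dct nu (f_ : nat -> T -> R) f (M : R) :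
  (forall n, measurable_fun setT (f_ n)) -> measurable_fun setT f ->
  (forall n x, `|f_ n x| <= M) -> (forall x, (fun n => f_ n x) @ \oo --> f x) ->
  (fun n => charge_integral nu (f_ n)) @ \oo --> charge_integral nu f.
Proof.
move=> mf_ mf fM ff; under eq_fun do rewrite charge_integralE.
rewrite charge_integralE.
have H (mu : {finite_measure set T -> \bar R}) :
    (fun n => \int[mu]_x f_ n x) @ \oo --> \int[mu]_x f x.
  by have [] := Rintegral_dct mf_ mf ff (bmeas_integrable mu (bmeas_cst M)) fM.
by apply: cvgB; exact: H.
Qed.

Lemma charge_integral_indic nu E : measurable E ->
  charge_integral nu \1_E = fine (nu E).
Proof.
move=> mE; rewrite charge_integralE /Rintegral !integral_indic// !setIT.
rewrite (jordan_decomp (hahn nu) mE) /cadd/= cscaleN1 fineD//; first by rewrite fineN.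
- exact: fin_num_measure (jpos nu) _ mE.
- by rewrite fin_numN; exact: fin_num_measure (jneg nu) _ mE.
Qed.

(** Each Jordan part of [nu] gives [E] a mass that is, up to sign, the value of [nu] on the trace of
    [E] on a Hahn set; two parts, hence the factor 2. *)
Lemma charge_integral_bound nu f (E : set T) (M eps : R) : measurable E ->
  bmeas f -> (forall x, `|f x| <= M) -> (forall x, ~ E x -> f x = 0) ->
  (forall F, measurable F -> F `<=` E -> `|fine (nu F)| <= eps) ->
  `|charge_integral nu f| <= 2 * (M * eps).
Proof.
move=> mE bf fM f0 nuE.
have M0 : 0 <= M.
  by apply: le_trans (fM point).
have H (mu : {finite_measure set T -> \bar R}) : fine (mu E) <= eps ->
    `|\int[mu]_x f x| <= M * eps.
  move=> muE; have mfi := bmeas_integrable mu bf.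
  apply: le_trans (le_normr_Rintegral measurableT mfi) _.
  apply: le_trans (_ : \int[mu]_x (M * \1_E x) <= _).
    apply: le_Rintegral => //.
    - exact: (integrable_norm mfi).
    - exact: (bmeas_integrable mu (bmeasM (bmeas_cst M) (bmeas_indic mE))).
    - move=> x _; rewrite indicE; case: (boolP (x \in E)) => [|/negP].
        by rewrite mulr1.
      by rewrite inE => /f0 ->; rewrite normr0 mulr0.
  rewrite RintegralZl//; last exact: (bmeas_integrable mu (bmeas_indic mE)).
  by rewrite /Rintegral integral_indic// setIT ler_wpM2l.
rewrite charge_integralE; apply: le_trans (ler_normB _ _) _.
rewrite mulr2n mulrDl !mul1r; apply: lerD; apply: H.
- have mP : measurable (sval (cid (Hahn_decomposition nu))).
    by have [[]] := hahn nu.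
  have -> : jpos nu E = nu (E `&` sval (cid (Hahn_decomposition nu))).
    by transitivity (crestr0 nu mP E) => //; rewrite /crestr0 mem_set.
  apply: le_trans (ler_norm _) _; apply: nuE; first exact: measurableI.
  exact: subIsetl.
- set N := sval (cid (svalP (cid (Hahn_decomposition nu)))).
  have mN : measurable N by have [_ []] := hahn nu.
  have -> : jneg nu E = (- nu (E `&` N))%E.
    transitivity (cscale (-1) (crestr0 nu mN) E) => //.
    by rewrite cscaleN1/= /crestr0 mem_set.
  rewrite fineN; apply: le_trans (ler_norm _) _; rewrite normrN; apply: nuE.
    exact: measurableI.
  exact: subIsetl.
Qed.

End charge_integral.

Section cintegral.
Context d (T : measurableType d) (R : realType).
Implicit Types (lambda : {charge set T -> \bar R[i]}) (g h : T -> R[i]).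

Definition bcmeas g : Prop :=
  bmeas (fun x => complex.Re (g x)) /\ bmeas (fun x => complex.Im (g x)).

Lemma Re_add (x y : R[i]) : complex.Re (x + y) = complex.Re x + complex.Re y.
Proof. by case: x; case: y. Qed.
Lemma Im_add (x y : R[i]) : complex.Im (x + y) = complex.Im x + complex.Im y.
Proof. by case: x; case: y. Qed.
Lemma Re_mul (x y : R[i]) :
  complex.Re (x * y) = complex.Re x * complex.Re y - complex.Im x * complex.Im y.
Proof. by case: x; case: y. Qed.
Lemma Im_mul (x y : R[i]) :
  complex.Im (x * y) = complex.Re x * complex.Im y + complex.Im x * complex.Re y.
Proof. by case: x => a b; case: y. Qed.

Lemma Re_mulr (x : R[i]) (r : R) : complex.Re (x * r%:C) = complex.Re x * r.
Proof. by rewrite Re_mul mulr0 subr0. Qed.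
Lemma Im_mulr (x : R[i]) (r : R) : complex.Im (x * r%:C) = complex.Im x * r.
Proof. by rewrite Im_mul mulr0 add0r. Qed.

Lemma normc_ge0 (x : R[i]) : 0 <= normc x.
Proof. by case: x => a b; exact: sqrtr_ge0. Qed.

Lemma normc_le (x : R[i]) : normc x <= `|complex.Re x| + `|complex.Im x|.
Proof.
case: x => a b /=; rewrite -[leRHS]ger0_norm ?addr_ge0// -sqrtr_sqr ler_wsqrtr//.
rewrite sqrrD !real_normK ?num_real//.
by rewrite -addrA lerD2l addrC lerDl mulrn_wge0// mulr_ge0.
Qed.

Lemma normc_real (x : R) : normc x%:C = `|x|.
Proof. by rewrite /normc /= expr0n/= addr0 sqrtr_sqr. Qed.

Lemma normc_conj (x : R[i]) : normc x^c = normc x.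
Proof. by case: x => a b; rewrite /normc /= sqrrN. Qed.

Lemma bcmeas_bound g : bcmeas g -> exists2 M, 0 <= M & forall x, normc (g x) <= M.
Proof.
move=> [[_ [M HM]] [_ [N HN]]]; exists (M + N) => [|x].
  by rewrite addr_ge0// (le_trans _ (HM point), le_trans _ (HN point)).
by apply: le_trans (normc_le _) _; apply: lerD.
Qed.

Lemma bcmeas_cst c : bcmeas (fun=> c).
Proof. by split; exact: bmeas_cst. Qed.

Lemma bcmeasD g h : bcmeas g -> bcmeas h -> bcmeas (fun x => g x + h x).
Proof.
move=> [g1 g2] [h1 h2]; split; under eq_fun do rewrite (Re_add, Im_add); exact: bmeasD.
Qed.

Lemma bcmeasM g h : bcmeas g -> bcmeas h -> bcmeas (fun x => g x * h x).
Proof.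
move=> [g1 g2] [h1 h2]; split.
  by under eq_fun do rewrite Re_mul; apply: bmeasB; exact: bmeasM.
by under eq_fun do rewrite Im_mul; apply: bmeasD; exact: bmeasM.
Qed.

Lemma bcmeasN g : bcmeas g -> bcmeas (fun x => - g x).
Proof.
move=> bg; rewrite (_ : (fun x => - g x) = (fun x => -1 * g x)).
  by apply: bcmeasM => //; exact: bcmeas_cst.
by apply/funext => x; rewrite mulN1r.
Qed.

Lemma bcmeasB g h : bcmeas g -> bcmeas h -> bcmeas (fun x => g x - h x).
Proof. by move=> bg bh; apply: bcmeasD => //; exact: bcmeasN. Qed.

Lemma bcmeas_real (f : T -> R) : bmeas f -> bcmeas (fun x => (f x)%:C).
Proof. by move=> bf; split => //=; exact: bmeas_cst. Qed.

Lemma bcmeas_sum I (r : seq I) (G : I -> T -> R[i]) :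
  (forall i, bcmeas (G i)) -> bcmeas (fun x => \sum_(i <- r) G i x).
Proof.
move=> bG; elim: r => [|i r IH].
  by under eq_fun do rewrite big_nil; exact: bcmeas_cst.
by under eq_fun do rewrite big_cons; exact: bcmeasD.
Qed.

Variable lambda : {charge set T -> \bar R[i]}.
Local Notation J := (cintegral lambda).
Local Notation nu1 := (Re_charge lambda).
Local Notation nu2 := (Im_charge lambda).

Lemma cintegral_lin a g h : bcmeas g -> bcmeas h ->
  J (fun x => a * g x + h x) = a * J g + J h.
Proof.
case: a => a b [g1 g2] [h1 h2]; rewrite /cintegral.
have E1 : (fun x => complex.Re (Complex a b * g x + h x)) =
    (fun x => a * complex.Re (g x) + (- b * complex.Im (g x) + complex.Re (h x))).
  by apply/funext => x; rewrite Re_add Re_mul/=; ring.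
have E2 : (fun x => complex.Im (Complex a b * g x + h x)) =
    (fun x => a * complex.Im (g x) + (b * complex.Re (g x) + complex.Im (h x))).
  by apply/funext => x; rewrite Im_add Im_mul/=; ring.
have B1 c : bmeas (fun x => c * complex.Re (g x)) by apply: bmeasM => //; exact: bmeas_cst.
have B2 c : bmeas (fun x => c * complex.Im (g x)) by apply: bmeasM => //; exact: bmeas_cst.
have B3 : bmeas (fun x => - b * complex.Im (g x) + complex.Re (h x)) by exact: bmeasD.
have B4 : bmeas (fun x => b * complex.Re (g x) + complex.Im (h x)) by exact: bmeasD.
rewrite E1 E2 !charge_integral_lin//.
move: (charge_integral nu1 (fun x => complex.Re (g x))) => p1.
move: (charge_integral nu1 (fun x => complex.Im (g x))) => p2.
move: (charge_integral nu2 (fun x => complex.Re (g x))) => p3.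
move: (charge_integral nu2 (fun x => complex.Im (g x))) => p4.
move: (charge_integral nu1 (fun x => complex.Re (h x))) => q1.
move: (charge_integral nu1 (fun x => complex.Im (h x))) => q2.
move: (charge_integral nu2 (fun x => complex.Re (h x))) => q3.
move: (charge_integral nu2 (fun x => complex.Im (h x))) => q4.
by apply/eqP; rewrite eq_complex /=; apply/andP; split; apply/eqP; ring.
Qed.

Lemma cintegral0 : J (fun=> 0) = 0.
Proof.
have b0 := bcmeas_cst (0 : R[i]).
by have := cintegral_lin (-1) b0 b0; rewrite !mulN1r !addNr.
Qed.

Lemma cintegralD g h : bcmeas g -> bcmeas h -> J (fun x => g x + h x) = J g + J h.
Proof.
move=> bg bh; rewrite -[in RHS](mul1r (J g)) -cintegral_lin//; congr cintegral.
by apply/funext => x; rewrite mul1r.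
Qed.

Lemma cintegralZ a g : bcmeas g -> J (fun x => a * g x) = a * J g.
Proof.
move=> bg; rewrite -[RHS]addr0 -cintegral0 -cintegral_lin//; last exact: bcmeas_cst.
by congr cintegral; apply/funext => x; rewrite addr0.
Qed.

Lemma cintegralB g h : bcmeas g -> bcmeas h -> J (fun x => g x - h x) = J g - J h.
Proof.
move=> bg bh; rewrite -(mulN1r (J h)) addrC -cintegral_lin//; congr cintegral.
by apply/funext => x; rewrite mulN1r addrC.
Qed.

Lemma cintegral_sum I (r : seq I) (G : I -> T -> R[i]) :
  (forall i, bcmeas (G i)) -> J (fun x => \sum_(i <- r) G i x) = \sum_(i <- r) J (G i).
Proof.
move=> bG; elim: r => [|i r IH].
  by rewrite big_nil; under eq_fun do rewrite big_nil; exact: cintegral0.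
rewrite big_cons -IH -cintegralD//; last exact: bcmeas_sum.
by under eq_fun do rewrite big_cons.
Qed.

Lemma cintegral_cvg0 (g_ : nat -> T -> R[i]) g (M : R) :
  (forall n, bcmeas (g_ n)) -> bcmeas g -> (forall n x, normc (g_ n x) <= M) ->
  (forall x, (fun n => complex.Re (g_ n x)) @ \oo --> complex.Re (g x)) ->
  (forall x, (fun n => complex.Im (g_ n x)) @ \oo --> complex.Im (g x)) ->
  (forall n, J (g_ n) = 0) -> J g = 0.
Proof.
move=> bg_ bg gM gRe gIm J0.
have H1 (nu : {charge set T -> \bar R}) : (fun n => charge_integral nu (fun x => complex.Re (g_ n x))) @ \oo -->
    charge_integral nu (fun x => complex.Re (g x)).
  apply: (@charge_integral_dct _ _ _ nu _ _ M) => //.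
  - by move=> n; have [[]] := bg_ n.
  - by have [[]] := bg.
  - by move=> n x; apply: le_trans (normc_Re _) _.
have H2 (nu : {charge set T -> \bar R}) : (fun n => charge_integral nu (fun x => complex.Im (g_ n x))) @ \oo -->
    charge_integral nu (fun x => complex.Im (g x)).
  apply: (@charge_integral_dct _ _ _ nu _ _ M) => //.
  - by move=> n; have [_ []] := bg_ n.
  - by have [_ []] := bg.
  - by move=> n x; apply: le_trans (normc_Im _) _.
apply/eqP; rewrite eq_complex; apply/andP; split; apply/eqP => /=.
  rewrite -(cvg_lim (@Rhausdorff R) (cvgB (H1 nu1) (H2 nu2))).
  apply: cvg_lim; first exact: Rhausdorff.
  rewrite (_ : (_ - _ : nat -> R) = cst 0); first exact: cvg_cst.
  by apply/funext => n; have [] := J0 n.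
rewrite -(cvg_lim (@Rhausdorff R) (cvgD (H2 nu1) (H1 nu2))).
apply: cvg_lim; first exact: Rhausdorff.
rewrite (_ : (_ + _ : nat -> R) = cst 0); first exact: cvg_cst.
by apply/funext => n; have [] := J0 n.
Qed.

Lemma cintegral_indic E : measurable E ->
  J (fun x => (\1_E x)%:C) = fine (lambda E).
Proof.
move=> mE; rewrite /cintegral/=.
rewrite !charge_integral0 !charge_integral_indic// subr0 add0r /=.
by case: (fine (lambda E)).
Qed.

(** Four real integrals make up a complex one, each bounded with the factor 2. *)
Lemma cintegral_bound g E (M eps : R) : measurable E -> bcmeas g ->
  (forall x, normc (g x) <= M) -> (forall x, ~ E x -> g x = 0) ->
  (forall F, measurable F -> F `<=` E -> normc (fine (lambda F)) <= eps) ->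
  normc (J g) <= 8 * (M * eps).
Proof.
move=> mE [g1 g2] gM g0 lE.
have HR (nu : {charge set T -> \bar R}) (f : T -> R) : bmeas f -> (forall x, `|f x| <= M) -> (forall x, ~ E x -> f x = 0) ->
    (forall F, measurable F -> F `<=` E -> `|fine (nu F)| <= eps) ->
    `|charge_integral nu f| <= 2 * (M * eps) by exact: charge_integral_bound.
have a1 x : `|complex.Re (g x)| <= M by apply: le_trans (normc_Re _) _.
have a2 x : `|complex.Im (g x)| <= M by apply: le_trans (normc_Im _) _.
have z1 x : ~ E x -> complex.Re (g x) = 0 by move=> /g0->.
have z2 x : ~ E x -> complex.Im (g x) = 0 by move=> /g0->.
have n1 F : measurable F -> F `<=` E -> `|fine (nu1 F)| <= eps.
  by move=> mF FE; apply: le_trans (normc_Re _) (lE _ mF FE).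
have n2 F : measurable F -> F `<=` E -> `|fine (nu2 F)| <= eps.
  by move=> mF FE; apply: le_trans (normc_Im _) (lE _ mF FE).
apply: le_trans (normc_le _) _; rewrite /cintegral/=.
have h1 := HR nu1 _ g1 a1 z1 n1; have h2 := HR nu2 _ g2 a2 z2 n2.
have h3 := HR nu1 _ g2 a2 z2 n1; have h4 := HR nu2 _ g1 a1 z1 n2.
have -> : 8 * (M * eps) = (2 * (M * eps) + 2 * (M * eps)) + (2 * (M * eps) + 2 * (M * eps)) by ring.
apply: lerD.
  exact: le_trans (ler_normB _ _) (lerD h1 h2).
exact: le_trans (ler_normD _ _) (lerD h3 h4).
Qed.

End cintegral.

(** * Radon measures *)

Section borel.
Variables (R : realType) (Y : topologicalType) (y0 : Y).
Hypothesis Y_hausdorff : hausdorff_space Y.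
Local Notation T := (borel y0).

Lemma borel_open (U : set Y) : open U -> measurable (U : set T).
Proof. by move=> oU; apply: sub_sigma_algebra. Qed.

Lemma borel_closed (U : set Y) : closed U -> measurable (U : set T).
Proof.
by move=> cU; rewrite -(setCK U); apply: measurableC; apply: borel_open; exact: closed_openC.
Qed.

Lemma borel_compact (U : set Y) : compact U -> measurable (U : set T).
Proof. by move=> cU; apply: borel_closed; exact: compact_closed. Qed.

Lemma continuous_borel (f : Y -> R) : continuous f -> measurable_fun setT (f : T -> R).
Proof.
move=> cf; apply: (measurability _ (RGenOpens.measurableE R)) => _ [_ [a [b ->] <-]].
rewrite setTI; apply: borel_open; move/continuousP : cf; apply.
exact: interval_open.
Qed.

Lemma continuous_ccomp (f : Y -> R[i]) : continuous (f : Y -> R[i]^o) ->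
  continuous (fun y => complex.Re (f y)) /\ continuous (fun y => complex.Im (f y)).
Proof.
move=> cf; split => y.
- exact: (continuous_comp (cf y) (@Re_continuous R (f y))).
- exact: (continuous_comp (cf y) (@Im_continuous R (f y))).
Qed.

Lemma bmeas_continuous (f : Y -> R) (M : R) : continuous f -> (forall y, `|f y| <= M) ->
  bmeas (f : T -> R).
Proof. by move=> cf fM; split; [exact: continuous_borel|exists M]. Qed.

Lemma bcmeas_continuous (f : Y -> R[i]) (M : R) : continuous (f : Y -> R[i]^o) ->
  (forall y, normc (f y) <= M) -> bcmeas (f : T -> R[i]).
Proof.
move=> /continuous_ccomp[c1 c2] fM; split.
- by apply: bmeas_continuous c1 _ => y; exact: le_trans (normc_Re _) (fM y).
- by apply: bmeas_continuous c2 _ => y; exact: le_trans (normc_Im _) (fM y).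
Qed.

Variable lambda : {charge set T -> \bar R[i]}.
Local Notation tv := (Defs.total_variation lambda).
Local Notation L E := (normc (fine (lambda E))).

Let seriesL (F : (set T)^nat) : \bar R := (\sum_(0 <= k <oo) (L (F k))%:E)%E.

Let L0 : L set0 = 0.
Proof. by rewrite charge0/= /normc/= expr0n/= addr0 sqrtr0. Qed.

Let seriesL_ge0 F : (0 <= seriesL F)%E.
Proof. by apply: nneseries_ge0 => k _ _; rewrite lee_fin normc_ge0. Qed.

(** [D], the [F k] and the rest of [E] form one partition of [E]. Monotonicity, boundedness and
    tightness below all rest on this inequality. *)
Lemma total_variation_cons (D E : set T) (F : (set T)^nat) :
  measurable D -> measurable E -> (forall k, measurable (F k)) -> trivIset setT F ->
  (D `|` \bigcup_k F k `<=` E) -> [disjoint D & \bigcup_k F k] ->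
  ((L D)%:E + seriesL F <= tv E)%E.
Proof.
move=> mD mE mF tF DFE /disj_setPS dDF.
set B := \bigcup_k F k in DFE dDF.
have mB : measurable B by exact: bigcup_measurable.
(* Index 0 holds [D], index 1 the rest of [E], and index [k + 2] holds [F k]. *)
pose G k := if k is k'.+1 then (if k' is k''.+1 then F k'' else E `\` (D `|` B)) else D.
have : (seriesL G <= tv E)%E.
  apply: ereal_sup_ubound; exists G => //; split.
  - move=> [|[|k]] //=; apply: measurableD => //; exact: measurableU.
  - suff H i j : (i < j)%N -> G i `&` G j `<=` set0.
      apply/trivIsetP => i j _ _; rewrite neq_ltn => /orP[ij|ij]; [|rewrite setIC].
        by apply/seteqP; split => // y; exact: H ij y.
      by apply/seteqP; split => // y; exact: H ij y.
    move=> ij y [].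
    move: i j ij => [|[|i]] [|[|j]] //=.
    + by move=> _ Dy [_ []]; left.
    + by move=> _ Dy Fy; apply: (dDF y); split => //; exists j.
    + by move=> _ [_ nDB] Fy; apply: nDB; right; exists j.
    + rewrite !ltnS => ij Fi Fj; have := tF i j I I (ex_intro _ y (conj Fi Fj)).
      by move=> eij; move: ij; rewrite eij ltnn.
  - apply/seteqP; split => [y [[|[|k]] _ /=]|y Ey].
    + by move=> Dy; apply: DFE; left.
    + by move=> [].
    + by move=> Fy; apply: DFE; right; exists k.
    + have [Dy|nDy] := pselect (D y); first by exists 0%N.
      have [[k _ Fy]|nBy] := pselect (B y); first by exists k.+2.
      by exists 1%N => //=; split => // -[].
apply: le_trans.
rewrite /seriesL [leRHS](nneseries_split 0%N 2%N) => [|k _]; last by rewrite lee_fin normc_ge0.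
rewrite add0n big_nat_recl// big_nat1 /= -addeA leeD2l//.
rewrite (_ : (\sum_(2 <= k <oo) (L (G k))%:E)%E = seriesL F); last first.
  rewrite -(@nneseries_addn _ (fun k => (L (G k))%:E) 2%N) => [|k]; last by rewrite lee_fin normc_ge0.
  by apply: eq_eseriesr => k _; rewrite addn2.
by rewrite leeDr// lee_fin normc_ge0.
Qed.

Hypothesis lambda_radon : finite_radon lambda.

Let tvT : (tv setT < +oo)%E. Proof. by have [] := lambda_radon. Qed.

Lemma tv_le (E E' : set T) : measurable E -> measurable E' -> E `<=` E' -> (tv E <= tv E')%E.
Proof.
move=> mE mE' EE'; apply: ge_ereal_sup => _ [F [mF tF FE] <-].
have := @total_variation_cons set0 E' F measurable0 mE' mF tF.
rewrite set0U FE L0 add0e; apply=> //.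
by apply/disj_setPS; rewrite set0I.
Qed.

Lemma radon_bounded : exists2 C : R, 0 <= C & forall E, measurable E -> L E <= C.
Proof.
have tv0 : (0 <= tv setT)%E.
  apply: le_trans (@total_variation_cons set0 setT (fun=> set0) _ _ _ _ _ _) => //.
  - by rewrite L0 add0e.
  - by apply/trivIsetP => i j _ _ _; rewrite setI0.
  - by apply/disj_setPS; rewrite set0I.
have tvf : tv setT \is a fin_num by rewrite ge0_fin_numE.
exists (fine (tv setT)); first exact: fine_ge0.
move=> E mE; rewrite -lee_fin fineK//.
apply: le_trans (@total_variation_cons E setT (fun=> set0) _ _ _ _ _ _) => //.
- by rewrite leeDl.
- by apply/trivIsetP => i j _ _ _; rewrite setI0.
- by apply/disj_setPS; rewrite bigcup0// setI0.
Qed.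

(** Inner regularity gives a compact [B] whose variation is within [eps / 2] of that of [E], and
    some partition of [B] comes within [eps / 2] of the variation of [B]. A subset of [E] disjoint
    from [B] can be adjoined to that partition, so its mass fits into the remaining [eps]. *)
Lemma radon_tight (E : set T) (eps : R) : measurable E -> 0 < eps ->
  exists B : set Y, [/\ compact B, B `<=` E &
    forall D, measurable D -> D `<=` E `\` B -> L D <= eps].
Proof.
move=> mE e0; have [_ H _] := lambda_radon.
have tvf : tv E \is a fin_num.
  rewrite ge0_fin_numE; first exact: le_lt_trans (tv_le mE measurableT _) tvT.
  apply: le_trans (@total_variation_cons set0 E (fun=> set0) _ _ _ _ _ _) => //.
  - by rewrite L0 add0e.
  - by apply/trivIsetP => i j _ _ _; rewrite setI0.
  - by rewrite bigcup0// setU0.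
  - by apply/disj_setPS; rewrite set0I.
have e2 : 0 < eps / 2 by rewrite divr_gt0.
have := H E mE => tvE.
have tvf' := tvf; rewrite tvE in tvf'.
have := ub_ereal_sup_adherent e2 tvf'; rewrite -tvE => -[_ [B [cB BE] <-] h1].
have mB := borel_compact cB.
have tvBf : tv B \is a fin_num.
  rewrite fin_numElt (le_lt_trans (tv_le mB mE BE)) ?ltey_eq ?tvf// andbT.
  by apply: lt_trans h1; rewrite -(fineK tvf) -EFinB ltNyr.
have [_ [F [mF tF FB] <-] h2] := ub_ereal_sup_adherent e2 tvBf.
exists B; split => // D mD DE.
have := @total_variation_cons D E F mD mE mF tF.
rewrite FB => h3.
have {}h3 : ((L D)%:E + seriesL F <= tv E)%E.
  apply: h3; first by move=> y [/DE[]//|/BE].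
  by apply/disj_setPS => y [/DE[]].
have {}h2 : (tv B - (eps / 2)%:E < seriesL F)%E by exact: h2.
move: h1 h2 h3.
have sf : seriesL F \is a fin_num.
  rewrite ge0_fin_numE//; apply: le_lt_trans (_ : (tv B < +oo)%E); last by rewrite ltey_eq tvBf.
  by apply: ereal_sup_ubound; exists F.
rewrite -(fineK tvf) -(fineK tvBf) -(fineK sf) -!EFinB -!EFinD !lte_fin lee_fin.
lra.
Qed.

End borel.

(** * Measures of zero energy *)

(** If [P B] failed, the sets [A] with [P (B \ A)] would form a proper filter containing [B]; at one
    of its cluster points in [B] the local hypothesis gives a contradiction. This stands in for
    finite subcovers. *)
Lemma compact_induction (Y : topologicalType) (B : set Y) (P : set Y -> Prop) :
  compact B -> P set0 ->
  (forall U V, P U -> P V -> P (U `|` V)) ->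
  (forall U V, U `<=` V -> P V -> P U) ->
  (forall x, B x -> exists2 U, nbhs x U & P U) -> P B.
Proof.
move=> cB P0 PU PS Px; apply: contrapT => nPB.
pose F : set_system Y := fun A => P (B `\` A).
have FF : ProperFilter F.
  split; first by rewrite /F setD0.
  split.
  - by rewrite /F setDT.
  - move=> U V; rewrite /F setDIr; exact: PU.
  - by move=> U V UV; apply: PS => x [Bx nVx]; split => // /UV.
have FB : F B by rewrite /F setDv.
have [x [Bx clx]] := cB F FF FB.
have [U Ux PUx] := Px x Bx.
have FU : F (~` U) by apply: PS PUx => y [_ /contrapT].
by have [y [nUy Uy]] := clx _ _ FU Ux.
Qed.

Lemma continuous_section (R : realType) (Y : topologicalType) (K : Y -> Y -> R[i]) (q : Y) :
  continuous_kernel K -> continuous ((fun p => K p q) : Y -> R[i]^o).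
Proof.
move=> cK p; have h : (fun p' => (p', q)) @ p --> (p, q).
  by apply: cvg_pair; [exact: cvg_id|exact: cvg_cst].
exact: (cvg_comp _ (fun w : Y * Y => K w.1 w.2 : R[i]^o) h (cK (p, q))).
Qed.

(** * Approximation of a measure by point masses *)

Section step_approximation.
Variables (R : realType) (d : measure_display) (T : measurableType d).
Variable lambda : {charge set T -> \bar R[i]}.
Local Notation J := (cintegral lambda).
Local Notation L E := (normc (fine (lambda E))).
Variables (C eta : R) (B : set T).
Hypothesis lambdaC : forall E, measurable E -> L E <= C.
Hypothesis mB : measurable B.
Hypothesis lambdaB : forall E, measurable E -> E `<=` ~` B -> L E <= eta.

Lemma cintegral_split (g : T -> R[i]) (M eps : R) : bcmeas g ->
  (forall x, normc (g x) <= M) -> (forall x, B x -> normc (g x) <= eps) -> 0 <= eps ->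
  normc (J g) <= 8 * (eps * C) + 8 * (M * eta).
Proof.
move=> bg gM ge e0; have mB' : measurable (~` B) by exact: measurableC.
have b1 := bcmeas_real (bmeas_indic R mB : bmeas (\1_B : T -> R)).
have b2 := bcmeas_real (bmeas_indic R mB' : bmeas (\1_(~` B) : T -> R)).
have gE : g = (fun x => g x * (\1_B x)%:C + g x * (\1_(~` B) x)%:C).
  apply/funext => x; rewrite !indicE in_setC -mulrDr -rmorphD.
  by case: (x \in B); rewrite /= ?addr0 ?add0r mulr1.
rewrite [in leLHS]gE cintegralD; [|exact: bcmeasM|exact: bcmeasM].
have M0 : 0 <= M by apply: le_trans (gM point); exact: normc_ge0.
apply: le_trans (le_normcD _ _) _; apply: lerD.
- apply: (cintegral_bound mB) => //; first exact: bcmeasM.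
  + move=> x; rewrite indicE normcM normc_real; case: (boolP (x \in B)) => [/set_mem Bx|_].
      by rewrite normr1 mulr1; exact: ge.
    by rewrite normr0 mulr0.
  + by move=> x Bx; rewrite indicE memNset//= mulr0.
  + by move=> F mF _; exact: lambdaC.
- apply: (cintegral_bound mB') => //; first exact: bcmeasM.
  + move=> x; rewrite indicE normcM normc_real; case: (x \in ~` B); last by rewrite normr0 mulr0.
    by rewrite normr1 mulr1.
  + by move=> x Bx; rewrite indicE memNset//= mulr0.
Qed.

Variables (n : nat) (D : nat -> set T) (p : nat -> T).
Hypothesis mD : forall i, measurable (D i).
Hypothesis tD : trivIset setT D.
Hypothesis BD : B = \big[setU/set0]_(i < n) D i.

Definition step (c : nat -> R[i]) (x : T) : R[i] :=
  \sum_(i < n) c i * (\1_(D i) x)%:C.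

Let bD i : bcmeas (fun x => (\1_(D i) x : R)%:C).
Proof. by apply: bcmeas_real; exact: bmeas_indic. Qed.

Lemma bcmeas_step c : bcmeas (step c).
Proof. by apply: bcmeas_sum => i; apply: bcmeasM => //; exact: bcmeas_cst. Qed.

Lemma cintegral_step c : J (step c) = \sum_(i < n) c i * fine (lambda (D i)).
Proof.
rewrite cintegral_sum => [|i]; last by apply: bcmeasM => //; exact: bcmeas_cst.
by apply: eq_bigr => i _; rewrite cintegralZ// cintegral_indic.
Qed.

Lemma step_in c i x : (i < n)%N -> D i x -> step c x = c i.
Proof.
move=> ni Dx; rewrite /step (bigD1 (Ordinal ni))//= indicE mem_set// mulr1 big1 ?addr0// => j ji.
rewrite indicE memNset ?mulr0// => Djx; move/eqP: ji; apply; apply: val_inj => /=.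
by apply: (tD I I); exists x.
Qed.

Lemma step_out c x : ~ B x -> step c x = 0.
Proof.
move=> nBx; rewrite /step big1// => i _; rewrite indicE memNset ?mulr0// => Dx.
by apply: nBx; rewrite BD (bigD1 i)//; left.
Qed.

Lemma B_D x : B x -> exists2 i, (i < n)%N & D i x.
Proof. by rewrite BD -bigcup_mkord => -[i ni Dx]; exists i. Qed.

(** Reading the sum as the integral of a step function gives a bound independent of the number of
    pieces. *)
Lemma step_bound c M : 0 <= M -> (forall i, (i < n)%N -> normc (c i) <= M) ->
  normc (\sum_(i < n) c i * fine (lambda (D i))) <= 8 * (M * C).
Proof.
move=> M0 cM; rewrite -cintegral_step; apply: (cintegral_bound measurableT) => //.
- exact: bcmeas_step.
- move=> x; have [/B_D[i ni Dx]|nBx] := pselect (B x).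
    by rewrite (step_in _ ni Dx) cM.
  by rewrite step_out// normc0.
- by move=> x /(_ I).
- by move=> F mF _; exact: lambdaC.
Qed.

Lemma step_approx (g : T -> R[i]) (M eps : R) : bcmeas g ->
  (forall x, normc (g x) <= M) -> 0 <= eps ->
  (forall i x, (i < n)%N -> D i x -> normc (g x - g (p i)) <= eps) ->
  normc (J g - \sum_(i < n) g (p i) * fine (lambda (D i))) <=
  8 * (eps * C) + 8 * (2 * M * eta).
Proof.
move=> bg gM e0 gD; rewrite -(cintegral_step (g \o p)) -cintegralB//; last exact: bcmeas_step.
have M0 : 0 <= M by apply: le_trans (gM point); exact: normc_ge0.
apply: cintegral_split => //.
- by apply: bcmeasB => //; exact: bcmeas_step.
- move=> x; apply: le_trans (le_normcD _ _) _; rewrite normcN mulr2n mulrDl mul1r.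
  apply: lerD => //; have [/B_D[i ni Dx]|nBx] := pselect (B x).
    by rewrite (step_in _ ni Dx)/=.
  by rewrite step_out// normc0.
- by move=> x /B_D[i ni Dx]; rewrite (step_in _ ni Dx)/= gD.
Qed.

End step_approximation.

(** * Zero energy and dominated functions *)

Section ispd_domination.
Variables (R : realType) (Y : topologicalType) (y0 : Y).
Hypothesis Y_hausdorff : hausdorff_space Y.
Local Notation T := (borel y0).
Variable lambda : {charge set T -> \bar R[i]}.
Hypothesis lambda_radon : finite_radon lambda.
Local Notation J := (cintegral lambda).
Local Notation L E := (normc (fine (lambda E))).

Lemma near_normc (Z : topologicalType) (f : Z -> R[i]^o) (z : Z) (e : R) :
  {for z, continuous f} -> 0 < e -> \forall w \near z, normc (f z - f w) < e.
Proof.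
move=> cf e0; have e0' : 0 < e%:C by rewrite ltcR.
have /cvgrPdist_lt := (cf : f w @[w --> z] --> f z) => /(_ _ e0').
by apply: filterS => w; rewrite /= ltcR.
Qed.

(** The tube lemma: continuity at each [(p, q0)] becomes uniform in [p] over a compact set. *)
Lemma kernel_near_compact (K : Y -> Y -> R[i]) (B : set Y) (q0 : Y) (e : R) :
  continuous_kernel K -> compact B -> 0 < e ->
  \forall q \near q0, forall p, B p -> normc (K p q0 - K p q) <= e.
Proof.
move=> cK cB e0; have e2 : 0 < e / 2 by rewrite divr_gt0.
pose P (A : set Y) := \forall q \near q0, forall p, A p -> normc (K p q0 - K p q) <= e.
apply: (@compact_induction _ B P) => //.
- by rewrite /P; apply: nearW.
- move=> U V; rewrite /P; apply: filterS2 => q HU HV p [Up|Vp]; [exact: HU|exact: HV].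
- by move=> U V UV; rewrite /P; apply: filterS => q H p /UV; exact: H.
- move=> p0 _; have := near_normc (cK (p0, q0)) e2.
  case=> -[U V] /= [Up0 Vq0] UV; exists U => //.
  have Vq0' := Vq0; rewrite /P; apply: filterS Vq0' => q Vq p Up.
  have h1 := UV (p, q) (conj Up Vq); have h2 := UV (p, q0) (conj Up (nbhs_singleton Vq0)).
  rewrite /= in h1 h2.
  have -> : K p q0 - K p q = (K p0 q0 - K p q) - (K p0 q0 - K p q0) by ring.
  apply: le_trans (le_normcD _ _) _; rewrite normcN (splitr e).
  by apply: ltW; apply: ltrD.
Unshelve. all: by end_near. Qed.

(** Sequences do not detect continuity in a general space, so dominated convergence is replaced by
    tightness: over a compact set the sections vary uniformly, and the charge outside is small. *)
Lemma cintegral_section_continuous (K : Y -> Y -> R[i]) (M : R) :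
  continuous_kernel K -> (forall p q, normc (K p q) <= M) ->
  (forall q, bcmeas ((fun p => K p q) : T -> R[i])) ->
  forall q0 e, 0 < e -> \forall q \near q0, normc (J (fun p => K p q0) - J (fun p => K p q)) <= e.
Proof.
move=> cK KM bK q0 e e0.
have M0 : 0 <= M by apply: le_trans (KM y0 y0); exact: normc_ge0.
have [C C0 LC] := radon_bounded lambda_radon.
(* [eta] and, below, [eps] each account for at most [e / 2] in [8 eps C + 8 (2 M) eta]; the added
   [1] guards against [M = 0] and [C = 0]. *)
pose eta := e / (32 * (M + 1)).
have M1 : 0 < 32 * (M + 1) by rewrite mulr_gt0// ltr_wpDl.
have eta0 : 0 < eta by rewrite divr_gt0.
have [B [cB _ LB]] := radon_tight Y_hausdorff lambda_radon measurableT eta0.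
have mB : measurable (B : set T) by exact: borel_compact.
pose eps := e / (16 * (C + 1)).
have C1 : 0 < 16 * (C + 1) by rewrite mulr_gt0// ltr_wpDl.
have eps0 : 0 < eps by rewrite divr_gt0.
apply: filterS (kernel_near_compact q0 cK cB eps0) => q Hq.
rewrite -cintegralB//.
have LB' (F : set T) : measurable F -> F `<=` ~` B -> L F <= eta.
  by move=> mF FB; apply: LB => // x Fx; split => //; exact: FB.
have KM2 p : normc (K p q0 - K p q) <= 2 * M.
  by apply: le_trans (le_normcD _ _) _; rewrite normcN mulr2n mulrDl mul1r lerD.
apply: le_trans (cintegral_split LC mB LB' (bcmeasB (bK q0) (bK q)) KM2 Hq (ltW eps0)) _.
have h1 : eps * (16 * (C + 1)) = e by rewrite divfK// gt_eqF.
have h2 : eta * (32 * (M + 1)) = e by rewrite divfK// gt_eqF.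
move: h1 h2 (ltW eps0) (ltW eta0); nra.
Qed.

Lemma bcmeas_near (h : Y -> R[i]) (M : R) : (forall y, normc (h y) <= M) ->
  (forall q0 e, 0 < e -> \forall q \near q0, normc (h q0 - h q) <= e) ->
  bcmeas (h : T -> R[i]).
Proof.
move=> hM hc; apply: (bcmeas_continuous _ _ hM) => q0.
apply/cvgrPdist_le => e /[!ltcE]/= /andP[/eqP ei e0].
apply: filterS (hc q0 _ e0) => q h1.
by case: e ei e0 h1 => a b /= -> a0 h1; rewrite lecR.
Qed.

(** A finite open cover of [B] by sets of small oscillation is made disjoint by [seqDU]. Hermitian
    symmetry moves the estimate of [kernel_near_compact] to the first variable. *)
Lemma oscillation_partition (K : Y -> Y -> R[i]) (phi : Y -> R[i]) (B : set Y) (e : R) :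
  continuous_kernel K -> continuous (phi : Y -> R[i]^o) -> psd K -> compact B -> 0 < e ->
  exists (n : nat) (D : nat -> set Y) (p : nat -> Y),
    [/\ forall i, measurable (D i : set T), trivIset setT D, B = \big[setU/set0]_(i < n) D i &
     forall i x, (i < n)%N -> D i x -> [/\ D i (p i), normc (phi x - phi (p i)) <= e &
       forall q, B q -> normc (K x q - K (p i) q) <= e]].
Proof.
move=> cK cphi pK cB e0; have e2 : 0 < e / 2 by rewrite divr_gt0.
pose small (E : set Y) := open E /\ forall x y, E x -> E y -> normc (phi x - phi y) <= e /\
  forall q, B q -> normc (K x q - K y q) <= e.
pose P (A : set Y) := exists (n : nat) (E : nat -> set Y), (forall i, small (E i)) /\
  A `<=` \big[setU/set0]_(i < n) E i.
have [n [E [sE BE]]] : P B.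
  apply: (@compact_induction _ B P) => //.
  - by exists 0%N, (fun=> set0); split => [i|]; [split => //; exact: open0|exact: sub0set].
  - move=> U V [n [E [sE UE]]] [n' [E' [sE' VE']]].
    pose G i := if (i < n)%N then E i else E' (i - n)%N.
    exists (n + n')%N, G; split; first by move=> i; rewrite /G; case: ifP.
    rewrite -(bigcup_mkord _ G); move: UE VE'; rewrite -!bigcup_mkord => UE VE' x [/UE|/VE'] [i /= ni Ex].
      by exists i => /=; [exact: ltn_addr|rewrite /G ni].
    by exists (n + i)%N => /=; [rewrite ltn_add2l|rewrite /G ltnNge leq_addr/= addKn].
  - by move=> U V UV [n [E [sE VE]]]; exists n, E; split => //; exact: subset_trans VE.
  - move=> x0 Bx0.
    have Kh x q : normc (K x0 q - K x q) = normc (K q x0 - K q x).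
      by rewrite (psd_herm q x0 pK) (psd_herm q x pK) -conjcN -conjcD normc_conj.
    have H : \forall x \near x0, normc (phi x0 - phi x) <= e / 2 /\
        forall q, B q -> normc (K x0 q - K x q) <= e / 2.
      near=> x; split.
        by apply: ltW; near: x; exact: near_normc (cphi x0) e2.
      move=> q Bq; rewrite Kh; move: q Bq; near: x.
      exact: kernel_near_compact.
    move: H; rewrite /prop_near1 nbhsE => -[U [oU Ux0] UH].
    exists U; first by exists U.
    exists 1%N, (fun=> U); split; last by rewrite big_ord1.
    move=> _; split => // x y /UH[x1 x2] /UH[y1 y2]; rewrite (splitr e); split=> [|q Bq].
      have -> : phi x - phi y = (phi x0 - phi y) - (phi x0 - phi x) by ring.
      by apply: le_trans (le_normcD _ _) _; rewrite normcN lerD.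
    have -> : K x q - K y q = (K x0 q - K y q) - (K x0 q - K x q) by ring.
    by apply: le_trans (le_normcD _ _) _; rewrite normcN lerD// ?x2 ?y2.
pose F i := E i `&` B.
(* An empty piece has no point to offer and receives the dummy [y0]. *)
exists n, (seqDU F), (fun i => if pselect (exists x, seqDU F i x) is left h then sval (cid h) else y0).
have mF i : measurable (F i : set T).
  by apply: measurableI; [apply: borel_open; have [] := sE i|exact: borel_compact].
split.
- by move=> i; apply: measurableD => //; exact: bigsetU_measurable.
- exact: trivIset_seqDU.
- rewrite -(bigsetU_seqDU F); apply/seteqP; split => x; rewrite -(bigcup_mkord n F).
    by move=> Bx; move: (BE x Bx); rewrite -bigcup_mkord => -[i ni Ex]; exists i.
  by move=> [i _ []].
- move=> i x ni Dx; case: pselect => [h|]; last by case; exists x.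
  case: (cid h) => y /= Dy; have [[Ey _] _] := Dy; have [[Ex _] _] := Dx.
  by have [_ /(_ x y Ex Ey)[]] := sE i.
Unshelve. all: by end_near. Qed.

(* Up to a small error [lambda] is a combination of point masses, to which
   [cdom K M phi] applies: [|int phi|^2 <= M * int int K]. *)
Lemma ispd_domination (K : Y -> Y -> R[i]) (phi : Y -> R[i]) (MK Mphi M : R) :
  continuous_kernel K -> (forall p q, normc (K p q) <= MK) -> psd K ->
  continuous (phi : Y -> R[i]^o) -> (forall p, normc (phi p) <= Mphi) ->
  0 <= M -> cdom K M phi ->
  cintegral (conj_charge lambda) (fun q => J (fun p => K p q)) = 0 ->
  J phi = 0.
Proof.
move=> cK KM pK cphi phiM M0 Kphi I0.
have MK0 : 0 <= MK by apply: le_trans (KM y0 y0); exact: normc_ge0.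
have Mphi0 : 0 <= Mphi by apply: le_trans (phiM y0); exact: normc_ge0.
have [C C0 LC] := radon_bounded lambda_radon.
have bK q : bcmeas ((fun p => K p q) : T -> R[i]).
  apply: (bcmeas_continuous _ _ (fun p => KM p q)) => p.
  exact: continuous_section.
have bphi : bcmeas (phi : T -> R[i]) by exact: bcmeas_continuous phiM.
pose h q := J (fun p => K p q).
have hM q : normc (h q) <= 8 * (MK * C).
  apply: (cintegral_bound measurableT) => //; first by move=> x /(_ I).
  by move=> F mF _; exact: LC.
have bh : bcmeas (h : T -> R[i]).
  exact: (bcmeas_near hM (cintegral_section_continuous cK KM bK)).
have LC' (E : set T) : measurable E -> normc (fine (conj_charge lambda E)) <= C.
  by move=> mE; rewrite /= normc_conj; exact: LC.
(* The sum over the point masses is of order [sqrt e] and the error of order [e]; both vanish with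
   [e]. *)
suff main e : 0 < e -> exists2 x : R, 0 <= x & x ^+ 2 <= M * ((128 * C * C + 384 * MK * C) * e) /\
    normc (J phi) <= x + (8 * C + 16 * Mphi) * e.
  apply/eq0_normc/eqP; rewrite -[_ == 0]negbK; apply/negP => a0.
  set a := normc (J phi) in a0 main.
  have {}a0 : 0 < a by rewrite lt_neqAle eq_sym a0 normc_ge0.
  pose k1 := 128 * C * C + 384 * MK * C; pose k2 := 8 * C + 16 * Mphi.
  have k10 : 0 <= k1.
    exact: (addr_ge0 (mulr_ge0 (mulr_ge0 (ler0n _ _) C0) C0) (mulr_ge0 (mulr_ge0 (ler0n _ _) MK0) C0)).
  have k20 : 0 <= k2 by exact: (addr_ge0 (mulr_ge0 (ler0n _ _) C0) (mulr_ge0 (ler0n _ _) Mphi0)).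
  have Mk0 : 0 <= M * k1 by rewrite mulr_ge0.
  (* For [e <= e1] the error is at most [a / 2]; for [e <= e2] the square of the main term is at
     most [a^2 / 8], less than [(a / 2)^2]. *)
  pose e1 := a / (2 * (k2 + 1)); pose e2 := a ^+ 2 / (8 * (M * k1 + 1)).
  have d1 : 0 < 2 * (k2 + 1) by rewrite mulr_gt0// ltr_wpDl.
  have d2 : 0 < 8 * (M * k1 + 1) by rewrite mulr_gt0// ltr_wpDl.
  have e10 : 0 < e1 by rewrite divr_gt0.
  have e20 : 0 < e2 by rewrite divr_gt0// exprn_gt0.
  have [x x0 [h1 h2]] : exists2 x : R, 0 <= x & x ^+ 2 <= M * (k1 * Num.min e1 e2) /\
    a <= x + k2 * Num.min e1 e2 by apply: main; rewrite lt_min e10.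
  have f1 : k2 * Num.min e1 e2 <= a / 2.
    apply: (@le_trans _ _ (k2 * e1)); first by rewrite ler_wpM2l// ge_min lexx.
    have : e1 * (2 * (k2 + 1)) = a by rewrite divfK// gt_eqF.
    move: e10; nra.
  have f2 : M * (k1 * Num.min e1 e2) <= a ^+ 2 / 8.
    apply: (@le_trans _ _ (M * k1 * e2)).
      by rewrite mulrA ler_wpM2l// ge_min lexx orbT.
    have : e2 * (8 * (M * k1 + 1)) = a ^+ 2 by rewrite divfK// gt_eqF.
    move: e20; nra.
  have f3 : a / 2 <= x by lra.
  have : (a / 2) ^+ 2 <= x ^+ 2 by rewrite lerXn2r ?nnegrE// divr_ge0// ltW.
  have := exprn_gt0 2 a0; lra.
move=> e0.
have [B [cB _ LB]] := radon_tight Y_hausdorff lambda_radon measurableT e0.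
have mB : measurable (B : set T) by exact: borel_compact.
have LB1 (F : set T) : measurable F -> F `<=` ~` B -> L F <= e.
  by move=> mF FB; apply: LB => // x Fx; split => //; exact: FB.
have LB2 (F : set T) : measurable F -> F `<=` ~` B -> normc (fine (conj_charge lambda F)) <= e.
  by move=> mF FB; rewrite /= normc_conj; exact: LB1.
have [n [D [p [mD tD BD osc]]]] := oscillation_partition cK cphi pK cB e0.
pose l i := fine (lambda (D i)).
pose s := [seq (l i, p i) | i <- index_iota 0 n].
have DB i x : (i < n)%N -> D i x -> B x.
  by move=> ni Dx; rewrite BD -bigcup_mkord; exists i.
have Kh x y q : normc (K q x - K q y) = normc (K x q - K y q).
  by rewrite (psd_herm q x pK) (psd_herm q y pK) -conjcN -conjcD normc_conj.
have A1 : normc (J phi - \sum_(i < n) phi (p i) * l i) <= (8 * C + 16 * Mphi) * e.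
  apply: le_trans (step_approx LC mB LB1 mD tD BD bphi phiM (ltW e0) _) _.
    by move=> i x ni /(osc _ _ ni)[].
  by rewrite le_eqVlt; apply/orP; left; apply/eqP; ring.
have hosc i x : (i < n)%N -> D i x -> normc (h x - h (p i)) <= 8 * (e * C) + 8 * (2 * MK * e).
  move=> ni Dx; rewrite /h -cintegralB//.
  apply: (cintegral_split LC mB LB1 (bcmeasB (bK x) (bK (p i)))) => [y|y By|]; last exact: ltW.
    by apply: le_trans (le_normcD _ _) _; rewrite normcN mulr2n mulrDl mul1r lerD.
  by rewrite Kh; have [_ _] := osc _ _ ni Dx; exact.
have A2 : normc (0 - \sum_(j < n) h (p j) * (l j)^c) <=
    8 * ((8 * (e * C) + 8 * (2 * MK * e)) * C) + 8 * (2 * (8 * (MK * C)) * e).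
  rewrite -[X in normc (X - _)]I0.
  apply: (step_approx LC' mB LB2 mD tD BD bh hM _ hosc).
  by rewrite addr_ge0// !mulr_ge0// ltW.
pose w j := \sum_(i < n) K (p i) (p j) * l i.
pose E1 := 8 * (e * C) + 8 * (2 * MK * e).
have E10 : 0 <= E1 by rewrite addr_ge0// !mulr_ge0// ltW.
(* On an empty piece the dummy [p j] may lie outside [B], where the difference is not controlled;
   the charge of the piece is zero, so [delta] is set to zero there. *)
pose delta j := if `[< exists y, D j y >] then h (p j) - w j else 0.
have A3 j : (j < n)%N -> normc (delta j) <= E1.
  move=> nj; rewrite /delta; case: asboolP => [[y Dy]|_]; last by rewrite normc0.
  have [Dpj _ _] := osc _ _ nj Dy.
  apply: (step_approx LC mB LB1 mD tD BD (bK (p j)) (fun q => KM q (p j)) (ltW e0)) => i x ni Dx.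
  have [_ _ o2] := osc _ _ ni Dx.
  exact: o2 (DB _ _ nj Dpj).
have A4 : \sum_(j < n) delta j * (l j)^c =
    \sum_(j < n) h (p j) * (l j)^c - \sum_(j < n) w j * (l j)^c.
  rewrite -sumrB; apply: eq_bigr => j _; rewrite /delta.
  case: asboolP => [_|nD]; first by rewrite mulrBl.
  have -> : l j = 0.
    rewrite /l (_ : D j = set0) ?charge0//.
    by apply/seteqP; split => // y Dy; case: nD; exists y.
  by rewrite conjc0 !mulr0 subrr.
have A5 : normc (\sum_(j < n) delta j * (l j)^c) <= 8 * (E1 * C).
  exact: (step_bound LC' mD tD BD E10 A3).
have sE : sesq K s s = \sum_(j < n) w j * (l j)^c.
  rewrite /sesq big_map big_mkord.
  under eq_bigr do rewrite big_map big_mkord.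
  rewrite exchange_big; apply: eq_bigr => j _ /=; rewrite /w big_distrl/=.
  by apply: eq_bigr => i _; ring.
have A6 : normc (sesq K s s) <= 8 * (E1 * C) + (8 * (E1 * C) + 8 * (2 * (8 * (MK * C)) * e)).
  have -> : sesq K s s = - (\sum_(j < n) delta j * (l j)^c) - (0 - \sum_(j < n) h (p j) * (l j)^c).
    by rewrite A4 sE; ring.
  by apply: le_trans (le_normcD _ _) _; rewrite !normcN lerD.
(* Here [cdom] is tested on the combination [s] of point masses. *)
have A7 : normc (\sum_(i < n) phi (p i) * l i) ^+ 2 <= M * normc (sesq K s s).
  have Es : sesq (fun x y => M%:C * K x y - phi x * (phi y)^c) s s =
      M%:C * sesq K s s - sesq (fun x y => phi x * (phi y)^c) s s.
    rewrite -sesqZ -[in RHS]mulN1r -sesqZ -sesqD; congr sesq.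
    by apply/funext => x; apply/funext => y; rewrite mulN1r.
  have := Kphi s; rewrite Es.
  rewrite subr_ge0 sesq_rank1 big_map big_mkord.
  rewrite (eq_bigr (fun i : 'I_n => phi (p i) * l i)) => [|i _]; last by rewrite mulrC.
  rewrite -sqr_normc (_ : `|_| = (normc (\sum_(i < n) phi (p i) * l i))%:C)//.
  have eN (x : R) : x%:C ^+ 2 = (x ^+ 2)%:C by rewrite -rmorphXn.
  rewrite eN; case: (sesq K s s) => a b; rewrite lecE => /andP[_ /= h1].
  rewrite mul0r subr0 in h1; apply: le_trans h1 _; rewrite ler_wpM2l//.
  by apply: le_trans (normc_Re (Complex a b)); rewrite ler_norm.
exists (normc (\sum_(i < n) phi (p i) * l i)); first exact: normc_ge0.
split.
  apply: le_trans A7 _; rewrite ler_wpM2l//; apply: le_trans A6 _.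
  rewrite /E1 -subr_ge0.
  rewrite (_ : _ - _ = 0); last by ring.
  by [].
have -> : J phi = \sum_(i < n) phi (p i) * l i + (J phi - \sum_(i < n) phi (p i) * l i) by ring.
by apply: le_trans (le_normcD _ _) _; rewrite lerD.
Qed.

End ispd_domination.

(** * A Stone-Weierstrass theorem for measures *)

Section smoothstep.
Variable R : realType.

(* Iterating [smoothstep] sends [x > 1/2] to [1] and [x < 1/2] to [0]: it turns a
   multiplier into the indicator of one of its superlevel sets. *)
Definition smoothstep (x : R) : R := x ^+ 2 * (3 - 2 * x).

Lemma smoothstep_ge0 x : 0 <= x <= 1 -> 0 <= smoothstep x <= 1.
Proof.
move=> /andP[x0 x1]; rewrite /smoothstep; apply/andP; split.
  by rewrite mulr_ge0 ?sqr_ge0//; lra.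
have -> : x ^+ 2 * (3 - 2 * x) = 1 - (1 - x) ^+ 2 * (1 + 2 * x) by ring.
by rewrite lerBlDr lerDl mulr_ge0 ?sqr_ge0//; lra.
Qed.

Lemma iter_smoothstep_ge0 n x : 0 <= x <= 1 -> 0 <= iter n smoothstep x <= 1.
Proof. by move=> x01; elim: n => //= n IH; exact: smoothstep_ge0. Qed.

Lemma smoothstep_sym x : smoothstep (1 - x) = 1 - smoothstep x.
Proof. by rewrite /smoothstep; ring. Qed.

Lemma iter_smoothstep_sym n x : iter n smoothstep (1 - x) = 1 - iter n smoothstep x.
Proof. by elim: n => //= n ->; exact: smoothstep_sym. Qed.

(** Since [1 - smoothstep y = (1 - y) (1 + y - 2 y^2)], and on [[x, 1]] the second factor is at most
    its value [rho < 1] at [x], the distance to [1] decays geometrically. *)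
Lemma iter_smoothstep_gt x : 2^-1 < x <= 1 ->
  (fun n => iter n smoothstep x) @ \oo --> (1 : R).
Proof.
move=> /andP[x0 x1]; pose rho := 1 + x - 2 * x ^+ 2.
have rho1 : rho < 1 by rewrite /rho; nra.
have rho0 : 0 <= rho by rewrite /rho; nra.
have H n : x <= iter n smoothstep x <= 1 /\ 1 - iter n smoothstep x <= rho ^+ n.
  elim: n => /= [|n [/andP[h1 h2] h3]]; first by rewrite lexx x1 expr0; split => //; lra.
  set y := iter n smoothstep x in h1 h2 h3 *.
  have E : 1 - smoothstep y = (1 - y) * (1 + y - 2 * y ^+ 2) by rewrite /smoothstep; ring.
  have r1 : 1 + y - 2 * y ^+ 2 <= rho by rewrite /rho; nra.
  have r0 : 0 <= 1 + y - 2 * y ^+ 2 by nra.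
  have y1 : 0 <= 1 - y by lra.
  split.
    apply/andP; split; nra.
  by rewrite E [leRHS]exprSr; exact: ler_pM.
have hr : (fun n => rho ^+ n) @ \oo --> (0 : R) by apply: cvg_expr; rewrite ger0_norm.
apply/cvgrPdist_le => e e0; move/cvgrPdist_le : hr => /(_ _ e0).
apply: filterS => n; rewrite sub0r normrN ger0_norm ?exprn_ge0// => h.
have [/andP[h1 h2] h3] := H n.
by rewrite ger0_norm ?subr_ge0//; exact: le_trans h.
Qed.

Lemma iter_smoothstep_lt x : 0 <= x < 2^-1 ->
  (fun n => iter n smoothstep x) @ \oo --> (0 : R).
Proof.
move=> /andP[x0 x1].
have h : (fun n => iter n smoothstep (1 - x)) @ \oo --> (1 : R).
  by apply: iter_smoothstep_gt; apply/andP; split; lra.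
have -> : (fun n => iter n smoothstep x) = (fun n => 1 - iter n smoothstep (1 - x)).
  by apply/funext => n; rewrite iter_smoothstep_sym; ring.
rewrite -[X in _ --> X](subrr (1 : R)).
by apply: cvgB => //; exact: cvg_cst.
Qed.

Lemma iter_smoothstep_half n : iter n smoothstep 2^-1 = 2^-1.
Proof. by elim: n => //= n ->; rewrite /smoothstep; field. Qed.

(** The sum is the ceiling of [y]. It serves to compare a function with the staircase of its
    superlevel sets. *)
Lemma count_lt_bounds n (y : R) : 0 <= y <= n%:R ->
  y <= \sum_(k < n) (k%:R < y)%R%:R <= y + 1.
Proof.
elim: n y => [|n IH] y /andP[y0 yn].
  by rewrite big_ord0; apply/andP; split => //; lra.
rewrite big_ord_recr/=; have [yn'|ny] := leP y n%:R.
  by rewrite addr0 IH// y0.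
rewrite (eq_bigr (fun=> 1)) => [|k _]; last first.
  by rewrite (_ : (k%:R < y)%R = true)//; apply: le_lt_trans ny; rewrite ler_nat ltnW.
rewrite sumr_const card_ord -[1 *+ n]/(n%:R) (_ : true%:R = 1 :> R)//.
move: yn; rewrite -natr1 => yn; apply/andP; split => //; lra.
Qed.

End smoothstep.

Section measure_uniqueness.
Variables (R : realType) (Y : topologicalType) (y0 : Y).
Hypothesis Y_hausdorff : hausdorff_space Y.
Local Notation T := (borel y0).
Variable lambda : {charge set T -> \bar R[i]}.
Hypothesis lambda_radon : finite_radon lambda.
Local Notation J := (cintegral lambda).
Variables (I : Type) (w : I -> T -> R[i]).
Hypothesis bw : forall i, bcmeas (w i).

(** A whole family of weights is tested at once because multiplication by a generating function
    turns one weight into others of the same family: it adds a sine to a list or shifts the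
    frequencies of the cosines. *)
Definition annihilated (f : T -> R) : Prop :=
  bmeas f /\ forall i, J (fun x => w i x * (f x)%:C) = 0.
Local Notation W := annihilated.

Let bwf i f : bmeas f -> bcmeas (fun x => w i x * (f x)%:C).
Proof. by move=> bf; apply: bcmeasM => //; exact: bcmeas_real. Qed.

Lemma annihilatedD f g : W f -> W g -> W (fun x => f x + g x).
Proof.
move=> [bf f0] [bg g0]; split; first exact: bmeasD.
move=> i; under eq_fun do rewrite rmorphD mulrDr.
by rewrite cintegralD ?f0 ?g0 ?addr0//; exact: bwf.
Qed.

Lemma annihilatedZ c f : W f -> W (fun x => c * f x).
Proof.
move=> [bf f0]; split; first by apply: bmeasM => //; exact: bmeas_cst.
move=> i; under eq_fun do rewrite rmorphM mulrCA.
by rewrite cintegralZ ?f0 ?mulr0//; exact: bwf.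
Qed.

Lemma annihilated_lim (f_ : nat -> T -> R) f M :
  (forall n, W (f_ n)) -> (forall n x, `|f_ n x| <= M) ->
  (forall x, (fun n => f_ n x) @ \oo --> f x) -> W f.
Proof.
move=> Wf fM ff.
have mf : measurable_fun setT f.
  apply: (@measurable_fun_cvg _ _ _ setT f_) => //.
  by move=> n; have [[]] := Wf n.
have fM' x : `|f x| <= M.
  by apply: (cvgr_to_le (cvg_norm (ff x))); exact: nearW.
have bf : bmeas f by split => //; exists M.
split => // i; have [N N0 wN] := bcmeas_bound (bw i).
apply: (@cintegral_cvg0 _ _ _ lambda (fun n x => w i x * (f_ n x)%:C) _ (N * M)) => //.
- by move=> n; apply: bwf; have [] := Wf n.
- exact: bwf.
- by move=> n x; rewrite normcM normc_real ler_pM// normc_ge0.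
- move=> x; rewrite Re_mulr; under eq_cvg do rewrite Re_mulr.
  by apply: cvgM; [exact: cvg_cst|exact: ff].
- move=> x; rewrite Im_mulr; under eq_cvg do rewrite Im_mulr.
  by apply: cvgM; [exact: cvg_cst|exact: ff].
- by move=> n; have [_] := Wf n.
Qed.

(** Annihilated functions form only a vector space. Their multipliers form an algebra, also closed
    under bounded pointwise limits, in which polynomials and then indicators can be built. *)
Definition multiplier (f : T -> R) : Prop :=
  bmeas f /\ forall h, W h -> W (fun x => f x * h x).
Local Notation V := multiplier.

Lemma multiplierD f g : V f -> V g -> V (fun x => f x + g x).
Proof.
move=> [bf Vf] [bg Vg]; split; first exact: bmeasD.
move=> h Wh; under [X in W X]eq_fun do rewrite mulrDl.
exact: annihilatedD (Vf _ Wh) (Vg _ Wh).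
Qed.

Lemma multiplierM f g : V f -> V g -> V (fun x => f x * g x).
Proof.
move=> [bf Vf] [bg Vg]; split; first exact: bmeasM.
move=> h Wh; under [X in W X]eq_fun do rewrite -mulrA.
exact: Vf (Vg _ Wh).
Qed.

Lemma multiplier_cst c : V (fun=> c).
Proof. by split; [exact: bmeas_cst|move=> h; exact: annihilatedZ]. Qed.

Lemma multiplierB f g : V f -> V g -> V (fun x => f x - g x).
Proof.
move=> Vf Vg; have := multiplierD Vf (multiplierM (multiplier_cst (-1)) Vg).
by rewrite (_ : (fun x => _) = (fun x => f x - g x))//; apply/funext => x; rewrite mulN1r.
Qed.

Lemma multiplier_lim (f_ : nat -> T -> R) f M :
  (forall n, V (f_ n)) -> (forall n x, `|f_ n x| <= M) ->
  (forall x, (fun n => f_ n x) @ \oo --> f x) -> V f.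
Proof.
move=> Vf fM ff.
have fM' x : `|f x| <= M.
  by apply: (cvgr_to_le (cvg_norm (ff x))); exact: nearW.
have mf : measurable_fun setT f.
  apply: (@measurable_fun_cvg _ _ _ setT f_) => //.
  by move=> n; have [[]] := Vf n.
split; first by split => //; exists M.
move=> h Wh; have [[_ [N hN]] _] := Wh.
apply: (@annihilated_lim (fun n x => f_ n x * h x) _ (M * N)) => [n|n x|x].
- by have [_] := Vf n; exact.
- by rewrite normrM ler_pM.
- by apply: cvgM => //; exact: cvg_cst.
Qed.

Definition mult_set (S : set Y) : Prop := V (\1_S : T -> R).

Lemma mult_set0 : mult_set set0.
Proof. by rewrite /mult_set indic0; exact: multiplier_cst. Qed.

Lemma mult_setC S : mult_set S -> mult_set (~` S).
Proof.
move=> VS; have := multiplierB (multiplier_cst 1) VS; rewrite /mult_set.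
congr V; apply/funext => x; rewrite !indicE in_setC.
by case: (x \in S); rewrite ?subrr ?subr0.
Qed.

Lemma mult_setI S S' : mult_set S -> mult_set S' -> mult_set (S `&` S').
Proof.
move=> VS VS'; have := multiplierM VS VS'; rewrite /mult_set.
by congr V; apply/funext => x; rewrite !indicE in_setI -natrM mulnb.
Qed.

Lemma mult_setU S S' : mult_set S -> mult_set S' -> mult_set (S `|` S').
Proof.
move=> VS VS'; rewrite -(setCK (S `|` S')) setCU; apply: mult_setC.
by apply: mult_setI; exact: mult_setC.
Qed.

(** An affine change moves the threshold [c] to [1/2] and the range into [[0, 1]], where the
    iterates of [smoothstep] converge boundedly. *)
Lemma multiplier_gt f c : V f -> mult_set [set x | c < f x].
Proof.
move=> Vf; have [[_ [M0 fM0]] _] := Vf.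
pose M := M0 + `|c| + 1.
have M0' : 0 <= M0 by apply: le_trans (fM0 point).
have M1 : 0 < M by rewrite ltr_wpDl// addr_ge0.
have fM x : `|f x - c| <= M.
  by apply: le_trans (ler_normB _ _) _; rewrite /M -addrA lerD// lerDl.
pose g x := (f x - c) / (2 * M) + 2^-1.
have Vg : V g.
  apply: multiplierD (multiplier_cst _); apply: multiplierM (multiplier_cst _).
  exact: multiplierB Vf (multiplier_cst c).
have g01 x : 0 <= g x <= 1.
  have := fM x; rewrite ler_norml => /andP[h1 h2].
  have d0 : 0 < 2 * M by rewrite mulr_gt0.
  have -> : g x = (f x - c + M) / (2 * M) by rewrite /g; field; rewrite gt_eqF.
  apply/andP; split; first by apply: divr_ge0; [lra|exact: ltW].
  by rewrite ler_pdivrMr// mul1r; lra.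
have Vs n : V (fun x => iter n (@smoothstep R) (g x)).
  elim: n => //= n IH; rewrite /smoothstep.
  under [X in V X]eq_fun do rewrite expr2.
  apply: multiplierM; first exact: multiplierM.
  apply: multiplierB (multiplier_cst _) _; exact: multiplierM (multiplier_cst _) IH.
pose l x : R := if c < f x then 1 else if f x < c then 0 else 2^-1.
have Vl : V l.
  apply: (@multiplier_lim (fun n x => iter n (@smoothstep R) (g x)) l 1) => // [n x|x].
    by have /andP[h1 h2] := iter_smoothstep_ge0 n (g01 x); rewrite ger0_norm.
  have d0 : 0 < (2 * M)^-1 by rewrite invr_gt0 mulr_gt0.
  rewrite /l; case: ltgtP => h.
  - apply: iter_smoothstep_gt; have /andP[_ ->] := g01 x; rewrite andbT /g.
    by rewrite ltr_pwDl// mulr_gt0// subr_gt0.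
  - apply: iter_smoothstep_lt; have /andP[-> _] := g01 x; rewrite /= /g.
    by rewrite gtrDr pmulr_llt0// subr_lt0.
  - rewrite /g h subrr mul0r add0r; under eq_fun do rewrite iter_smoothstep_half.
    exact: cvg_cst.
(* The limit [l] takes the value [1/2] where [f = c]; the polynomial [l (2 l - 1)] sends [0], [1/2],
   [1] to [0], [0], [1]. *)
have := multiplierM Vl (multiplierB (multiplierM (multiplier_cst 2) Vl) (multiplier_cst 1)).
rewrite /mult_set; congr V; apply/funext => x; rewrite indicE /l.
case: (boolP (x \in _)) => [|/negP]; rewrite inE/=.
  by move=> ->; rewrite !mulr1; ring.
move=> /negP; rewrite -leNgt => h; rewrite ltNge h/=.
case: ltP => _; rewrite ?mul0r//; rewrite (_ : _ - _ = 0) ?mulr0//.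
by rewrite divff ?subrr// pnatr_eq0.
Qed.

Lemma multiplier_lt f c : V f -> mult_set [set x | f x < c].
Proof.
move=> Vf; have := multiplier_gt (- c) (multiplierB (multiplier_cst 0) Vf).
by rewrite (_ : [set x | _] = [set x | f x < c])//; apply/seteqP; split => x /=; rewrite sub0r ltrN2.
Qed.

Variable G : set (Y -> R).
Hypothesis G_cont : forall g, G g -> continuous g.
Hypothesis G_mult : forall g, G g -> multiplier (g : T -> R).
Hypothesis W1 : W (fun=> 1).

Definition separated_by (p q : Y) : Prop := exists2 g, G g & g p <> g q.

Lemma separated_nbhs p q : separated_by p q -> exists S S' : set Y,
  [/\ mult_set S, mult_set S', nbhs p S, nbhs q S' & S `&` S' `<=` set0].
Proof.
move=> [g Gg gpq]; have Vg := G_mult Gg; have cg := G_cont Gg.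
pose c := (g p + g q) / 2.
have oG : open (g @^-1` [set y | c < y]) by move/continuousP : (cg); apply; exact: open_gt.
have oL : open (g @^-1` [set y | y < c]) by move/continuousP : (cg); apply; exact: open_lt.
have [pq|qp|//] := ltgtP (g p) (g q).
- exists [set x | g x < c], [set x | c < g x]; split.
  + exact: multiplier_lt.
  + exact: multiplier_gt.
  + by apply: open_nbhs_nbhs; split => //=; rewrite /c; lra.
  + by apply: open_nbhs_nbhs; split => //=; rewrite /c; lra.
  + by move=> x [/= h1 h2]; have := lt_trans h1 h2; rewrite ltxx.
- exists [set x | c < g x], [set x | g x < c]; split.
  + exact: multiplier_gt.
  + exact: multiplier_lt.
  + by apply: open_nbhs_nbhs; split => //=; rewrite /c; lra.
  + by apply: open_nbhs_nbhs; split => //=; rewrite /c; lra.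
  + by move=> x [/= h1 h2]; have := lt_trans h1 h2; rewrite ltxx.
Qed.

(** The classical separation of disjoint compact sets in a Hausdorff space, with multiplier sets in
    the role of open sets: compactness of [K2] for a fixed point of [K1], then compactness of
    [K1]. *)
Lemma separated_compact (K1 K2 : set Y) : compact K1 -> compact K2 ->
  (forall p q, K1 p -> K2 q -> separated_by p q) ->
  exists S, [/\ mult_set S, K1 `<=` S & S `&` K2 `<=` set0].
Proof.
move=> cK1 cK2 sep.
pose Q (A : set Y) := exists S, [/\ mult_set S, A `<=` S & S `&` K2 `<=` set0].
apply: (@compact_induction _ K1 Q) => //.
- by exists set0; split; [exact: mult_set0|exact: subset_refl|rewrite set0I].
- move=> U U' [S [VS US SK]] [S' [VS' US' SK']]; exists (S `|` S'); split.
  + exact: mult_setU.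
  + exact: setUSS.
  + by move=> x [[Sx|Sx] Kx]; [apply: (SK x)|apply: (SK' x)].
- by move=> U U' UU' [S [VS US SK]]; exists S; split => //; exact: subset_trans US.
move=> p K1p.
pose P (A : set Y) := exists S S', [/\ mult_set S, mult_set S', nbhs p S, A `<=` S' & S `&` S' `<=` set0].
have [S [S' [VS VS' Sp K2S' SS']]] : P K2.
  apply: (@compact_induction _ K2 P) => //.
  - exists setT, set0; split.
    + by rewrite -setC0; apply: mult_setC; exact: mult_set0.
    + exact: mult_set0.
    + exact: filterT.
    + exact: subset_refl.
    + by rewrite setTI.
  - move=> A A' [S [S' [VS VS' Sp AS' SS']]] [U [U' [VU VU' Up AU' UU']]].
    exists (S `&` U), (S' `|` U'); split.
    + exact: mult_setI.
    + exact: mult_setU.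
    + exact: filterI.
    + exact: setUSS.
    + by move=> x [[Sx Ux] [S'x|U'x]]; [apply: (SS' x)|apply: (UU' x)].
  - move=> A A' AA' [S [S' [VS VS' Sp AS' SS']]]; exists S, S'; split => //.
    exact: subset_trans AS'.
  - move=> q K2q; have [S [S' [VS VS' Sp S'q SS']]] := separated_nbhs (sep p q K1p K2q).
    by exists S' => //; exists S, S'; split.
exists S => //; exists S; split => // x [Sx /K2S' S'x].
exact: (SS' x).
Qed.

(** Compact sets inside [E] and inside its complement carry [lambda] up to [2 e]. A multiplier set
    separating them has an indicator that agrees with that of [E] on both, and that is annihilated
    because [1] is. *)
Lemma annihilated_indic (E : set T) : measurable E ->
  (forall p q, E p -> ~ E q -> separated_by p q) -> W (\1_E).
Proof.
move=> mE sep; split; first exact: bmeas_indic.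
move=> i; apply: eq0_normc; have [M M0 wM] := bcmeas_bound (bw i).
have [C C0 LC] := radon_bounded lambda_radon.
suff H e : 0 < e -> normc (J (fun x => w i x * (\1_E x)%:C)) <= 16 * M * e.
  apply/eqP; rewrite eq_le normc_ge0 andbT.
  apply/ler_addgt0Pr => e e0; rewrite add0r.
  have d0 : 0 < 16 * (M + 1) by rewrite mulr_gt0// ltr_wpDl.
  apply: le_trans (H (e / (16 * (M + 1))) _) _; first by rewrite divr_gt0.
  rewrite mulrA ler_pdivrMr//; move: (ltW e0); nra.
move=> e0.
have [K1 [cK1 K1E H1]] := radon_tight Y_hausdorff lambda_radon mE e0.
have mE' : measurable (~` E) by exact: measurableC.
have [K2 [cK2 K2E H2]] := radon_tight Y_hausdorff lambda_radon mE' e0.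
have [S [VS K1S SK2]] := separated_compact cK1 cK2 (fun p q Kp Kq => sep p q (K1E p Kp) (K2E q Kq)).
have mB : measurable (K1 `|` K2 : set T) by apply: measurableU; exact: borel_compact.
have LB (F : set T) : measurable F -> F `<=` ~` (K1 `|` K2) ->
    normc (fine (lambda F)) <= 2 * e.
  move=> mF FB; have := chargeU lambda (measurableI _ _ mF mE) (measurableI _ _ mF mE').
  rewrite -setIUr setUv setIT => ->; last by rewrite setIACA setICr setI0.
  rewrite fineD; [|exact: fin_num_measure _ _ (measurableI _ _ mF mE)|exact: fin_num_measure _ _ (measurableI _ _ mF mE')].
  apply: le_trans (le_normcD _ _) _; rewrite mulr2n mulrDl mul1r; apply: lerD.
    apply: H1; first exact: measurableI.
    by move=> x [Fx Ex]; split => // K1x; apply: (FB x Fx); left.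
  apply: H2; first exact: measurableI.
  by move=> x [Fx Ex]; split => // K2x; apply: (FB x Fx); right.
have WS : W (\1_S).
  have [_ /(_ _ W1)] := VS.
  by under [X in W X]eq_fun do rewrite mulr1.
have bE : bmeas (\1_E : T -> R) by exact: bmeas_indic.
have bS : bmeas (\1_S : T -> R) by have [] := WS.
have -> : J (fun x => w i x * (\1_E x)%:C) =
    J (fun x => w i x * (\1_E x)%:C - w i x * (\1_S x)%:C).
  by rewrite cintegralB; [rewrite WS.2 subr0|exact: bwf|exact: bwf].
have -> : 16 * M * e = 8 * (0 * C) + 8 * (M * (2 * e)) by ring.
apply: (cintegral_split LC mB LB) => //.
- by apply: bcmeasB; exact: bwf.
- move=> x; rewrite -mulrBr normcM -rmorphB normc_real.
  apply: le_trans (wM x); rewrite ler_piMr ?normc_ge0// !indicE.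
  by case: (x \in E); case: (x \in S); rewrite ?subrr ?subr0 ?sub0r ?normrN ?normr0 ?normr1//.
- move=> x [K1x|K2x].
    by rewrite !indicE !mem_set ?subrr ?normc0//; [exact: K1S|exact: K1E].
  rewrite !indicE !memNset ?mulr0 ?subrr ?normc0//; last exact: K2E.
  by move=> Sx; apply: (SK2 x).
Qed.

(* A bounded Borel function that is constant on the sets not separated by [G] is
   annihilated: this is the Stone-Weierstrass step. *)
Lemma annihilated_separated (F : T -> R) : bmeas F ->
  (forall p q, F p <> F q -> separated_by p q) -> W F.
Proof.
move=> bF sep; have [mF [M0 FM0]] := bF.
have M00 : 0 <= M0 by apply: le_trans (FM0 point).
pose M := M0 + 1; have M1 : 0 < 2 * M by rewrite mulr_gt0// ltr_wpDl.
pose F' x := (F x + M) / (2 * M).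
have F01 x : 0 <= F' x <= 1.
  have := FM0 x; rewrite ler_norml => /andP[h1 h2]; rewrite /F' /M.
  apply/andP; split; first by apply: divr_ge0; [lra|exact: ltW].
  by rewrite ler_pdivrMr// /M mul1r; lra.
have WE c : W (\1_[set x | c < F' x]).
  have -> : [set x | c < F' x] = F @^-1` `]2 * M * c - M, +oo[.
    apply/seteqP; split => x /=; rewrite in_itv/= andbT /F' ltr_pdivlMr//; lra.
  apply: annihilated_indic.
    by rewrite -[X in measurable X]setTI; apply: mF => //; exact: measurable_itv.
  move=> p q /= Fp Fq; apply: sep => Fpq; apply: Fq.
  by rewrite /= -Fpq.
(* A staircase built from indicators of superlevel sets, uniformly within [1 / (n + 1)] of [F']. *)
pose G_ n x : R := n.+1%:R^-1 * \sum_(k <- iota 0 n.+1) \1_[set x | k%:R / n.+1%:R < F' x] x.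
have GE n x : `|F' x - G_ n x| <= n.+1%:R^-1.
  have n0 : 0 < n.+1%:R :> R by rewrite ltr0n.
  have -> : F' x - G_ n x = n.+1%:R^-1 * (n.+1%:R * F' x - \sum_(k < n.+1) (k%:R < n.+1%:R * F' x)%R%:R).
    rewrite mulrBr mulKf ?gt_eqF// /G_ -[iota 0 n.+1]/(index_iota 0 n.+1) big_mkord.
    congr (_ - _ * _); apply: eq_bigr => k _; rewrite indicE.
    rewrite (_ : (x \in _) = (k%:R / n.+1%:R < F' x)); last by apply/idP/idP; rewrite inE.
    by rewrite ltr_pdivrMr// mulrC.
  have i0 : 0 < n.+1%:R^-1 :> R by rewrite invr_gt0.
  rewrite normrM (gtr0_norm i0) (ler_piMr (ltW i0))//.
  have /andP[h1 h2] := F01 x.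
  have /count_lt_bounds/andP[h3 h4] : 0 <= n.+1%:R * F' x <= n.+1%:R.
    by rewrite (mulr_ge0 (ltW n0) h1) (ler_piMr (ltW n0) h2).
  by rewrite ler_norml; apply/andP; split; lra.
have WF' : W F'.
  apply: (@annihilated_lim G_ F' 2).
  - move=> n; apply: annihilatedZ; elim: (iota 0 n.+1) => [|k s IH].
      under [X in W X]eq_fun do rewrite big_nil.
      have := annihilatedZ 0 W1; congr W; apply/funext => x; exact: mul0r.
    under [X in W X]eq_fun do rewrite big_cons.
    exact: annihilatedD (WE _) IH.
  - move=> n x; have := GE n x; rewrite distrC => h.
    have -> : G_ n x = (G_ n x - F' x) + F' x by ring.
    apply: le_trans (ler_normD _ _) _; rewrite mulr2n lerD//.
      by apply: le_trans h _; rewrite invf_le1 ?ltr0n// ler1n.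
    by have /andP[h1 h2] := F01 x; rewrite ger0_norm.
  - move=> x; apply/cvgrPdist_le => e e0.
    have : \forall n \near \oo, n.+1%:R^-1 < e by exact: (near_infty_natSinv_lt (PosNum e0)).
    by apply: filterS => n h; apply: le_trans (GE n x) (ltW h).
have -> : F = (fun x => 2 * M * F' x + - M * 1).
  by apply/funext => x; rewrite /F' [2 * M * _]mulrC divfK ?gt_eqF//; ring.
by apply: annihilatedD; exact: annihilatedZ.
Qed.

End measure_uniqueness.

(** * Continuity of the kernels *)

Section continuity.
Variables (R : realType) (T : topologicalType).

Lemma ccontP (f : T -> R[i]) : continuous (f : T -> R[i]^o) <->
  continuous (fun x => complex.Re (f x)) /\ continuous (fun x => complex.Im (f x)).
Proof.
split; first exact: continuous_ccomp.
move=> [cR cI] x; apply/cvgrPdist_le => -[e e'] /[!ltcE]/= /andP[/eqP-> e0].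
have e2 : 0 < e / 2 by rewrite divr_gt0.
have /cvgrPdist_le/(_ _ e2) h1 := cR x; have /cvgrPdist_le/(_ _ e2) h2 := cI x.
near=> y; rewrite lecR; apply: le_trans (normc_le _) _; rewrite (splitr e).
have -> : complex.Re (f x - f y) = complex.Re (f x) - complex.Re (f y).
  by case: (f x); case: (f y).
have -> : complex.Im (f x - f y) = complex.Im (f x) - complex.Im (f y).
  by case: (f x); case: (f y).
by apply: lerD; near: y.
Unshelve. all: by end_near. Qed.

Lemma contM (f g : T -> R) : continuous f -> continuous g -> continuous (fun x => f x * g x).
Proof. by move=> cf cg x; apply: cvgM; [exact: cf|exact: cg]. Qed.

Lemma contD (f g : T -> R) : continuous f -> continuous g -> continuous (fun x => f x + g x).
Proof. by move=> cf cg x; apply: cvgD; [exact: cf|exact: cg]. Qed.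

Lemma contN (f : T -> R) : continuous f -> continuous (fun x => - f x).
Proof. by move=> cf x; apply: cvgN; exact: cf. Qed.

Lemma contB (f g : T -> R) : continuous f -> continuous g -> continuous (fun x => f x - g x).
Proof. by move=> cf cg x; apply: cvgB; [exact: cf|exact: cg]. Qed.

Lemma contV (f : T -> R) : (forall x, f x != 0) -> continuous f -> continuous (fun x => (f x)^-1).
Proof. by move=> f0 cf x; apply: cvgV => //; exact: cf. Qed.

Lemma cont_cst (c : R) : continuous (fun _ : T => c).
Proof. by move=> x; exact: cvg_cst. Qed.

Lemma cont_comp (h : R -> R) (f : T -> R) : continuous h -> continuous f ->
  continuous (fun x => h (f x)).
Proof. by move=> ch cf x; apply: continuous_comp; [exact: cf|exact: ch]. Qed.

Lemma cont_expR : continuous (@expR R).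
Proof. exact: continuous_expR. Qed.

Lemma cont_prod I (r : seq I) (f : I -> T -> R) : (forall i, continuous (f i)) ->
  continuous (fun x => \prod_(i <- r) f i x).
Proof.
move=> cf; elim: r => [|i r IH].
  by under eq_fun do rewrite big_nil; exact: cont_cst.
by under eq_fun do rewrite big_cons; exact: contM.
Qed.

Lemma ccontMr (f : T -> R[i]) (g : T -> R) : continuous (f : T -> R[i]^o) ->
  continuous g -> continuous ((fun x => f x * (g x)%:C) : T -> R[i]^o).
Proof.
move=> /ccontP[c1 c2] cg; apply/ccontP; split.
  by under eq_fun do rewrite Re_mulr; exact: contM.
by under eq_fun do rewrite Im_mulr; exact: contM.
Qed.

Lemma norm_prod_le I (r : seq I) (f : I -> R) (b : R) : (forall i, `|f i| <= b) ->
  `|\prod_(i <- r) f i| <= b ^+ size r.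
Proof.
move=> fb; elim: r => [|i r IH]; first by rewrite big_nil normr1.
by rewrite big_cons normrM /= exprS ler_pM.
Qed.

Lemma cvg_bigprod I (r : seq I) (f : nat -> I -> R) (l : I -> R) :
  (forall i, (fun n => f n i) @ \oo --> l i) ->
  (fun n => \prod_(i <- r) f n i) @ \oo --> \prod_(i <- r) l i.
Proof.
move=> fl; elim: r => [|i r IH].
  by rewrite big_nil; under eq_fun do rewrite big_nil; exact: cvg_cst.
by rewrite big_cons; under eq_fun do rewrite big_cons; exact: cvgM.
Qed.

End continuity.

Section gaussian_continuity.
Variables (R : realType) (m : nat) (X : topologicalType).
Variables (gamma : X -> X -> R) (A : X -> X -> R[i]).
Hypothesis gamma_gt0 : forall u v, 0 < gamma u v.
Hypothesis gamma_cont : continuous (fun p : X * X => gamma p.1 p.2).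
Hypothesis A_cont : continuous_kernel A.
Local Notation Y := (X * 'rV[R]_m)%type.
Local Notation C := (Cker m A gamma).

Lemma cont_sqrt_gamma : continuous (fun p : X * X => Num.sqrt (gamma p.1 p.2)).
Proof. by move=> p; apply: continuous_comp; [exact: gamma_cont|exact: sqrt_continuous]. Qed.

Lemma Cker_cont : continuous_kernel C.
Proof.
rewrite /continuous_kernel.
rewrite (_ : (fun p => _) = (fun p : X * X => A p.1 p.2 * (Num.sqrt (gamma p.1 p.2) ^+ m)%:C)).
  apply: ccontMr => //; apply: (cont_comp (@exprn_continuous R m)).
  exact: cont_sqrt_gamma.
by apply/funext => p; rewrite CkerE.
Qed.

Lemma cont_pair (T Z1 Z2 : topologicalType) (f : T -> Z1) (g : T -> Z2) :
  continuous f -> continuous g -> continuous (fun t => (f t, g t)).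
Proof. by move=> cf cg t; apply: cvg_pair; [exact: cf|exact: cg]. Qed.

Lemma cont_fst1 (Z1 Z2 : topologicalType) : continuous (fun p : Z1 * Z2 => p.1).
Proof. by move=> p; exact: cvg_fst. Qed.

Lemma cont_snd1 (Z1 Z2 : topologicalType) : continuous (fun p : Z1 * Z2 => p.2).
Proof. by move=> p; exact: cvg_snd. Qed.

Lemma cont_compT (T Z W : topologicalType) (f : T -> Z) (g : Z -> W) :
  continuous f -> continuous g -> continuous (fun t => g (f t)).
Proof. by move=> cf cg t; apply: continuous_comp; [exact: cf|exact: cg]. Qed.

Lemma cont_coord i : continuous (fun p : Y => p.2 0 i).
Proof.
apply: (@cont_compT Y 'rV[R]_m R (fun p => p.2) (fun v => v 0 i)); first exact: cont_snd1.
exact: coord_continuous.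
Qed.

Lemma cont_base : continuous (fun w : Y * Y => (w.1.1, w.2.1)).
Proof.
apply: (@cont_pair (Y * Y)%type X X (fun w => w.1.1) (fun w => w.2.1)).
  by apply: (@cont_compT (Y * Y)%type Y X (fun w => w.1) (fun p => p.1)); exact: cont_fst1.
apply: (@cont_compT (Y * Y)%type Y X (fun w => w.2) (fun p => p.1)); first exact: cont_snd1.
exact: cont_fst1.
Qed.

Lemma cont_gamma_base : continuous (fun w : Y * Y => gamma w.1.1 w.2.1).
Proof. exact: (@cont_compT (Y * Y)%type (X * X)%type R _ (fun p => gamma p.1 p.2) cont_base gamma_cont). Qed.

Lemma cont_diff i : continuous (fun w : Y * Y => w.1.2 0 i - w.2.2 0 i).
Proof.
apply: contB.
  by apply: (@cont_compT (Y * Y)%type Y R (fun w => w.1) (fun p => p.2 0 i)); [exact: cont_fst1|exact: cont_coord].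
by apply: (@cont_compT (Y * Y)%type Y R (fun w => w.2) (fun p => p.2 0 i)); [exact: cont_snd1|exact: cont_coord].
Qed.

Lemma Cker_base_cont : continuous_kernel (fun p q : Y => C p.1 q.1).
Proof. exact: (@cont_compT (Y * Y)%type (X * X)%type R[i]^o _ (fun p => C p.1 p.2) cont_base Cker_cont). Qed.

Lemma Gker_cont : continuous_kernel (Gker m A gamma).
Proof.
rewrite /continuous_kernel.
rewrite (_ : (fun p => _) = (fun w : Y * Y => C w.1.1 w.2.1 * (peaks gamma w.1 w.2)%:C)).
  apply: ccontMr; first exact: Cker_base_cont.
  apply: cont_prod => i; rewrite /gauss_peak; apply: contM.
    apply: contV => [w|]; first by rewrite gt_eqF// sqrtr_gt0.
    exact: (@cont_compT (Y * Y)%type (X * X)%type R _ (fun p => Num.sqrt (gamma p.1 p.2)) cont_base cont_sqrt_gamma).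
  apply: (cont_comp (@cont_expR R)); apply: contN; apply: contM.
    by apply: (cont_comp (@exprn_continuous R 2)); exact: cont_diff.
  by apply: contV => [w|]; [rewrite gt_eqF|exact: cont_gamma_base].
by apply/funext => w; rewrite GkerE.
Qed.

Lemma Cker_waves_cont (xi : 'I_m -> R) :
  continuous_kernel (fun p q : Y => C p.1 q.1 * (waves gamma xi p q)%:C).
Proof.
rewrite /continuous_kernel; apply: ccontMr; first exact: Cker_base_cont.
apply: cont_prod => i; apply: contM.
  apply: (cont_comp (@cont_expR R)); apply: contN; apply: contM; last exact: cont_cst.
  exact: cont_gamma_base.
apply: (cont_comp (@continuous_cos R)); apply: contM; first exact: cont_cst.
exact: cont_diff.
Qed.

Lemma windows_cont (s0 : 'I_m -> R) (d : R) : 0 < d ->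
  continuous_kernel (fun p q : Y => C p.1 q.1 * (windows gamma s0 d p q)%:C).
Proof.
move=> d0; rewrite /continuous_kernel; apply: ccontMr; first exact: Cker_base_cont.
apply: cont_prod => i.
apply: (@window_continuous _ _ d d0 _ (fun w : Y * Y => gamma w.1.1 w.2.1) (fun w : Y * Y => w.1.2 0 i - w.2.2 0 i)).
- by move=> t; exact: ltW.
- exact: cont_gamma_base.
- exact: cont_diff.
Qed.

End gaussian_continuity.

(** * Measures of zero energy for the Gaussian kernel *)

Lemma hausdorff_separated (Y : topologicalType) :
  (forall p q : Y, p <> q -> exists Z : topologicalType, exists f : Y -> Z,
    [/\ hausdorff_space Z, continuous f & f p <> f q]) ->
  hausdorff_space Y.
Proof.
move=> sep p q pq; apply: contrapT => /sep[Z [f [hZ cf]]]; apply; apply: hZ.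
move=> A B /cf fA /cf fB; have [z [Az Bz]] := pq _ _ fA fB.
by exists (f z).
Qed.

(** Scaling by [pi / 2 / (|x| + |y|)] puts both points into the interval on which the sine is
    injective. *)
Lemma sin_separates (R : realType) (x y : R) : x <> y -> exists b, sin (b * x) <> sin (b * y).
Proof.
move=> xy; have D0 : 0 < `|x| + `|y|.
  rewrite lt_def addr_ge0// andbT paddr_eq0// !normr_eq0.
  by apply/negP => /andP[/eqP x0 /eqP y0]; apply: xy; rewrite x0 y0.
set D := _ + _ in D0.
exists (pi / 2 / D) => sxy; apply: xy.
have H z : `|z| <= D -> pi / 2 / D * z \in `[- (pi / 2), pi / 2]%R.
  move=> zD; rewrite in_itv/= -ler_norml normrM ger0_norm; last first.
    by rewrite !divr_ge0 ?pi_ge0// ltW.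
  rewrite mulrAC ler_pdivrMr// ler_wpM2l// divr_ge0// pi_ge0//.
have := sin_inj (H x _) (H y _) sxy; rewrite /D lerDl lerDr !normr_ge0 => /(_ isT isT).
apply: mulfI; rewrite gt_eqF// !divr_gt0// pi_gt0//.
Qed.

Section strictness.
Variables (R : realType) (m : nat) (X : topologicalType).
Hypothesis X_hausdorff : hausdorff_space X.
Variables (gamma : X -> X -> R) (A : X -> X -> R[i]).
Hypothesis gamma_gt0 : forall u v, 0 < gamma u v.
Hypothesis gamma_cont : continuous (fun p : X * X => gamma p.1 p.2).
Hypothesis gamma_cnd : cond_neg_def_kernel gamma.
Hypothesis A_cont : continuous_kernel A.
Hypothesis C_pd : pos_def_kernel (Cker m A gamma).
Local Notation Y := (X * 'rV[R]_m)%type.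
Local Notation C := (Cker m A gamma).

Lemma Y_hausdorff : hausdorff_space Y.
Proof.
apply: hausdorff_separated => -[u x] [v y] uxvy.
have [uv|uv] := pselect (u = v); last first.
  by exists X, fst; split => // p; exact: cvg_fst.
have /existsNP[i xyi] : ~ forall i, x 0 i = y 0 i.
  by move=> xy; apply: uxvy; rewrite uv; congr pair; apply/rowP.
exists R, (fun p : Y => p.2 0 i); split => //.
exact: cont_coord.
Qed.

(** Were all values equal, those at [a = u] and [a = u'] would force the squared Gram distance of
    [u] and [u'], which is [2 gamma u u' - gamma u u - gamma u' u'], to vanish. *)
Lemma cnd_gram_separates u u' w : metrizable_kernel gamma -> u <> u' ->
  exists a, cnd_gram gamma w u a <> cnd_gram gamma w u' a.
Proof.
move=> gm uu'; apply: contrapT => /forallNP H.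
have /contrapT := H u; have /contrapT := H u'; have := gm _ _ uu'.
rewrite /cnd_gram (gamma_cnd.1 u' u); lra.
Qed.

Variables (c MC : R).
Hypothesis c_gt0 : 0 < c.
Hypothesis gamma_ge : forall u v, c <= gamma u v.
Hypothesis C_le : forall u v, normc (C u v) <= MC.

Lemma peaks_le (p q : Y) : `|peaks gamma p q| <= ((Num.sqrt c)^-1) ^+ m.
Proof.
apply: le_trans (norm_prod_le (b := (Num.sqrt c)^-1) _ _) _; last first.
  by rewrite -[index_enum _]enumT size_enum_ord.
move=> i; rewrite /gauss_peak normrM ger0_norm; last by rewrite invr_ge0 sqrtr_ge0.
rewrite (ger0_norm (expR_ge0 _)) -[leRHS]mulr1; apply: ler_pM; rewrite ?invr_ge0 ?sqrtr_ge0 ?expR_ge0//.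
- by rewrite lef_pV2 ?posrE ?sqrtr_gt0// ler_wsqrtr.
- by rewrite -expR0 ler_expR oppr_le0 divr_ge0 ?sqr_ge0// ltW.
Qed.

Lemma Gker_bounded p q : normc (Gker m A gamma p q) <= MC * ((Num.sqrt c)^-1) ^+ m.
Proof.
rewrite GkerE// normcM normc_real; apply: ler_pM => //; first exact: normc_ge0.
exact: peaks_le.
Qed.

Lemma waves_le xi (p q : Y) : `|waves gamma xi p q| <= 1.
Proof.
apply: le_trans (norm_prod_le (b := 1) _ _) _; last by rewrite expr1n.
by move=> i; apply: wave_le1; exact: ltW.
Qed.

Lemma windows_le s0 d (p q : Y) : 0 < d -> `|windows gamma s0 d p q| <= d ^+ m.
Proof.
move=> d0; apply: le_trans (norm_prod_le (b := d) _ _) _; last first.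
  by rewrite -[index_enum _]enumT size_enum_ord.
by move=> i; apply: window_le => //; exact: ltW.
Qed.

Variables (y0 : Y) (lambda : {charge set (borel y0) -> \bar R[i]}).
Hypothesis lambda_radon : finite_radon lambda.
Local Notation T := (borel y0).
Local Notation J := (cintegral lambda).
Hypothesis energy0 : cintegral (conj_charge lambda)
  (fun q => J (fun p => Gker m A gamma p q)) = 0.

Lemma section_bcmeas (K : Y -> Y -> R[i]) (M : R) q : continuous_kernel K ->
  (forall p, normc (K p q) <= M) -> bcmeas ((fun p => K p q) : T -> R[i]).
Proof.
by move=> cK KM; apply: (@bcmeas_continuous _ _ _ _ M) => //; exact: continuous_section.
Qed.

Lemma Cker_real_le u v (r M : R) : `|r| <= M -> normc (C u v * r%:C) <= MC * M.
Proof. by move=> rM; rewrite normcM normc_real ler_pM// normc_ge0. Qed.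

Lemma integral_windows0 s0 d (q : Y) : 0 < d ->
  J (fun p => C p.1 q.1 * (windows gamma s0 d p q)%:C) = 0.
Proof.
move=> d0; have [M M0 HM] := cdom_windows gamma_gt0 gamma_cnd C_pd s0 q d0.
apply: (@ispd_domination _ _ _ Y_hausdorff _ lambda_radon (Gker m A gamma) _
  (MC * ((Num.sqrt c)^-1) ^+ m) (MC * d ^+ m) M _ _ _ _ _ M0 HM energy0).
- exact: Gker_cont.
- exact: Gker_bounded.
- exact: psd_Gker.
- have cW := windows_cont (s0 := s0) gamma_gt0 gamma_cont A_cont d0.
  exact: (continuous_section (q := q) cW).
- by move=> p; apply: Cker_real_le; exact: windows_le.
Qed.

(** Windows of length [1 / (n + 1)], renormalised by [(n + 1)^m], converge boundedly to a single
    frequency. *)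
Lemma integral_waves0 xi (q : Y) : J (fun p => C p.1 q.1 * (waves gamma xi p q)%:C) = 0.
Proof.
pose d n : R := n.+1%:R^-1; have d0 n : 0 < d n by rewrite invr_gt0.
pose r (n : nat) (p : Y) := \prod_(i < m) (n.+1%:R * window (xi i) (d n) (gamma p.1 q.1) (p.2 0 i - q.2 0 i)).
have rE n p : r n p = n.+1%:R ^+ m * windows gamma xi (d n) p q.
  by rewrite /r big_split/= prodr_const card_ord.
have bw n : bcmeas ((fun p => C p.1 q.1 * (windows gamma xi (d n) p q)%:C) : T -> R[i]).
  apply: (section_bcmeas (q := q) (windows_cont (s0 := xi) gamma_gt0 gamma_cont A_cont (d0 n))).
  by move=> p; apply: Cker_real_le; exact: windows_le.
have rwE n : (fun p => C p.1 q.1 * (r n p)%:C) =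
    (fun p => (n.+1%:R ^+ m)%:C * (C p.1 q.1 * (windows gamma xi (d n) p q)%:C)).
  by apply/funext => p; rewrite rE rmorphM mulrCA.
have rl p : (fun n => r n p) @ \oo --> waves gamma xi p q.
  apply: (@cvg_bigprod R _ (index_enum 'I_m)
    (fun n i => n.+1%:R * window (xi i) (d n) (gamma p.1 q.1) (p.2 0 i - q.2 0 i))
    (fun i => wave (xi i) (gamma p.1 q.1) (p.2 0 i - q.2 0 i))) => i.
  exact: window_cvg.
apply: (@cintegral_cvg0 _ _ _ lambda (fun n p => C p.1 q.1 * (r n p)%:C) _ (MC * 1)).
- by move=> n; rewrite rwE; apply: bcmeasM => //; exact: bcmeas_cst.
- apply: (section_bcmeas (q := q) (M := MC * 1) (Cker_waves_cont gamma_gt0 gamma_cont A_cont (xi := xi))) => p.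
  by apply: Cker_real_le; exact: waves_le.
- move=> n p; apply: Cker_real_le; rewrite rE normrM ger0_norm ?exprn_ge0//.
  have := windows_le xi p q (d0 n); rewrite /d exprVn => h.
  by rewrite -ler_pdivlMl ?exprn_gt0// mulr1.
- move=> p; rewrite Re_mulr; under eq_cvg do rewrite Re_mulr.
  by apply: cvgM; [exact: cvg_cst|exact: rl].
- move=> p; rewrite Im_mulr; under eq_cvg do rewrite Im_mulr.
  by apply: cvgM; [exact: cvg_cst|exact: rl].
- by move=> n; rewrite rwE cintegralZ// integral_windows0// mulr0.
Qed.

Definition sines (w : X) (l : seq (R * X)) (p : Y) : R :=
  \prod_(a <- l) sin (a.1 * cnd_gram gamma w p.1 a.2).

Definition cosines (a b : 'I_m -> R) (p : Y) : R := \prod_(i < m) cos (a i * p.2 0 i - b i).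

Definition decay (t : R) (w : X) (p : Y) : R := expR (- (t * gamma p.1 w)).

Lemma gamma_fst_cont w : continuous (fun p : Y => gamma p.1 w).
Proof.
apply: (@cont_compT Y (X * X)%type R (fun p => (p.1, w)) (fun p => gamma p.1 p.2)) => //.
apply: cont_pair; first exact: cont_fst1.
by move=> x; exact: cvg_cst.
Qed.

Lemma Cker_fst_cont w : continuous ((fun p : Y => C p.1 w) : Y -> R[i]^o).
Proof.
have h := @Cker_base_cont R m X gamma A gamma_gt0 gamma_cont A_cont.
exact: (continuous_section (q := (w, 0 : 'rV[R]_m)) h).
Qed.

Lemma sin_gram_cont w (a : R * X) : continuous (fun p : Y => sin (a.1 * cnd_gram gamma w p.1 a.2)).
Proof.
apply: (cont_comp (@continuous_sin R)); apply: contM; first exact: cont_cst.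
apply: contB; last exact: cont_cst.
apply: contB; last exact: gamma_fst_cont.
by apply: contD; [exact: gamma_fst_cont|exact: cont_cst].
Qed.

Lemma sines_cont w l : continuous (sines w l).
Proof. by apply: cont_prod => a; exact: sin_gram_cont. Qed.

Lemma cos_coord_cont (a b : R) i : continuous (fun p : Y => cos (a * p.2 0 i - b)).
Proof.
apply: (cont_comp (@continuous_cos R)); apply: contB; last exact: cont_cst.
by apply: contM; [exact: cont_cst|exact: cont_coord].
Qed.

Lemma cosines_cont a b : continuous (cosines a b).
Proof. by apply: cont_prod => i; exact: cos_coord_cont. Qed.

Lemma decay_cont t w : continuous (decay t w).
Proof.
apply: (cont_comp (@cont_expR R)); apply: contN; apply: contM; first exact: cont_cst.
exact: gamma_fst_cont.
Qed.

Lemma cos_le1_norm (x : R) : `|cos x| <= 1.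
Proof. by rewrite ler_norml cos_geN1 cos_le1. Qed.

Lemma sin_le1_norm (x : R) : `|sin x| <= 1.
Proof. by rewrite ler_norml sin_geN1 sin_le1. Qed.

Lemma sines_le w l p : `|sines w l p| <= 1.
Proof.
apply: le_trans (norm_prod_le (b := 1) _ _) _; last by rewrite expr1n.
by move=> i; exact: sin_le1_norm.
Qed.

Lemma cosines_le a b p : `|cosines a b p| <= 1.
Proof.
apply: le_trans (norm_prod_le (b := 1) _ _) _; last by rewrite expr1n.
by move=> i; exact: cos_le1_norm.
Qed.

Lemma decay_le t w p : 0 <= t -> `|decay t w p| <= 1.
Proof.
move=> t0; rewrite /decay ger0_norm ?expR_ge0// -expR0 ler_expR oppr_le0 mulr_ge0//.
exact: ltW.
Qed.

Lemma integral_sines0 (xi : 'I_m -> R) l (w : X) (y : 'I_m -> R) : 0 < \sum_(i < m) xi i ^+ 2 ->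
  J (fun p => C p.1 w * (decay (\sum_(i < m) xi i ^+ 2) w p * sines w l p *
    cosines (fun i => 2 * xi i) (fun i => 2 * xi i * y i) p)%:C) = 0.
Proof.
move=> t0; set t := \sum_(i < m) _ in t0 *.
pose q : Y := (w, \row_i y i).
have [M M0 HM] := cdom_waves (xi := xi) gamma_cnd C_pd l q t0.
have HM' : cdom (fun p q => C p.1 q.1 * (waves gamma xi p q)%:C) M
    (fun p => C p.1 w * (decay t w p * sines w l p *
    cosines (fun i => 2 * xi i) (fun i => 2 * xi i * y i) p)%:C).
  have E : (fun p => C p.1 w * (decay t w p * sines w l p *
      cosines (fun i => 2 * xi i) (fun i => 2 * xi i * y i) p)%:C) =
    (fun p : Y => Cker m A gamma p.1 q.1 *
      (expR (- ((\sum_(i < m) xi i ^+ 2) * gamma p.1 q.1)) *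
       \prod_(a <- l) sin (a.1 * cnd_gram gamma q.1 p.1 a.2) *
       \prod_i cos (2 * xi i * (p.2 0 i - q.2 0 i)))%:C).
    apply/funext => p; rewrite /decay /sines /cosines /q /=; congr (_ * (_ * _)%:C).
    by apply: eq_bigr => i _; rewrite mxE mulrBr.
  by rewrite E.
apply: (@ispd_domination _ _ _ Y_hausdorff _ lambda_radon _ _ (MC * 1) (MC * 1) M _ _ _ _ _ M0 HM').
- exact: Cker_waves_cont.
- by move=> p p'; apply: Cker_real_le; exact: waves_le.
- exact: psd_Cker_waves.
- apply: ccontMr; first exact: Cker_fst_cont.
  by apply: contM (@cosines_cont _ _); apply: contM (@sines_cont _ _); exact: decay_cont.
- move=> p; apply: Cker_real_le; rewrite !normrM mulr_ile1 ?mulr_ge0 ?cosines_le//.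
  by rewrite mulr_ile1 ?sines_le// decay_le// ltW.
(* All sections of the wave kernel are annihilated, so its energy is zero and it may serve as the
   dominating kernel. *)
- by under eq_fun do rewrite integral_waves0; exact: cintegral0.
Qed.

Lemma Cker_bcmeas w : bcmeas ((fun p : Y => C p.1 w) : T -> R[i]).
Proof. by apply: (@bcmeas_continuous _ _ _ _ MC) => //; exact: Cker_fst_cont. Qed.

Hypothesis gamma_metr : metrizable_kernel gamma.

(** Functions of the base point alone, kept as functions on the product, where [lambda] lives. *)
Definition fiberwise (F : T -> R) : Prop :=
  bmeas F /\ forall p q : Y, p.1 = q.1 -> F p = F q.

Lemma bcmeas_real_cont (f : Y -> R) M : continuous f -> (forall p, `|f p| <= M) ->
  bcmeas ((fun p => (f p)%:C) : T -> R[i]).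
Proof. by move=> cf fM; apply: bcmeas_real; exact: bmeas_continuous fM. Qed.

(** The weights [W l] are indexed by lists of sines. Multiplication by one more sine passes from
    [W l] to [W (a :: l)], so sines are multipliers, and metrizability makes them separate distinct
    fibres. *)
Lemma integral_fiberwise0 (xi : 'I_m -> R) (w : X) (y : 'I_m -> R) (F : T -> R) :
  0 < \sum_(i < m) xi i ^+ 2 -> fiberwise F ->
  J (fun p => C p.1 w * (decay (\sum_(i < m) xi i ^+ 2) w p *
    cosines (fun i => 2 * xi i) (fun i => 2 * xi i * y i) p)%:C * (F p)%:C) = 0.
Proof.
move=> t0 [bF Ff]; set t := \sum_(i < m) _.
set cs := cosines _ _.
pose W (l : seq (R * X)) (p : T) : R[i] := C p.1 w * (decay t w p * sines w l p * cs p)%:C.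
have bW l : bcmeas (W l).
  apply: bcmeasM; first exact: Cker_bcmeas.
  apply: (@bcmeas_real_cont _ 1); last first.
    move=> p; rewrite !normrM mulr_ile1 ?mulr_ge0 ?cosines_le//.
    by rewrite mulr_ile1 ?sines_le// decay_le// ltW.
  by apply: contM (@cosines_cont _ _); apply: contM (@sines_cont _ _); exact: decay_cont.
have W0 l : J (W l) = 0 by exact: integral_sines0.
pose G : set (Y -> R) := [set g | exists a, g = (fun p => sin (a.1 * cnd_gram gamma w p.1 a.2))].
have GF : annihilated lambda W F.
  apply: (@annihilated_separated _ _ _ Y_hausdorff _ lambda_radon _ _ bW G) => //.
  - by move=> _ [a ->]; exact: sin_gram_cont.
  - move=> _ [a ->]; have bs : bmeas ((fun p : Y => sin (a.1 * cnd_gram gamma w p.1 a.2)) : T -> R).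
      by apply: bmeas_continuous (fun p => sin_le1_norm _); exact: sin_gram_cont.
    split; first exact: bs.
    move=> h [bh h0]; split; first exact: bmeasM.
    move=> l; rewrite -(h0 (a :: l)); congr J; apply/funext => p.
    by rewrite /W /sines big_cons !rmorphM; ring.
  - split; first exact: bmeas_cst.
    by move=> l; rewrite -(W0 l); congr J; apply/funext => p; rewrite mulr1.
  - move=> p q Fpq; have pq : p.1 <> q.1 by move=> /Ff.
    have [a ka] := cnd_gram_separates w gamma_metr pq.
    have [b sb] := sin_separates ka.
    by exists (fun p => sin (b * cnd_gram gamma w p.1 a)) => //; exists (b, a).
rewrite -(GF.2 [::]); congr J; apply/funext => p.
by rewrite /W /sines big_nil mulr1.
Qed.

Definition sqmod (z : R[i]) : R := complex.Re z ^+ 2 + complex.Im z ^+ 2.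

(** This is [z] times its conjugate, arranged so that [z] is multiplied by real functions, the kind
    that [integral_fiberwise0] accepts. *)
Lemma sqmodE (z : R[i]) : z * (complex.Re z)%:C + 'i * (z * (- complex.Im z)%:C) = (sqmod z)%:C.
Proof.
case: z => a b; apply/eqP; rewrite eq_complex; apply/andP; rewrite /sqmod.
by split; apply/eqP => /=; ring.
Qed.

(* On [patch w] both [C (., w)] and [e^(-t gamma (., w))] are bounded away from [0],
   so that they can be divided out. *)
Definition patch (w : X) : set Y :=
  [set p | sqmod (C w w) / 2 < sqmod (C p.1 w) /\ gamma p.1 w < gamma w w + 1].

Lemma sqmod_cont w : continuous (fun p : Y => sqmod (C p.1 w)).
Proof.
have /ccontP[c1 c2] := @Cker_fst_cont w.
by apply: contD; apply: (cont_comp (@exprn_continuous R 2)).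
Qed.

Lemma patch_open w : open (patch w).
Proof.
rewrite (_ : patch w = (fun p : Y => sqmod (C p.1 w)) @^-1` [set y | sqmod (C w w) / 2 < y]
   `&` (fun p : Y => gamma p.1 w) @^-1` [set y | y < gamma w w + 1])//.
apply: openI.
  by have /continuousP := @sqmod_cont w; apply; exact: open_gt.
by have /continuousP := @gamma_fst_cont w; apply; exact: open_lt.
Qed.

Lemma fiberwiseM F G : fiberwise F -> fiberwise G -> fiberwise (fun p => F p * G p).
Proof.
move=> [bF hF] [bG hG]; split; first exact: bmeasM.
by move=> p q pq; rewrite (hF p q)// (hG p q).
Qed.

Lemma fiberwise_patch w : fiberwise (\1_(patch w)).
Proof.
split; first by apply: bmeas_indic; apply: borel_open; exact: patch_open.
move=> p q pq; rewrite !indicE; congr (_%:R); congr nat_of_bool.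
by apply/idP/idP => /set_mem h; apply/mem_set; move: h; rewrite /patch/= pq.
Qed.

Lemma fiberwise_cont (f : X -> R) M : continuous (fun p : Y => f p.1) ->
  (forall u, `|f u| <= M) -> fiberwise (fun p => f p.1).
Proof.
move=> cf fM; split; last by move=> p q ->.
exact: (bmeas_continuous _ cf (fun p => fM p.1)).
Qed.

Hypothesis A_pos : forall u, 0 < A u u.

Lemma sqmod_gt0 w : 0 < sqmod (C w w).
Proof.
have : 0 < C w w.
  by rewrite CkerE// mulr_gt0// ltcR exprn_gt0// sqrtr_gt0.
rewrite /sqmod; case: (C w w) => a b; rewrite ltcE/= => /andP[_ a0].
by rewrite ltr_pwDl ?exprn_gt0// sqr_ge0.
Qed.

Lemma integral_patch_cosines_pos w (F : T -> R) (a b : 'I_m -> R) :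
  fiberwise F -> 0 < \sum_(i < m) a i ^+ 2 ->
  J (fun p => (\1_(patch w) p * F p * cosines a b p)%:C) = 0.
Proof.
(* These solve [2 xi (x - y) = a x - b]. A coordinate with [a i = 0] gets [y i = 0] by the
   convention for division, and its constant factor [cos (b i)] goes into [k]. *)
move=> fF a0; pose xi i := a i / 2; pose y i := b i / a i.
pose t := \sum_(i < m) xi i ^+ 2.
have t0 : 0 < t.
  rewrite /t /xi; under eq_bigr do rewrite exprMn.
  by rewrite -mulr_suml mulr_gt0// exprn_gt0// invr_gt0.
pose k := \prod_(i < m) (if a i == 0 then cos (b i) else 1).
pose cs := cosines (fun i => 2 * xi i) (fun i => 2 * xi i * y i).
have csE p : cosines a b p = k * cs p.
  rewrite /cosines /k /cs -big_split/=; apply: eq_bigr => i _; rewrite /xi /y.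
  case: eqP => [->|/eqP ai]; first by rewrite mul0r sub0r cosN !mul0r !mulr0 !mul0r subrr cos0 mulr1.
  by rewrite mul1r; congr cos; field.
(* [den] and [grow] are bounded, and agree on [patch w] with [sqmod (C u w)] and
   [expR (t * gamma u w)]. *)
pose den (u : X) := sqmod (C w w) / 2 + `|sqmod (C u w) - sqmod (C w w) / 2|.
pose kap := sqmod (C w w) / 2; have kap0 : 0 < kap by rewrite divr_gt0// sqmod_gt0.
have den_ge u : kap <= den u by rewrite lerDl.
have den0 u : 0 < den u by apply: lt_le_trans (den_ge u).
pose grow (u : X) := expR (t * (gamma w w + 1 - `|gamma w w + 1 - gamma u w|)).
pose s (u : X) := (den u)^-1 * grow u.
have sM u : `|s u| <= kap^-1 * expR (t * (gamma w w + 1)).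
  rewrite normrM ger0_norm ?invr_ge0 ?(ltW (den0 u))// (ger0_norm (expR_ge0 _)).
  apply: ler_pM; rewrite ?expR_ge0 ?invr_ge0 ?(ltW (den0 u))//.
    by rewrite lef_pV2 ?posrE.
  by rewrite ler_expR ler_wpM2l ?(ltW t0)// gerBl.
have cs_ : continuous (fun p : Y => s p.1).
  apply: contM.
    apply: contV => [p|]; first by rewrite gt_eqF.
    apply: contD; first exact: cont_cst.
    apply: (cont_comp (@norm_continuous _ R)); apply: contB; last exact: cont_cst.
    exact: sqmod_cont.
  apply: (cont_comp (@cont_expR R)); apply: contM; first exact: cont_cst.
  apply: contB; first exact: cont_cst.
  apply: (cont_comp (@norm_continuous _ R)); apply: contB; first exact: cont_cst.
  exact: gamma_fst_cont.
have fs : fiberwise (fun p => s p.1) by exact: fiberwise_cont cs_ sM.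
have /ccontP[c1 c2] := @Cker_fst_cont w.
have f1 : fiberwise (fun p => complex.Re (C p.1 w)).
  by apply: (@fiberwise_cont (fun u => complex.Re (C u w)) MC c1) => u; exact: le_trans (normc_Re _) (C_le u w).
have f2 : fiberwise (fun p => - complex.Im (C p.1 w)).
  apply: (@fiberwise_cont (fun u => - complex.Im (C u w)) MC (contN c2)) => u; rewrite normrN.
  exact: le_trans (normc_Im _) (C_le u w).
have fU := fiberwise_patch w.
have fG := fiberwiseM (fiberwiseM fU fF) fs.
(* The real part of [C(.,w)] and minus its imaginary part are both admissible factors; combined with
   [1] and ['i] they multiply [C(.,w)] by its conjugate. *)
have I1 := integral_fiberwise0 w y t0 (fiberwiseM fG f1).
have I2 := integral_fiberwise0 w y t0 (fiberwiseM fG f2).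
set B := fun p => _ in I1; set B' := fun p => _ in I2.
have bB F' : fiberwise F' -> bcmeas ((fun p => C p.1 w * (decay t w p * cs p)%:C * (F' p)%:C) : T -> R[i]).
  move=> [bF' _]; apply: bcmeasM; last exact: bcmeas_real.
  apply: bcmeasM; first exact: Cker_bcmeas.
  apply: (@bcmeas_real_cont _ 1); first by apply: contM (@cosines_cont _ _); exact: decay_cont.
  by move=> p; rewrite normrM mulr_ile1 ?cosines_le// decay_le// ltW.
have := cintegral_lin lambda 'i (bB _ (fiberwiseM fG f2)) (bB _ (fiberwiseM fG f1)).
rewrite I1 I2 mulr0 addr0 => I3.
have bI := bcmeasM.
transitivity (k%:C * 0 : R[i]); last by rewrite mulr0.
rewrite -I3 -cintegralZ; last first.
  apply: bcmeasD; last exact: bB (fiberwiseM fG f1).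
  by apply: bcmeasM; [exact: bcmeas_cst|exact: bB (fiberwiseM fG f2)].
congr J; apply/funext => p; rewrite csE.
have [Up|Up] := pselect (patch w p); last first.
  by rewrite !indicE memNset// !mul0r rmorph0 !mulr0 addr0 mulr0.
rewrite !indicE mem_set// !mul1r.
have [U1 U2] := Up.
have -> : s p.1 = (sqmod (C p.1 w))^-1 * expR (t * gamma p.1 w).
  rewrite /s /den /grow ger0_norm ?subr_ge0 ?(ltW U1)// ger0_norm ?subr_ge0 ?(ltW U2)//.
  by congr (_^-1 * expR (t * _)); ring.
have E1 : sqmod (C p.1 w) != 0 by rewrite gt_eqF// (lt_trans _ U1)// -/kap.
have E2 : decay t w p * expR (t * gamma p.1 w) = 1 by rewrite /decay -expRD addNr expR0.
move: (sqmodE (C p.1 w)) E1 E2.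
move: (decay t w p) (expR _) (C p.1 w) (cs p) (F p) => d e z x f zE n0 de.
transitivity (k%:C * ((d * e * x * f * (sqmod z)^-1)%:C *
   (z * (complex.Re z)%:C + 'i * (z * (- complex.Im z)%:C)))).
  rewrite zE -!rmorphM de; congr (_%:C); field.
  exact: n0.
by rewrite !rmorphM/=; ring.
Qed.

(** When all frequencies vanish, the cosines form a constant, and the constant [1] is the bounded
    limit of products with all frequencies [1 / (n + 1)], whose sum of squares is positive because
    [0 < m]. *)
Lemma integral_patch_cosines (m_gt0 : (0 < m)%N) w (F : T -> R) (a b : 'I_m -> R) :
  fiberwise F -> J (fun p => (\1_(patch w) p * F p * cosines a b p)%:C) = 0.
Proof.
move=> fF; have [a0|] := ltP 0 (\sum_(i < m) a i ^+ 2); first exact: integral_patch_cosines_pos.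
move=> a0; have az i : a i = 0.
  have /psumr_eq0P : \sum_(i < m) a i ^+ 2 = 0.
    by apply/eqP; rewrite eq_le a0 sumr_ge0// => j _; exact: sqr_ge0.
  by move=> /(_ (fun j _ => sqr_ge0 (a j)) i isT) /eqP; rewrite sqrf_eq0 => /eqP.
have [bU _] := fiberwiseM (fiberwise_patch w) fF.
have bc a' b' : bcmeas ((fun p => (\1_(patch w) p * F p * cosines a' b' p)%:C) : T -> R[i]).
  apply: bcmeas_real; apply: bmeasM => //.
  exact: (bmeas_continuous _ (@cosines_cont a' b') (@cosines_le a' b')).
have E : (fun p => (\1_(patch w) p * F p * cosines a b p)%:C) =
    (fun p => (cosines a b y0)%:C * (\1_(patch w) p * F p * cosines (fun=> 0) (fun=> 0) p)%:C).
  apply/funext => p; rewrite -rmorphM.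
  have -> : cosines (fun=> 0) (fun=> 0) p = 1.
    by apply: big1 => i _; rewrite mul0r subrr cos0.
  rewrite mulr1 mulrC; congr ((_ * _)%:C).
  by apply: eq_bigr => i _; rewrite az !mul0r.
rewrite E cintegralZ//.
have [M0 hM0] := bU.2.
rewrite (@cintegral_cvg0 _ _ _ lambda
  (fun n p => (\1_(patch w) p * F p * cosines (fun=> n.+1%:R^-1) (fun=> 0) p)%:C) _ (M0 * 1)) ?mulr0//.
- by move=> n p; rewrite normc_real normrM ler_pM// cosines_le.
- move=> p /=; apply: cvgM; first exact: cvg_cst.
  apply: (@cvg_bigprod R _ (index_enum 'I_m)
     (fun n i => cos (n.+1%:R^-1 * p.2 0 i - 0)) (fun i => cos (0 * p.2 0 i - 0))) => i.
  apply: continuous_cvg; first exact: continuous_cos.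
  apply: cvgB; last exact: cvg_cst.
  by apply: cvgM; [exact: cvg_harmonic|exact: cvg_cst].
- by move=> p /=; exact: cvg_cst.
- move=> n; apply: integral_patch_cosines_pos => //.
  rewrite sumr_const card_ord pmulrn_lgt0// exprn_gt0//.
Qed.

(** The index set is shaped for a second Stone-Weierstrass argument: fiberwise factors are collected
    in [F], and a further cosine is resolved by [cosinesM] into two members of the family. *)
Definition test_fun (i : {F | fiberwise F} * ('I_m -> R) * ('I_m -> R)) w : T -> R[i] :=
  fun p => (\1_(patch w) p * sval i.1.1 p * cosines i.1.2 i.2 p)%:C.

Lemma test_fun_bcmeas w i : bcmeas (test_fun i w).
Proof.
apply: bcmeas_real; apply: bmeasM.
  by have [] := fiberwiseM (fiberwise_patch w) (svalP i.1.1).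
exact: (bmeas_continuous _ (@cosines_cont i.1.2 i.2) (@cosines_le i.1.2 i.2)).
Qed.

Lemma cosinesM i (a b : 'I_m -> R) (e d : R) p :
  cosines a b p * cos (e * p.2 0 i - d) =
  2^-1 * (cosines (fun j => if j == i then a j + e else a j) (fun j => if j == i then b j + d else b j) p
    + cosines (fun j => if j == i then a j - e else a j) (fun j => if j == i then b j - d else b j) p).
Proof.
have D1 a' b' : cosines a' b' p =
    cos (a' i * p.2 0 i - b' i) * \prod_(j < m | j != i) cos (a' j * p.2 0 j - b' j).
  by rewrite /cosines (bigD1 i).
rewrite !D1 !eqxx; set P := \prod_(j < m | _) cos (a j * _ - _).
have E f g : \prod_(j < m | j != i) cos ((if j == i then f j else a j) * p.2 0 j -
    (if j == i then g j else b j)) = P.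
  by apply: eq_bigr => j /negPf->.
rewrite !E.
rewrite (_ : (a i + e) * p.2 0 i - (b i + d) = (a i * p.2 0 i - b i) + (e * p.2 0 i - d)); last by ring.
rewrite (_ : (a i - e) * p.2 0 i - (b i - d) = (a i * p.2 0 i - b i) - (e * p.2 0 i - d)); last by ring.
move: (a i * _ - _) (e * _ - _) => u v.
by rewrite cosD cosB; field.
Qed.

(** Stone-Weierstrass on the whole product: sines of the Gram kernel separate distinct fibres,
    cosines of the coordinates separate points within a fibre. *)
Lemma measure0_patch (m_gt0 : (0 < m)%N) w (E : set T) : measurable E ->
  fine (lambda (E `&` patch w)) = 0.
Proof.
move=> mE; have mU : measurable (patch w : set T) by apply: borel_open; exact: patch_open.
pose G : set (Y -> R) := [set g | (continuous g /\ fiberwise g) \/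
  exists a i, g = (fun p => cos (a.1 * p.2 0 i - a.2))].
have f1 : fiberwise (fun=> 1) by split => //; exact: bmeas_cst.
have WE : annihilated lambda (fun i => test_fun i w) (\1_E).
  apply: (@annihilated_separated _ _ _ Y_hausdorff _ lambda_radon _ _ (test_fun_bcmeas w) G).
  - by move=> g [[]//|[a [i ->]]]; exact: cos_coord_cont.
  - move=> g [[cg fg]|[a [i ->]]].
      split; first by case: fg.
      move=> h [bh h0]; split; first by apply: bmeasM => //; case: fg.
      move=> [[[F fF] a] b]; rewrite -(h0 (exist _ _ (fiberwiseM fF fg), a, b)).
      congr J; apply/funext => p; rewrite /test_fun /= !rmorphM/=; ring.
    have bs : bmeas ((fun p : Y => cos (a.1 * p.2 0 i - a.2)) : T -> R).
      by apply: bmeas_continuous (fun p => cos_le1_norm _); exact: cos_coord_cont.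
    split; first exact: bs.
    move=> h [bh h0]; split; first exact: bmeasM.
    move=> [[F x] y].
    pose i1 := (F, (fun j => if j == i then x j + a.1 else x j), (fun j => if j == i then y j + a.2 else y j)).
    pose i2 := (F, (fun j => if j == i then x j - a.1 else x j), (fun j => if j == i then y j - a.2 else y j)).
    have bh' j : bcmeas (fun p => test_fun j w p * (h p)%:C).
      by apply: bcmeasM; [exact: test_fun_bcmeas|exact: bcmeas_real].
    transitivity (2^-1%:C * (J (fun p => test_fun i1 w p * (h p)%:C) + J (fun p => test_fun i2 w p * (h p)%:C)) : R[i]); last first.
      by rewrite !h0 addr0 mulr0.
    rewrite -cintegralD// -cintegralZ; last exact: bcmeasD.
    congr J; apply/funext => p; rewrite /test_fun/= [cosines x y p]lock.
    rewrite -!rmorphM -!rmorphD -!rmorphM; congr (_%:C); rewrite -lock.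
    rewrite (mulrA _ (cos _)) -(mulrA _ _ (cos _)) cosinesM; ring.
  - split; first exact: bmeas_cst.
    move=> [[[F fF] a] b]; under eq_fun do rewrite mulr1.
    exact: integral_patch_cosines.
  - exact: bmeas_indic.
  - move=> p q Epq; have [pq|pq] := pselect (p.1 = q.1); last first.
      have [a ka] := cnd_gram_separates w gamma_metr pq.
      have [b sb] := sin_separates ka.
      exists (fun p => sin (b * cnd_gram gamma w p.1 a)) => //; left.
      have cg := @sin_gram_cont w (b, a); split; first exact: cg.
      exact: (@fiberwise_cont (fun u => sin (b * cnd_gram gamma w u a)) 1 cg (fun u => sin_le1_norm _)).
    have /existsNP[i /sin_separates[b sb]] : ~ forall i, p.2 0 i = q.2 0 i.
      move=> pq2; apply: Epq; congr (\1_E _).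
      by rewrite [p]surjective_pairing [q]surjective_pairing pq; congr pair; apply/rowP.
    (* The phase turns the cosine into minus a sine, so that [sin_separates] applies. *)
    exists (fun p : Y => cos (b * p.2 0 i - (- (pi / 2)))); first by right; exists (b, - (pi / 2)), i.
    by rewrite !opprK !cosDpihalf => /oppr_inj.
have := WE.2 (exist _ _ f1, (fun=> 0), (fun=> 0)).
rewrite -(cintegral_indic lambda (measurableI _ _ mE mU)) => <-.
congr J; apply/funext => p; rewrite /test_fun.
have -> : cosines (fun=> 0) (fun=> 0) p = 1.
  by apply: big1 => i _; rewrite mul0r subrr cos0.
by rewrite indicI/= !mulr1 rmorphM/= mulrC.
Qed.

Lemma measure_null (m_gt0 : (0 < m)%N) (E : set T) : measurable E -> lambda E = 0%E.
Proof.
move=> mE; rewrite -[lambda E]fineK; last exact: fin_num_measure.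
congr (_%:E); apply: eq0_normc; apply/eqP; rewrite eq_le normc_ge0 andbT.
apply/ler_addgt0Pr => e e0; rewrite add0r.
have [B [cB BE HB]] := radon_tight Y_hausdorff lambda_radon mE e0.
have mB : measurable (B : set T) by apply: borel_compact => //; exact: Y_hausdorff.
(* The charge has to vanish on all measurable subsets: cancellation would otherwise spoil unions. *)
have : exists S : set T, [/\ measurable S, B `<=` S &
    forall D, measurable D -> D `<=` S -> fine (lambda D) = 0].
  apply: (@compact_induction _ B (fun B : set Y => exists S : set T, [/\ measurable S, B `<=` S &
    forall D, measurable D -> D `<=` S -> fine (lambda D) = 0])) => //.
  - by exists set0; split=> // D _; rewrite subset0 => ->; rewrite charge0.
  - move=> U V [S [mS US HS]] [S' [mS' VS' HS']]; exists (S `|` S'); split.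
    + exact: measurableU.
    + exact: setUSS.
    + move=> D mD DSS; have mC := measurableC mS.
      have := chargeU lambda (measurableI _ _ mD mS) (measurableI _ _ mD mC).
      rewrite -setIUr setUv setIT => ->; last by rewrite setIACA setICr setI0.
      rewrite fineD; [|exact: fin_num_measure _ _ (measurableI _ _ mD mS)|exact: fin_num_measure _ _ (measurableI _ _ mD mC)].
      rewrite HS; [|exact: measurableI|by move=> x []].
      rewrite HS' ?addr0//; first exact: measurableI.
      by move=> x [/DSS[]].
  - by move=> U V UV [S [mS VS HS]]; exists S; split => //; exact: subset_trans VS.
  - move=> p _; exists (patch p.1); last first.
      exists (patch p.1); split => //; first by apply: borel_open; exact: patch_open.
      by move=> D mD DU; rewrite -(setIidl DU); exact: measure0_patch.
    apply: open_nbhs_nbhs; split; first exact: patch_open.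
    have := sqmod_gt0 p.1; split; last by rewrite ltrDl.
    by rewrite ltr_pdivrMr// ltr_pMr// ltrDl.
move=> [S [mS BS HS]].
have mC := measurableC mB.
have := chargeU lambda (measurableI _ _ mE mB) (measurableI _ _ mE mC).
rewrite -setIUr setUv setIT => ->; last by rewrite setIACA setICr setI0.
rewrite fineD; [|exact: fin_num_measure _ _ (measurableI _ _ mE mB)|exact: fin_num_measure _ _ (measurableI _ _ mE mC)].
rewrite HS; [|exact: measurableI|by move=> x [_ /BS]].
by rewrite add0r; apply: HB => //; exact: (measurableI _ _ mE mC).
Qed.

End strictness.

(** * The Moore-Aronszajn space *)

Section complex_limits.
Variable R : realType.
Implicit Types (z w : nat -> R[i]) (l k a : R[i]).

Definition clim z l : Prop :=
  (fun n => complex.Re (z n)) @ \oo --> complex.Re l /\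
  (fun n => complex.Im (z n)) @ \oo --> complex.Im l.

Lemma climD z w l k : clim z l -> clim w k -> clim (fun n => z n + w n) (l + k).
Proof.
move=> [z1 z2] [w1 w2]; split; rewrite ?Re_add ?Im_add.
  by under eq_cvg do rewrite Re_add; exact: cvgD.
by under eq_cvg do rewrite Im_add; exact: cvgD.
Qed.

Lemma climZ a z l : clim z l -> clim (fun n => a * z n) (a * l).
Proof.
move=> [z1 z2]; split; rewrite ?Re_mul ?Im_mul.
  under eq_cvg do rewrite Re_mul.
  by apply: cvgB; apply: cvgM => //; exact: cvg_cst.
under eq_cvg do rewrite Im_mul.
by apply: cvgD; apply: cvgM => //; exact: cvg_cst.
Qed.

Lemma clim_conj z l : clim z l -> clim (fun n => (z n)^c) l^c.
Proof.
have ER (x : R[i]) : complex.Re x^c = complex.Re x by case: x.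
have EI (x : R[i]) : complex.Im x^c = - complex.Im x by case: x.
move=> [z1 z2]; split; rewrite ?ER ?EI.
  by under eq_cvg do rewrite ER.
by under eq_cvg do rewrite EI; exact: cvgN.
Qed.

Lemma clim_cst l : clim (fun=> l) l.
Proof. by split; exact: cvg_cst. Qed.

Lemma clim_unique z l k : clim z l -> clim z k -> l = k.
Proof.
move=> [z1 z2] [w1 w2]; apply/eqP; rewrite eq_complex; apply/andP; split; apply/eqP.
  exact: cvg_unique z1 w1.
exact: cvg_unique z2 w2.
Qed.

Lemma clim_normc z l : clim z l <-> (fun n => normc (z n - l)) @ \oo --> (0 : R).
Proof.
have E (x y : R[i]) : complex.Re (x - y) = complex.Re x - complex.Re y /\
  complex.Im (x - y) = complex.Im x - complex.Im y by case: x y => [? ?] [? ?].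
split=> [[/cvgrPdist_le z1 /cvgrPdist_le z2]|/cvgrPdist_le h].
  apply/cvgrPdist_le => e e0; have e2 : 0 < e / 2 by rewrite divr_gt0.
  near=> n; rewrite sub0r normrN ger0_norm ?normc_ge0//.
  apply: le_trans (normc_le _) _; rewrite (E _ _).1 (E _ _).2 (splitr e).
  by apply: lerD; rewrite distrC; near: n; [exact: z1|exact: z2].
split; apply/cvgrPdist_le => e /h; apply: filterS => n.
  rewrite sub0r normrN ger0_norm ?normc_ge0// distrC -(E _ _).1.
  exact: le_trans (normc_Re _).
rewrite sub0r normrN ger0_norm ?normc_ge0// distrC -(E _ _).2.
exact: le_trans (normc_Im _).
Unshelve. all: by end_near. Qed.

Lemma clim_sum I (r : seq I) (z : I -> nat -> R[i]) (l : I -> R[i]) :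
  (forall i, clim (z i) (l i)) -> clim (fun n => \sum_(i <- r) z i n) (\sum_(i <- r) l i).
Proof.
move=> zl; elim: r => [|i r IH].
  by rewrite big_nil (_ : (fun n => _) = fun=> 0); [exact: clim_cst|apply/funext => n; rewrite big_nil].
rewrite big_cons (_ : (fun n => _) = fun n => z i n + \sum_(j <- r) z j n).
  exact: climD.
by apply/funext => n; rewrite big_cons.
Qed.

Lemma real_cauchy (x : nat -> R) :
  (forall e, 0 < e -> exists N, forall p q, (N <= p)%N -> (N <= q)%N -> `|x p - x q| < e) ->
  exists l : R, x @ \oo --> l.
Proof.
move=> xC; apply/cvg_ex; apply/cauchy_cvgP/cauchy_ballP => e e0.
have [N HN] := xC e e0.
exists ([set y | exists2 p, (N <= p)%N & x p = y], [set y | exists2 p, (N <= p)%N & x p = y]).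
  by split; exists N => // n /= Nn; exists n.
by move=> [_ _] [[p Np <-] [q Nq <-]] /=; exact: HN.
Qed.

Lemma clim_cauchy z :
  (forall e, 0 < e -> exists N, forall p q, (N <= p)%N -> (N <= q)%N -> normc (z p - z q) < e) ->
  exists l, clim z l.
Proof.
move=> zC.
have E (x y : R[i]) : complex.Re (x - y) = complex.Re x - complex.Re y /\
  complex.Im (x - y) = complex.Im x - complex.Im y by case: x y => [? ?] [? ?].
have [|a za] := @real_cauchy (fun n => complex.Re (z n)).
  move=> e /zC[N HN]; exists N => p q Np Nq; rewrite -(E _ _).1.
  exact: le_lt_trans (normc_Re _) (HN p q Np Nq).
have [|b zb] := @real_cauchy (fun n => complex.Im (z n)).
  move=> e /zC[N HN]; exists N => p q Np Nq; rewrite -(E _ _).2.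
  exact: le_lt_trans (normc_Im _) (HN p q Np Nq).
by exists (a +i* b).
Qed.

End complex_limits.

Section combination_norm.
Variables (R : realType) (Y : Type) (L : Y -> Y -> R[i]).
Hypothesis pL : psd L.
Implicit Types s t r : seq (R[i] * Y).

Definition cnorm s : R := Num.sqrt (complex.Re (sesq L s s)).
Definition cdiff s t := s ++ coef_scale (-1) t.

Lemma cnorm_ge0 s : 0 <= cnorm s. Proof. exact: sqrtr_ge0. Qed.

Lemma cnormE s : sesq L s s = (cnorm s ^+ 2)%:C.
Proof.
rewrite /cnorm; case: (sesq L s s) (pL s) => a b; rewrite lecE/= => /andP[/eqP-> a0].
by rewrite sqr_sqrtr.
Qed.

Lemma normc_sqr (z : R[i]) : z * z^c = (normc z ^+ 2)%:C.
Proof.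
case: z => a b; rewrite /= sqr_sqrtr ?addr_ge0 ?sqr_ge0//.
by apply/eqP; rewrite eq_complex; apply/andP; split; apply/eqP => /=; ring.
Qed.

Lemma cnorm_CS s t : normc (sesq L s t) <= cnorm s * cnorm t.
Proof.
have := psd_CS s t pL; rewrite normc_sqr !cnormE -rmorphM lecR -exprMn.
by rewrite ler_sqr// nnegrE ?mulr_ge0 ?cnorm_ge0 ?normc_ge0.
Qed.

Let Re2 s : complex.Re (sesq L s s) = cnorm s ^+ 2. Proof. by rewrite cnormE. Qed.

Lemma cnorm_cat s t : cnorm (s ++ t) <= cnorm s + cnorm t.
Proof.
rewrite -ler_sqr ?nnegrE ?addr_ge0 ?cnorm_ge0// -Re2 !sesq_catl !sesq_catr !Re_add !Re2.
have h1 := le_trans (ler_norm _) (le_trans (normc_Re _) (cnorm_CS s t)).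
have h2 := le_trans (ler_norm _) (le_trans (normc_Re _) (cnorm_CS t s)).
by rewrite sqrrD; lra.
Qed.

Lemma cnorm_scale a s : cnorm (coef_scale a s) = normc a * cnorm s.
Proof.
rewrite {1}/cnorm sesq_scalel sesq_scaler cnormE mulrA normc_sqr -rmorphM/= -exprMn.
by rewrite sqrtr_sqr ger0_norm// mulr_ge0 ?normc_ge0 ?cnorm_ge0.
Qed.

Lemma cdiff_sesql s t r : sesq L (cdiff s t) r = sesq L s r - sesq L t r.
Proof. by rewrite sesq_catl sesq_scalel mulN1r. Qed.

Lemma cdiff_sesqr s t r : sesq L r (cdiff s t) = sesq L r s - sesq L r t.
Proof. by rewrite sesq_catr sesq_scaler conjcN conjc1 mulN1r. Qed.

Lemma cdiff_trans r s t : cnorm (cdiff s t) <= cnorm (cdiff s r) + cnorm (cdiff r t).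
Proof.
apply: le_trans (cnorm_cat _ _); rewrite /cnorm.
rewrite !(sesq_catl _ (cdiff _ _) (cdiff _ _)) !(sesq_catr _ _ (cdiff _ _) (cdiff _ _)).
by rewrite !(cdiff_sesql, cdiff_sesqr) le_eqVlt; apply/orP; left; apply/eqP; congr (Num.sqrt (complex.Re _)); ring.
Qed.

Lemma cdiff_sym s t : cnorm (cdiff s t) = cnorm (cdiff t s).
Proof. by rewrite /cnorm !(cdiff_sesql, cdiff_sesqr); congr (Num.sqrt (complex.Re _)); ring. Qed.

Lemma cnorm_le_diff s t : cnorm s <= cnorm (cdiff s t) + cnorm t.
Proof.
apply: le_trans (cnorm_cat _ _); rewrite /cnorm.
rewrite !(sesq_catl _ (cdiff _ _)) !(sesq_catr _ _ (cdiff _ _)).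
by rewrite !(cdiff_sesql, cdiff_sesqr) le_eqVlt; apply/orP; left; apply/eqP; congr (Num.sqrt (complex.Re _)); ring.
Qed.

Definition ccauchy (u : nat -> seq (R[i] * Y)) : Prop :=
  forall e, 0 < e -> exists N, forall p q, (N <= p)%N -> (N <= q)%N ->
    cnorm (cdiff (u p) (u q)) < e.

Lemma ccauchy_bounded u : ccauchy u -> exists N, exists2 M, 0 < M &
  forall n, (N <= n)%N -> cnorm (u n) <= M.
Proof.
move=> /(_ 1 ltr01)[N HN]; exists N, (1 + cnorm (u N)); first by rewrite ltr_pwDl ?cnorm_ge0.
move=> n Nn; apply: le_trans (cnorm_le_diff _ (u N)) _.
by rewrite lerD2r; apply/ltW/HN.
Qed.

Lemma ccauchy_sesq u v : ccauchy u -> ccauchy v -> exists l, clim (fun n => sesq L (u n) (v n)) l.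
Proof.
move=> cu cv; apply: clim_cauchy => e e0.
have [N1 [M1 M10 H1]] := ccauchy_bounded cu; have [N2 [M2 M20 H2]] := ccauchy_bounded cv.
have e1 : 0 < e / 2 / M2 by rewrite !divr_gt0.
have e2 : 0 < e / 2 / M1 by rewrite !divr_gt0.
have [N3 H3] := cu _ e1; have [N4 H4] := cv _ e2.
exists (maxn (maxn N1 N2) (maxn N3 N4)) => p q.
rewrite !geq_max => /andP[/andP[p1 p2] /andP[p3 p4]] /andP[/andP[q1 q2] /andP[q3 q4]].
have -> : sesq L (u p) (v p) - sesq L (u q) (v q) =
    sesq L (cdiff (u p) (u q)) (v p) + sesq L (u q) (cdiff (v p) (v q)).
  by rewrite cdiff_sesql cdiff_sesqr; ring.
apply: le_lt_trans (le_normcD _ _) _; rewrite (splitr e); apply: ltrD.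
  apply: le_lt_trans (cnorm_CS _ _) _.
  apply: le_lt_trans (_ : cnorm (cdiff (u p) (u q)) * M2 < _).
    by apply: ler_wpM2l; [exact: cnorm_ge0|exact: H2].
  by rewrite -ltr_pdivlMr//; exact: H3.
apply: le_lt_trans (cnorm_CS _ _) _.
apply: le_lt_trans (_ : M1 * cnorm (cdiff (v p) (v q)) < _).
  by apply: ler_wpM2r; [exact: cnorm_ge0|exact: H1].
by rewrite mulrC -ltr_pdivlMr//; exact: H4.
Qed.

End combination_norm.
Section moore_aronszajn.
Variables (R : realType) (Y : Type) (K : Y -> Y -> R[i]).
Hypothesis pK : psd K.
Local Notation L := (fun y y' => K y' y).
Local Notation combo := (seq (R[i] * Y)).
Implicit Types (s t : combo) (u v : nat -> combo) (F G E : Y -> R[i]).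

(** The inner product of the sections at [y] and [y'] is [K y' y], so the Gram kernel of formal
    combinations is the transpose of [K]. *)
Lemma psd_flip : psd L.
Proof.
move=> s; have := pK [seq (a.1^c, a.2) | a <- s].
rewrite /sesq big_map; under eq_bigr do rewrite big_map/=.
rewrite exchange_big/= => h; congr (0 <= _) : h.
by apply: eq_bigr => a _; apply: eq_bigr => b _; rewrite conjcK (mulrC b.1^c).
Qed.

Definition eval_combo s : Y -> R[i] := fun x => \sum_(a <- s) a.1 * K x a.2.

Lemma eval_comboE s x : eval_combo s x = sesq L s [:: (1, x)].
Proof. by rewrite sesq1r conjc1 mul1r. Qed.

Lemma sesq_eval s t : sesq L s t = \sum_(b <- t) b.1^c * eval_combo s b.2.
Proof.
rewrite /sesq exchange_big/=; apply: eq_bigr => b _; rewrite /eval_combo big_distrr/=.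
by apply: eq_bigr => a _; ring.
Qed.

Lemma eval_combo_le s x : normc (eval_combo s x) <= cnorm L s * Num.sqrt (complex.Re (K x x)).
Proof.
rewrite eval_comboE; apply: le_trans (cnorm_CS psd_flip _ _) _.
by rewrite {2}/cnorm sesq11 conjc1 !mul1r.
Qed.

Lemma eval_cat s t x : eval_combo (s ++ t) x = eval_combo s x + eval_combo t x.
Proof. by rewrite /eval_combo big_cat. Qed.

Lemma eval_scale a s x : eval_combo (coef_scale a s) x = a * eval_combo s x.
Proof. by rewrite !eval_comboE sesq_scalel. Qed.

Lemma eval_cdiff s t x : eval_combo (cdiff s t) x = eval_combo s x - eval_combo t x.
Proof. by rewrite eval_cat eval_scale mulN1r. Qed.

(** A point of the completion is given by a Cauchy sequence of formal combinations together with its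
    pointwise limit, which exists because evaluations are bounded. The space thus consists of
    functions instead of classes. *)
Definition represents u F : Prop :=
  ccauchy L u /\ forall x, clim (fun n => eval_combo (u n) x) (F x).

Definition hspace : set (Y -> R[i]) := [set F | exists u, represents u F].

Lemma ccauchy_represents u : ccauchy L u -> exists F, represents u F.
Proof.
move=> cu; have H x : exists l, clim (fun n => eval_combo (u n) x) l.
  apply: clim_cauchy => e e0; set c := Num.sqrt (complex.Re (K x x)).
  have c0 : 0 <= c by exact: sqrtr_ge0.
  have c1 : 0 < c + 1 by rewrite ltr_wpDl.
  have [|N HN] := cu (e / (c + 1)); first by rewrite divr_gt0.
  exists N => p q Np Nq; rewrite -eval_cdiff; apply: le_lt_trans (eval_combo_le _ _) _.
  rewrite -/c; apply: le_lt_trans (_ : cnorm L (cdiff (u p) (u q)) * (c + 1) < _).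
    by rewrite ler_wpM2l ?cnorm_ge0// lerDl.
  by rewrite -ltr_pdivlMr//; exact: HN.
by exists (fun x => projT1 (cid (H x))); split => // x; exact: projT2 (cid (H x)).
Qed.

Lemma represents_cst s : represents (fun=> s) (eval_combo s).
Proof.
split; last by move=> x; exact: clim_cst.
move=> e e0; exists 0 => p q _ _; rewrite /cnorm cdiff_sesql !cdiff_sesqr.
by rewrite subrr /= sqrtr0.
Qed.

Lemma represents_lin a u v F G : represents u F -> represents v G ->
  represents (fun n => v n ++ coef_scale a (u n)) (fun y => a * F y + G y).
Proof.
move=> [cu uF] [cv vG]; split=> [e e0|x]; last first.
  rewrite (_ : (fun n => _) = fun n => a * eval_combo (u n) x + eval_combo (v n) x).
    by apply: climD => //; exact: climZ.
  by apply/funext => n; rewrite eval_cat eval_scale addrC.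
have a1 : 0 < normc a + 1 by rewrite ltr_wpDl// normc_ge0.
have e1 : 0 < e / 2 / (normc a + 1) by rewrite !divr_gt0.
have e2 : 0 < e / 2 by rewrite !divr_gt0.
have [N1 H1] := cu _ e1; have [N2 H2] := cv _ e2.
exists (maxn N1 N2) => p q; rewrite !geq_max => /andP[p1 p2] /andP[q1 q2].
have -> : cnorm L (cdiff (v p ++ coef_scale a (u p)) (v q ++ coef_scale a (u q))) =
    cnorm L (cdiff (v p) (v q) ++ coef_scale a (cdiff (u p) (u q))).
  rewrite /cnorm !(sesq_catl, sesq_catr, sesq_scalel, sesq_scaler).
  by congr (Num.sqrt (complex.Re _)); ring.
apply: le_lt_trans (cnorm_cat psd_flip _ _) _; rewrite cnorm_scale; last exact: psd_flip.
rewrite (splitr e); apply: ltrD; first exact: H2.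
apply: le_lt_trans (_ : (normc a + 1) * cnorm L (cdiff (u p) (u q)) < _).
  by rewrite ler_wpM2r ?cnorm_ge0// lerDl.
by rewrite mulrC -ltr_pdivlMr//; exact: H1.
Qed.

Lemma representsB u v F G : represents u F -> represents v G ->
  represents (fun n => cdiff (u n) (v n)) (fun y => F y - G y).
Proof.
move=> uF vG; have := represents_lin (-1) vG uF.
by rewrite (_ : (fun y => -1 * G y + F y) = fun y => F y - G y)//; apply/funext => y; ring.
Qed.

(* A Cauchy sequence of combinations that vanishes pointwise vanishes in norm:
   this is what makes the inner product of the limits well defined. *)
Lemma represents0 u : represents u (fun=> 0) -> (fun n => cnorm L (u n)) @ \oo --> (0 : R).
Proof.
move=> [cu u0]; have pL := psd_flip.
have [N1 [M M0 HM]] := ccauchy_bounded pL cu.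
apply/cvgrPdist_le => e e0; have e2 : 0 < e ^+ 2 / 2 by rewrite divr_gt0// exprn_gt0.
have e3 : 0 < e ^+ 2 / 2 / M by rewrite divr_gt0.
(* [|u n|^2 = <u n, u n - u N> + <u n, u N>]: the first term is small by the Cauchy property; for
   fixed [N] the second involves finitely many values of [u n] and tends to zero. *)
have [N2 H2] := cu _ e3; pose N := maxn N1 N2.
have /clim_normc/cvgrPdist_le/(_ _ e2) H3 : clim (fun n => sesq L (u n) (u N)) 0.
  rewrite (_ : (fun n => _) = fun n => \sum_(b <- u N) b.1^c * eval_combo (u n) b.2); last first.
    by apply/funext => n; exact: sesq_eval.
  have := @clim_sum R _ (u N) (fun b n => b.1^c * eval_combo (u n) b.2)
    (fun b => b.1^c * 0) (fun b => climZ _ (u0 b.2)).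
  by rewrite [X in clim _ X](_ : _ = 0)// big1// => b _; rewrite mulr0.
near=> n; rewrite sub0r normrN ger0_norm ?cnorm_ge0//.
have Nn : (N <= n)%N by near: n; exists N.
have := Nn; rewrite geq_max => /andP[n1 n2].
rewrite -ler_sqr ?nnegrE ?cnorm_ge0 ?(ltW e0)//.
have -> : cnorm L (u n) ^+ 2 = normc (sesq L (u n) (cdiff (u n) (u N)) + sesq L (u n) (u N)).
  by rewrite cdiff_sesqr subrK cnormE// normc_real ger0_norm// exprn_ge0// cnorm_ge0.
apply: le_trans (le_normcD _ _) _; rewrite (splitr (e ^+ 2)); apply: lerD.
  apply: le_trans (cnorm_CS pL _ _) _.
  apply: le_trans (_ : M * cnorm L (cdiff (u n) (u N)) <= _).
    by rewrite ler_wpM2r ?cnorm_ge0//; exact: HM.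
  by rewrite mulrC -ler_pdivlMr//; apply/ltW/H2 => //; exact: leq_maxr.
have : `|0 - normc (sesq L (u n) (u N) - 0)| <= e ^+ 2 / 2 by near: n; exact: H3.
by rewrite sub0r normrN subr0 ger0_norm// normc_ge0.
Unshelve. all: by end_near. Qed.

Lemma cnorm_cvg u : ccauchy L u -> exists r : R, (fun n => cnorm L (u n)) @ \oo --> r.
Proof.
move=> cu; have [l [l1 _]] := ccauchy_sesq psd_flip cu cu.
by exists (Num.sqrt (complex.Re l)); apply: continuous_cvg l1; exact: sqrt_continuous.
Qed.

Lemma sesq_limit_unique u u' v v' F G l l' :
  represents u F -> represents u' F -> represents v G -> represents v' G ->
  clim (fun n => sesq L (u n) (v n)) l -> clim (fun n => sesq L (u' n) (v' n)) l' -> l = l'.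
Proof.
move=> uF u'F vG v'G ul u'l; have pL := psd_flip.
have zero E (w w' : nat -> combo) : represents w E -> represents w' E ->
    (fun n => cnorm L (cdiff (w n) (w' n))) @ \oo --> (0 : R).
  move=> wE w'E; apply: represents0; have := representsB wE w'E.
  by rewrite (_ : (fun y => E y - E y) = fun=> 0)//; apply/funext => y; rewrite subrr.
have [r vr] := cnorm_cvg vG.1; have [r' ur'] := cnorm_cvg u'F.1.
have H : (fun n => cnorm L (cdiff (u n) (u' n)) * cnorm L (v n) +
    cnorm L (u' n) * cnorm L (cdiff (v n) (v' n))) @ \oo --> (0 : R).
  rewrite -[0](_ : 0 * r + r' * 0 = 0); last by rewrite mul0r mulr0 addr0.
  by apply: cvgD; apply: cvgM => //; [exact: zero uF u'F|exact: zero vG v'G].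
have D : clim (fun n => sesq L (u n) (v n) - sesq L (u' n) (v' n)) 0.
  apply/clim_normc; apply: (squeeze_cvgr _ (cvg_cst 0) H).
  apply: nearW => n; rewrite normc_ge0 subr0/=.
  have -> : sesq L (u n) (v n) - sesq L (u' n) (v' n) =
      sesq L (cdiff (u n) (u' n)) (v n) + sesq L (u' n) (cdiff (v n) (v' n)).
    by rewrite cdiff_sesql cdiff_sesqr; ring.
  by apply: le_trans (le_normcD _ _) _; apply: lerD; exact: cnorm_CS.
have D' := climD ul (climZ (-1) u'l); apply/eqP; rewrite -subr_eq0 -mulN1r.
apply/eqP; apply: clim_unique D' _.
by rewrite (_ : (fun n => _ + _) = fun n => sesq L (u n) (v n) - sesq L (u' n) (v' n))//; apply/funext => n; rewrite mulN1r.
Qed.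

(* Only used on [hspace]; elsewhere it is [0]. *)
Definition hinner F G : R[i] :=
  if pselect (exists l, exists u, exists v,
    [/\ represents u F, represents v G & clim (fun n => sesq L (u n) (v n)) l]) is left h
  then projT1 (cid h) else 0.

Lemma hinnerP u v F G : represents u F -> represents v G ->
  clim (fun n => sesq L (u n) (v n)) (hinner F G).
Proof.
move=> uF vG; have [l ul] := ccauchy_sesq psd_flip uF.1 vG.1.
rewrite /hinner; case: pselect => [h|]; last by case; exists l, u, v.
case: (cid h) => l' /= [u' [v' [u'F v'G ul']]].
by rewrite -(sesq_limit_unique uF u'F vG v'G ul ul').
Qed.

Local Notation hnorm := (ipnorm hinner).

Lemma hnormP u F : represents u F -> (fun n => cnorm L (u n)) @ \oo --> hnorm F.
Proof.
move=> uF; have [H _] := hinnerP uF uF.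
by apply: continuous_cvg H; exact: sqrt_continuous.
Qed.

Lemma hnorm_combo s : hnorm (eval_combo s) = cnorm L s.
Proof. by have /cvg_unique := hnormP (represents_cst s); apply; [exact: Rhausdorff|exact: cvg_cst]. Qed.

Lemma hnorm_trans E F G : hspace E -> hspace F -> hspace G ->
  hnorm (fun y => F y - G y) <= hnorm (fun y => F y - E y) + hnorm (fun y => E y - G y).
Proof.
move=> [e eE] [f fF] [g gG].
apply: (ler_cvg_to (hnormP (representsB fF gG))
  (cvgD (hnormP (representsB fF eE)) (hnormP (representsB eE gG)))).
by apply: nearW => n; exact: cdiff_trans psd_flip _ _ _.
Qed.

Lemma hnorm_sym F G : hspace F -> hspace G ->
  hnorm (fun y => F y - G y) = hnorm (fun y => G y - F y).
Proof.
move=> [f fF] [g gG]; have H1 := hnormP (representsB fF gG).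
have H2 := hnormP (representsB gG fF).
have E : (fun n => cnorm L (cdiff (g n) (f n))) = (fun n => cnorm L (cdiff (f n) (g n))).
  by apply/funext => n; exact: cdiff_sym.
by rewrite E in H2; exact: cvg_unique H1 H2.
Qed.

Lemma hspace_combo s : hspace (eval_combo s).
Proof. by exists (fun=> s); exact: represents_cst. Qed.

Lemma represents_approx u F e : represents u F -> 0 < e -> exists N, forall n, (N <= n)%N ->
  hnorm (fun y => F y - eval_combo (u n) y) <= e.
Proof.
move=> uF e0; have [N HN] := uF.1 _ e0; exists N => n Nn.
apply: (cvgr_to_le (hnormP (representsB uF (represents_cst (u n))))).
by exists N => // k /= Nk; apply/ltW/HN.
Qed.

(** Each [w n] is replaced by a combination within [1 / (n + 1)] of it; these combinations form a
    Cauchy sequence, which represents the limit. *)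
Lemma hspace_complete w : (forall n, hspace (w n)) ->
  (forall eps : R, 0 < eps -> exists N, forall p q, (N <= p)%N -> (N <= q)%N ->
     hnorm (fun y => w p y - w q y) < eps) ->
  exists2 F, hspace F & (fun n => hnorm (fun y => w n y - F y)) @ \oo --> (0 : R).
Proof.
move=> Hw cw; have H n : exists s, hnorm (fun y => w n y - eval_combo s y) <= n.+1%:R^-1.
  have [u uw] := Hw n; have [|N HN] := @represents_approx u (w n) n.+1%:R^-1 uw.
    by rewrite invr_gt0.
  by exists (u N); exact: HN.
pose s n := projT1 (cid (H n)); have sw n := projT2 (cid (H n)) : hnorm (fun y => w n y - eval_combo (s n) y) <= _.
have small e : 0 < e -> exists N, forall n, (N <= n)%N -> n.+1%:R^-1 < e :> R.
  move=> e0; have /cvgrPdist_lt/(_ _ e0)[N _ HN] := @cvg_harmonic R.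
  by exists N => n /HN; rewrite /= sub0r normrN ger0_norm.
have cs : ccauchy L s.
  move=> e e0; have e3 : 0 < e / 3 by rewrite divr_gt0.
  have [N1 H1] := small _ e3; have [N2 H2] := cw _ e3.
  exists (maxn N1 N2) => p q; rewrite !geq_max => /andP[p1 p2] /andP[q1 q2].
  rewrite -hnorm_combo (_ : eval_combo _ = fun y => eval_combo (s p) y - eval_combo (s q) y); last first.
    by apply/funext => y; exact: eval_cdiff.
  have hp := hspace_combo (s p); have hq := hspace_combo (s q).
  have := hnorm_trans (Hw p) hp hq; have := hnorm_trans (Hw q) (Hw p) hq.
  rewrite (hnorm_sym hp (Hw p)).
  have := le_lt_trans (sw p) (H1 _ p1); have := le_lt_trans (sw q) (H1 _ q1).
  by have := H2 _ _ p2 q2; lra.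
have [F sF] := ccauchy_represents cs; have hF : hspace F by exists s.
exists F => //; apply/cvgrPdist_le => e e0; have e2 : 0 < e / 2 by rewrite divr_gt0.
have [N1 H1] := small _ e2; have [N2 H2] := represents_approx sF e2.
near=> n; rewrite sub0r normrN ger0_norm ?sqrtr_ge0//.
have n1 : (N1 <= n)%N by near: n; exists N1.
have n2 : (N2 <= n)%N by near: n; exists N2.
have := hnorm_trans (hspace_combo (s n)) (Hw n) hF.
rewrite (hnorm_sym (hspace_combo (s n)) hF).
have := le_lt_trans (sw n) (H1 _ n1); have := H2 _ n2; lra.
Unshelve. all: by end_near. Qed.

Lemma section_combo y : (fun x => K x y) = eval_combo [:: (1, y)].
Proof. by apply/funext => x; rewrite /eval_combo big_seq1 mul1r. Qed.

Theorem moore_aronszajn : is_rkhs K hspace hinner.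
Proof.
have pL := psd_flip; split.
- by exists (fun=> [::]); have := represents_cst [::]; rewrite (_ : eval_combo _ = fun=> 0)//; apply/funext => x; rewrite /eval_combo big_nil.
- by move=> a F G [u uF] [v vG]; exists (fun n => v n ++ coef_scale a (u n)); exact: represents_lin.
- move=> a F G E [u uF] [v vG] [e eE].
  apply: clim_unique (hinnerP (represents_lin a uF vG) eE) _.
  rewrite (_ : (fun n => _) = fun n => a * sesq L (u n) (e n) + sesq L (v n) (e n)).
    by apply: climD (hinnerP vG eE); apply: climZ; exact: hinnerP.
  by apply/funext => n; rewrite sesq_catl sesq_scalel addrC.
- move=> F G [u uF] [v vG]; apply: clim_unique (hinnerP vG uF) _.
  rewrite (_ : (fun n => _) = fun n => (sesq L (u n) (v n))^c).
    exact: clim_conj (hinnerP uF vG).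
  by apply/funext => n; exact: psd_hermS.
- move=> F [u uF]; have [h1 h2] := hinnerP uF uF; rewrite lecE; apply/andP; split.
    have E : (fun n => complex.Im (sesq L (u n) (u n))) = fun=> 0.
      by apply/funext => n; rewrite cnormE.
    by rewrite E in h2; apply/eqP; exact: cvg_unique h2 (cvg_cst _).
  apply: (cvgr_to_ge h1); apply: nearW => n; rewrite cnormE//=.
  exact: sqr_ge0.
- move=> F [u uF] F0; apply/funext => x; apply: clim_unique (uF.2 x) _; apply/clim_normc.
  have H : (fun n => cnorm L (u n) * Num.sqrt (complex.Re (K x x))) @ \oo --> (0 : R).
    rewrite -[0](_ : hnorm F * Num.sqrt (complex.Re (K x x)) = 0).
      by apply: cvgM; [exact: hnormP|exact: cvg_cst].
    by rewrite /ipnorm F0/= sqrtr0 mul0r.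
  apply: (squeeze_cvgr _ (cvg_cst 0) H); apply: nearW => n.
  by rewrite normc_ge0 subr0/=; exact: eval_combo_le.
- exact: hspace_complete.
- by move=> y; rewrite section_combo; exact: hspace_combo.
- move=> F y [u uF]; rewrite section_combo.
  apply: clim_unique (hinnerP uF (represents_cst _)) _.
  by under eq_fun do rewrite -eval_comboE; exact: uF.2.
- move=> F [u uF] e e0; have e2 : 0 < e / 2 by rewrite divr_gt0.
  have [N HN] := represents_approx uF e2; pose s := u N.
  exists (size s), (fun i => (tnth (in_tuple s) i).1), (fun i => (tnth (in_tuple s) i).2).
  rewrite (_ : (fun x => _) = fun y => F y - eval_combo s y).
    apply: le_lt_trans (HN N (leqnn _)) _; rewrite ltr_pdivrMr// ltr_pMr// ltr1n//.
  by apply/funext => x; rewrite /eval_combo [in RHS]big_tnth.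
Qed.

Lemma hspace_rkhs F : hspace F -> rkhs K F.
Proof. by move=> hF; exists hspace, hinner; split => //; exact: moore_aronszajn. Qed.

End moore_aronszajn.

(** * Function spaces containing a reproducing kernel space *)

Section rkhs_closure.
Variables (R : realType) (Y : Type) (K : Y -> Y -> R[i]).
Variables (H : set (Y -> R[i])) (ip : (Y -> R[i]) -> (Y -> R[i]) -> R[i]).
Hypothesis HK : is_rkhs K H ip.

(** Cauchy-Schwarz for [F] and the section at [y]: the vector [G = K(y,y) F - F(y) K_y] is
    orthogonal to the section and has nonnegative square. Only the axioms are used, since membership
    in [rkhs K] supplies an unspecified space. *)
Lemma rkhs_eval_le F y : H F -> normc (F y) <= ipnorm ip F * Num.sqrt (complex.Re (K y y)).
Proof.
move=> HF; have HKy := rkhs_section HK y; have H0 := rkhs_zero HK.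
have ip0 G : H G -> ip (fun=> 0) G = 0.
  move=> HG; have := rkhs_ip_lin HK 1 H0 H0 HG.
  rewrite (_ : (fun y => _) = fun=> 0); last by apply/funext => x; rewrite mulr0 addr0.
  by rewrite mul1r => /eqP; rewrite -subr_eq subrr => /eqP.
set b := K y y; set a := F y.
have ipb : ip (fun x => K x y) (fun x => K x y) = b by exact: (rkhs_reproducing HK).
have ipa : ip F (fun x => K x y) = a by exact: (rkhs_reproducing HK).
have b0 : 0 <= b by rewrite -ipb; exact: (rkhs_ip_ge0 HK).
have [bz|bn] := eqVneq b 0.
  have Kz := rkhs_ip_def HK HKy (etrans ipb bz).
  have -> : a = 0.
    rewrite -ipa (rkhs_ip_herm HK HKy HF) Kz ip0//; exact: rmorph0.
  by rewrite normc0 mulr_ge0// sqrtr_ge0.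
(* The summand [0] gives [G0] the shape that [rkhs_lin] requires. *)
pose G0 : Y -> R[i] := fun x => - a * K x y + 0.
pose G : Y -> R[i] := fun x => b * F x + G0 x.
have HG0 : H G0 by apply: (rkhs_lin HK).
have HG : H G by apply: (rkhs_lin HK).
have GG := rkhs_ip_lin HK b HF HG0 HG.
have G0G := rkhs_ip_lin HK (- a) HKy H0 HG.
have KG : ip (fun x => K x y) G = 0.
  rewrite (rkhs_ip_herm HK HG HKy) (rkhs_reproducing HK y HG).
  rewrite /G /G0 -/b -/a addr0 mulNr (mulrC b) subrr; exact: rmorph0.
rewrite -/G0 KG mulr0 ip0// addr0 in G0G.
have GF : ip G F = b * ip F F - a * a^c.
  rewrite (rkhs_ip_lin HK b HF HG0 HF) (rkhs_ip_lin HK (- a) HKy H0 HF) ip0// addr0.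
  by rewrite (rkhs_ip_herm HK HF HKy) ipa mulNr.
have FG : ip F G = b * ip F F - a * a^c.
  rewrite (rkhs_ip_herm HK HG HF) GF.
  have FF := conj_num (rkhs_ip_ge0 HK HF).
  by rewrite conjcD conjcN !conjcM conjcK FF (conj_num b0) (mulrC a^c).
have h : 0 <= b * (b * ip F F - a * a^c).
  by rewrite -FG; have := rkhs_ip_ge0 HK HG; rewrite {1}/G GG G0G addr0.
have h' : a * a^c <= b * ip F F.
  by rewrite -subr_ge0 -(pmulr_rge0 _ (_ : 0 < b))// lt_def bn.
rewrite -(ger0_norm (normc_ge0 a)) -sqrtr_sqr /ipnorm -sqrtrM; last first.
  by have := rkhs_ip_ge0 HK HF; rewrite lecE/= => /andP[].
apply: ler_wsqrtr; rewrite mulrC.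
move: h' b0 (rkhs_ip_ge0 HK HF); rewrite normc_sqr.
case: (b) => b1 b2; case: (ip F F) => f1 f2; rewrite !lecE/=.
by move=> /andP[_ h1] /andP[/eqP E1 _] /andP[/eqP E2 _]; move: h1; rewrite E1 E2 mulr0 subr0.
Qed.

Lemma rkhs_sub_combo F I (r : seq I) (c : I -> R[i]) (y : I -> Y) : H F ->
  H (fun x => F x - \sum_(i <- r) c i * K x (y i)).
Proof.
move=> HF; elim: r => [|i r IH].
  by rewrite (_ : (fun x => _) = F)//; apply/funext => x; rewrite big_nil subr0.
rewrite (_ : (fun x => _) = fun x => - c i * K x (y i) + (F x - \sum_(i <- r) c i * K x (y i))).
  by apply: (rkhs_lin HK) IH; exact: (rkhs_section HK).
by apply/funext => x; rewrite big_cons; ring.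
Qed.

Lemma rkhs_uniform_approx (M : R) F e : (forall y, complex.Re (K y y) <= M) -> H F -> 0 < e ->
  exists (n : nat) (c : 'I_n -> R[i]) (y : 'I_n -> Y),
    forall x, normc (F x - \sum_i c i * K x (y i)) <= e.
Proof.
move=> KM HF e0; pose d := Num.sqrt M + 1; have d0 : 0 < d by rewrite ltr_wpDl ?sqrtr_ge0.
have [|n [c [y E]]] := rkhs_dense HK HF (_ : 0 < e / d); first by rewrite divr_gt0.
exists n, c, y => x; apply: le_trans (@rkhs_eval_le _ x (rkhs_sub_combo _ c y HF)) _.
apply: le_trans (_ : e / d * d <= _); last by rewrite divfK// gt_eqF.
apply: ler_pM; rewrite ?sqrtr_ge0//; first exact: ltW.
by rewrite /d ler_wpDr// ler_wsqrtr.
Qed.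

End rkhs_closure.

Section rkhs_in_space.
Variables (R : realType) (Y : Type) (K : Y -> Y -> R[i]) (S : set (Y -> R[i])).
Hypothesis S0 : S (fun=> 0).
Hypothesis S_lin : forall a F G, S F -> S G -> S (fun x => a * F x + G x).
Hypothesis S_uniform : forall F,
  (forall e : R, 0 < e -> exists2 G, S G & forall x, normc (F x - G x) <= e) -> S F.

(** A bounded diagonal makes convergence in norm uniform, and combinations of sections are dense.
    [S] is abstract so as to cover both the continuous functions and [C_0]. *)
Lemma rkhs_subset (M : R) : (forall y, complex.Re (K y y) <= M) ->
  (forall y, S (fun x => K x y)) -> rkhs K `<=` S.
Proof.
move=> KM SK F [H [ip [HK HF]]]; apply: S_uniform => e e0.
have [n [c [y E]]] := rkhs_uniform_approx HK KM HF e0.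
exists (fun x => \sum_i c i * K x (y i)) => //.
elim: (index_enum 'I_n) => [|i r IH].
  by rewrite (_ : (fun x => _) = fun=> 0)//; apply/funext => x; rewrite big_nil.
rewrite (_ : (fun x => _) = fun x => c i * K x (y i) + \sum_(i <- r) c i * K x (y i)).
  exact: S_lin.
by apply/funext => x; rewrite big_cons.
Qed.

End rkhs_in_space.

Section continuous_spaces.
Variables (R : realType) (Y : topologicalType).
Implicit Types (F G : Y -> R[i]) (a : R[i]).

Lemma cont_normcP F : cont_funs R Y F <->
  forall y e, 0 < e -> \forall z \near y, normc (F y - F z) <= e.
Proof.
split=> [cF y e e0|FE y].
  by apply: filterS (near_normc (cF y) e0) => z /ltW.
apply/cvgrPdist_le => -[e e'] /[!ltcE]/= /andP[/eqP-> e0].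
by apply: filterS (FE y e e0) => z; rewrite lecR.
Qed.

Lemma cont_funs0 : cont_funs R Y (fun=> 0).
Proof. by apply/cont_normcP => y e e0; apply: nearW => z; rewrite subrr normc0 ltW. Qed.

Lemma cont_funs_lin a F G : cont_funs R Y F -> cont_funs R Y G ->
  cont_funs R Y (fun x => a * F x + G x).
Proof.
move=> /cont_normcP cF /cont_normcP cG; apply/cont_normcP => y e e0.
have a1 : 0 < normc a + 1 by rewrite ltr_wpDl ?normc_ge0.
have e1 : 0 < e / 2 / (normc a + 1) by rewrite !divr_gt0.
have e2 : 0 < e / 2 by rewrite divr_gt0.
near=> z; have -> : a * F y + G y - (a * F z + G z) = a * (F y - F z) + (G y - G z) by ring.
apply: le_trans (le_normcD _ _) _; rewrite (splitr e) normcM; apply: lerD.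
  apply: le_trans (_ : (normc a + 1) * normc (F y - F z) <= _).
    by rewrite ler_wpM2r ?normc_ge0// lerDl.
  by rewrite mulrC -ler_pdivlMr//; near: z; exact: cF.
by near: z; exact: cG.
Unshelve. all: by end_near. Qed.

Lemma cont_funs_uniform F :
  (forall e : R, 0 < e -> exists2 G, cont_funs R Y G & forall x, normc (F x - G x) <= e) ->
  cont_funs R Y F.
Proof.
move=> FG; apply/cont_normcP => y e e0; have e3 : 0 < e / 3 by rewrite divr_gt0.
have [G /cont_normcP cG GF] := FG _ e3; apply: filterS (cG y _ e3) => z h.
have -> : F y - F z = (F y - G y) + ((G y - G z) - (F z - G z)) by ring.
apply: le_trans (le_normcD _ _) _.
have := le_normcD (G y - G z) (- (F z - G z)).
have -> : normc (- (F z - G z)) = normc (F z - G z) by exact: normcN.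
by have := GF y; have := GF z; lra.
Qed.

Lemma C0_funs0 : C0_funs R Y (fun=> 0).
Proof.
split; first exact: cont_funs0.
by move=> e e0; exists set0 => [|y _]; [exact: compact0|rewrite normc0].
Qed.

Lemma C0_funs_lin a F G : C0_funs R Y F -> C0_funs R Y G ->
  C0_funs R Y (fun x => a * F x + G x).
Proof.
move=> [cF F0] [cG G0]; split; first exact: cont_funs_lin.
move=> e e0; have a1 : 0 < normc a + 1 by rewrite ltr_wpDl ?normc_ge0.
have e1 : 0 < e / 2 / (normc a + 1) by rewrite !divr_gt0.
have e2 : 0 < e / 2 by rewrite divr_gt0.
have [B cB HB] := F0 _ e1; have [D cD HD] := G0 _ e2.
exists (B `|` D); first exact: compactU.
move=> y /not_orP[nB nD]; apply: le_lt_trans (le_normcD _ _) _.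
rewrite (splitr e) normcM; apply: ltrD; last exact: HD.
apply: le_lt_trans (_ : (normc a + 1) * normc (F y) < _).
  by rewrite ler_wpM2r ?normc_ge0// lerDl.
by rewrite mulrC -ltr_pdivlMr//; exact: HB.
Qed.

Lemma C0_funs_uniform F :
  (forall e : R, 0 < e -> exists2 G, C0_funs R Y G & forall x, normc (F x - G x) <= e) ->
  C0_funs R Y F.
Proof.
move=> FG; split.
  by apply: cont_funs_uniform => e /FG[G [cG _] GF]; exists G.
move=> e e0; have e2 : 0 < e / 2 by rewrite divr_gt0.
have [G [_ G0] GF] := FG _ e2; have [B cB HB] := G0 _ e2; exists B => // y /HB h.
have := le_normcD (F y - G y) (G y); rewrite subrK; have := GF y; lra.
Qed.

Lemma C0_funs_bounded F : C0_funs R Y F -> exists M, forall y, normc (F y) <= M.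
Proof.
move=> [/cont_normcP cF /(_ 1 ltr01)[B cB HB]].
have [M HM] : exists M, forall y, B y -> normc (F y) <= M.
  apply: (@compact_induction _ B (fun B => exists M, forall y, B y -> normc (F y) <= M)) => //.
  - by exists 0.
  - move=> U V [M HM] [N HN]; exists (Num.max M N) => y.
    by rewrite le_max => -[/HM->//|/HN->]; rewrite orbT.
  - by move=> U V UV [M HM]; exists M => y /UV; exact: HM.
  - move=> x _; exists [set z | normc (F x - F z) <= 1]; first exact: cF.
    exists (1 + normc (F x)) => z /= h.
    have := le_normcD (- (F x - F z)) (F x).
    have -> : - (F x - F z) + F x = F z by ring.
    have -> : normc (- (F x - F z)) = normc (F x - F z) by exact: normcN.
    lra.
exists (Num.max 1 M) => y; have [By|nBy] := pselect (B y).
  by rewrite le_max HM// orbT.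
by rewrite le_max (ltW (HB y nBy)).
Qed.

End continuous_spaces.

(** * The gliding hump *)

Section gliding_hump.
Variables (R : realType) (Y : Type) (K : Y -> Y -> R[i]).
Hypothesis pK : psd K.
Local Notation L := (fun y y' => K y' y).
Local Notation kap x := (Num.sqrt (complex.Re (K x x))).

Variable x : nat -> Y.
(** The norm of the n-th hump. With ratio [1/4] all later humps together have norm at most
    [(4/3) a (n + 1) = a n / 3], too little to destroy the n-th peak. *)
Let a n : R := 4^-1 ^+ n.
Hypothesis x_large : forall n, n.+1%:R <= a n * kap (x n).

Let a_gt0 n : 0 < a n. Proof. by rewrite exprn_gt0// invr_gt0. Qed.

Let kap_gt0 n : 0 < kap (x n).
Proof. by rewrite -(pmulr_rgt0 _ (a_gt0 n)); apply: lt_le_trans (x_large n). Qed.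

(** The weight that gives the section at [x n] the norm [a n]. *)
Let v n : R := a n / kap (x n).
(* The sign is chosen so that the new hump is not cancelled by the previous ones. *)
Let coefficient n (s : seq (R[i] * Y)) : R :=
  if a n * kap (x n) <= normc ((a n * kap (x n))%:C + eval_combo K s (x n))
  then v n else - v n.

Fixpoint humps n : seq (R[i] * Y) :=
  if n is n'.+1 then ((coefficient n' (humps n'))%:C, x n') :: humps n' else [::].

Let Kxx n : K (x n) (x n) = (kap (x n) ^+ 2)%:C.
Proof.
have := psd_diag (x n) pK; case: (K _ _) => b b'; rewrite lecE/= => /andP[/eqP-> b0].
by rewrite sqr_sqrtr.
Qed.

Let vK n : v n * kap (x n) ^+ 2 = a n * kap (x n).
Proof. by rewrite /v expr2 mulrA divfK// gt_eqF. Qed.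

(** [A + E] and [A - E] add up to [2 A], so one of them has modulus at least [A]. *)
Lemma humps_peak n : a n * kap (x n) <= normc (eval_combo K (humps n.+1) (x n)).
Proof.
set A := a n * kap (x n); set E := eval_combo K (humps n) (x n).
have A0 : 0 < A by rewrite mulr_gt0.
have -> : eval_combo K (humps n.+1) (x n) = (coefficient n (humps n))%:C * (kap (x n) ^+ 2)%:C + E.
  by rewrite {1}/eval_combo big_cons; congr (_ * _ + _); exact: Kxx.
rewrite /coefficient -/A -/E; case: ifPn => [h|]; first by rewrite -rmorphM vK.
rewrite -ltNge => h; rewrite -rmorphM mulNr vK -/A.
have := le_normcD (A%:C + E) (A%:C - E).
have -> : A%:C + E + (A%:C - E) = (A + A)%:C by rewrite rmorphD/=; ring.
rewrite normc_real ger0_norm ?addr_ge0 ?(ltW A0)//.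
have -> : normc (A%:C - E) = normc ((- A)%:C + E).
  by rewrite -[LHS]normcN; congr normc; rewrite rmorphN/=; ring.
lra.
Qed.

Lemma humps_step n : cnorm L (cdiff (humps n.+1) (humps n)) = a n.
Proof.
have -> : cnorm L (cdiff (humps n.+1) (humps n)) = cnorm L [:: ((coefficient n (humps n))%:C, x n)].
  rewrite /cnorm (_ : humps n.+1 = [:: ((coefficient n (humps n))%:C, x n)] ++ humps n)//.
  rewrite !(cdiff_sesql, cdiff_sesqr, sesq_catl, sesq_catr).
  by congr (Num.sqrt (complex.Re _)); ring.
rewrite /cnorm sesq11 Kxx conjc_real -!rmorphM/=.
have -> : coefficient n (humps n) * coefficient n (humps n) * kap (x n) ^+ 2 = a n ^+ 2.
  have -> : a n = v n * kap (x n) by rewrite /v divfK// gt_eqF.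
  by rewrite /coefficient; case: ifP => _; rewrite exprMn ?mulrNN -expr2.
by rewrite sqrtr_sqr ger0_norm// ltW.
Qed.

Lemma humps_tail n k : cnorm L (cdiff (humps (k + n)) (humps n)) <= 4 / 3 * (a n - a (k + n)).
Proof.
elim: k => [|k IH].
  by rewrite add0n subrr mulr0 /cnorm cdiff_sesql !cdiff_sesqr subrr/= sqrtr0.
apply: le_trans (cdiff_trans (psd_flip pK) (humps (k + n)) _ _) _.
rewrite addSn humps_step; have : a (k + n).+1 = 4^-1 * a (k + n) by rewrite /a exprS.
by move: IH; lra.
Qed.

Lemma humps_dist p n : (n <= p)%N -> cnorm L (cdiff (humps p) (humps n)) <= 4 / 3 * a n.
Proof.
move=> /subnK <-; apply: le_trans (humps_tail _ _) _.
by rewrite ler_wpM2l// lerBlDr lerDl ltW.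
Qed.

Lemma humps_unbounded : exists2 F, hspace K F & forall M, exists y, M < normc (F y).
Proof.
have cs : ccauchy L humps.
  move=> e e0; have e3 : 0 < e / 3 by rewrite divr_gt0.
  have /cvgrPdist_lt/(_ _ e3)[N _ HN] : a @ \oo --> (0 : R).
    by apply: cvg_expr; rewrite ger0_norm// invf_lt1// ltr1n.
  exists N => p q Np Nq; apply: le_lt_trans (cdiff_trans (psd_flip pK) (humps N) _ _) _.
  rewrite (cdiff_sym _ (humps N)); have h1 := humps_dist Np; have h2 := humps_dist Nq.
  by have := HN N (leqnn _); rewrite /= sub0r normrN ger0_norm ?(ltW (a_gt0 _))//; lra.
have [F sF] := ccauchy_represents pK cs; exists F; first by exists humps.
have FE n y : normc (F y - eval_combo K (humps n) y) <= 4 / 3 * a n * kap y.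
  have /clim_normc H := sF.2 y.
  have H' : (fun p => normc (eval_combo K (humps p) y - F y) + 4 / 3 * a n * kap y) @ \oo --> 0 + 4 / 3 * a n * kap y.
    by apply: cvgD H _; exact: cvg_cst.
  rewrite add0r in H'; apply: (cvgr_to_ge H'); exists n => // p /= np.
  have := le_normcD (- (eval_combo K (humps p) y - F y)) (eval_combo K (cdiff (humps p) (humps n)) y).
  rewrite eval_cdiff.
  have -> : - (eval_combo K (humps p) y - F y) + (eval_combo K (humps p) y - eval_combo K (humps n) y) = F y - eval_combo K (humps n) y by ring.
  have -> : forall z : R[i], normc (- z) = normc z by exact: normcN.
  move=> h; apply: le_trans h _; rewrite lerD2l -eval_cdiff.
  apply: le_trans (eval_combo_le pK _ _) _; rewrite ler_wpM2r ?sqrtr_ge0//.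
  exact: humps_dist.
(* [F] keeps at least two thirds of the peak, and [2/3 (n + 1)] exceeds [4/3 |M|]. *)
move=> M; pose n := Num.truncn (2 * `|M|); exists (x n).
have h1 := FE n.+1 (x n); have h2 := humps_peak n.
have h3 := le_normcD (- (F (x n) - eval_combo K (humps n.+1) (x n))) (F (x n)).
rewrite (_ : - _ + F (x n) = eval_combo K (humps n.+1) (x n)) in h3; last by ring.
rewrite (_ : normc (- _) = normc (F (x n) - eval_combo K (humps n.+1) (x n))) in h3; last exact: normcN.
have h4 : a n.+1 * kap (x n) = 4^-1 * (a n * kap (x n)) by rewrite /a exprS mulrA.
rewrite -mulrA h4 in h1; have h5 := x_large n.
have h6 : 2 * `|M| < n.+1%:R by rewrite truncnS_gt.
have h7 := ler_norm M; have h8 := normr_ge0 M; lra.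
Qed.

End gliding_hump.

Section bounded_diagonal.
Variables (R : realType) (Y : Type) (K : Y -> Y -> R[i]).
Hypothesis pK : psd K.

(** An unbounded diagonal provides points with [sqrt (K x x) >= (n + 1) 4^n], from which the gliding
    hump builds an unbounded member of the space. *)
Lemma rkhs_bounded_diag :
  (forall F, rkhs K F -> exists M, forall y, normc (F y) <= M) ->
  exists M, forall y, complex.Re (K y y) <= M.
Proof.
move=> Fb; apply: contrapT => /forallNP nM.
have H n : exists y, n.+1%:R <= 4^-1 ^+ n * Num.sqrt (complex.Re (K y y)).
  have /existsNP[y /negP] := nM ((n.+1%:R * 4 ^+ n) ^+ 2); rewrite -ltNge => Ky.
  exists y; rewrite exprVn mulrC ler_pdivlMr ?exprn_gt0//.
  have c0 : 0 <= n.+1%:R * 4 ^+ n :> R by rewrite mulr_ge0// exprn_ge0.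
  by rewrite -(ger0_norm c0) -sqrtr_sqr ler_wsqrtr// ltW.
have [F hF FM] := humps_unbounded pK (fun n => projT2 (cid (H n))).
have [M HM] := Fb F (hspace_rkhs pK hF).
by have [y] := FM M; rewrite ltNge HM.
Qed.

Lemma kernel_le_diag M : (forall y, complex.Re (K y y) <= M) -> forall y y', normc (K y y') <= M.
Proof.
move=> KM y y'; have := cnorm_CS pK [:: (1, y)] [:: (1, y')].
rewrite sesq11 conjc1 !mul1r /cnorm !sesq11 conjc1 !mul1r => h; apply: le_trans h _.
have M0 : 0 <= M by apply: le_trans (KM y); by have := psd_diag y pK; rewrite lecE => /andP[].
rewrite -[leRHS](ger0_norm M0) -sqrtr_sqr expr2 sqrtrM// ler_pM ?sqrtr_ge0// ler_wsqrtr//.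
Qed.

End bounded_diagonal.

(** * Vanishing at infinity *)

Section vanishing_at_infinity.
Variables (R : realType) (m : nat) (X : topologicalType).
Variables (gamma : X -> X -> R) (A : X -> X -> R[i]).
Hypothesis gamma_gt0 : forall u v, 0 < gamma u v.
Hypothesis gamma_cont : continuous (fun p : X * X => gamma p.1 p.2).
Hypothesis gamma_cnd : cond_neg_def_kernel gamma.
Hypothesis A_cont : continuous_kernel A.
Hypothesis C_pd : pos_def_kernel (Cker m A gamma).
Local Notation Y := (X * 'rV[R]_m)%type.
Local Notation G := (Gker m A gamma).

Lemma Gker_le (p q : Y) : normc (G p q) <= normc (A p.1 q.1).
Proof.
rewrite /Gker normcM normc_real ger0_norm ?expR_ge0// ler_piMr ?normc_ge0//.
rewrite -expR0 ler_expR oppr_le0 divr_ge0 ?(ltW (gamma_gt0 _ _))//.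
by apply: sumr_ge0 => i _; exact: sqr_ge0.
Qed.

Lemma Gker_zero (u v : X) : G (u, 0) (v, 0) = A u v.
Proof.
rewrite /Gker /= big1 ?mul0r ?oppr0 ?expR0 ?mulr1//.
by move=> i _; rewrite subrr expr0n.
Qed.

Lemma gamma_bounded_compact (B : set X) v : compact B ->
  exists2 M, 0 < M & forall u, B u -> gamma u v <= M.
Proof.
move=> cB; apply: (@compact_induction _ B (fun B => exists2 M, 0 < M & forall u, B u -> gamma u v <= M)) => //.
- by exists 1.
- move=> U V [M M0 HM] [N N0 HN]; exists (Num.max M N) => [|y]; first by rewrite lt_max M0.
  by rewrite le_max => -[/HM->//|/HN->]; rewrite orbT.
- by move=> U V UV [M M0 HM]; exists M => // y /UV; exact: HM.
- move=> u _; have cg : continuous (fun u => gamma u v).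
    apply: (@cont_compT X (X * X)%type R (fun u => (u, v)) (fun p => gamma p.1 p.2)) => //.
    by apply: cont_pair => x; [exact: cvg_id|exact: cvg_cst].
  exists [set z | gamma z v < gamma u v + 1]; last first.
    by exists (gamma u v + 1) => [|z /ltW//]; rewrite addr_gt0.
  apply: open_nbhs_nbhs; split; last by rewrite /= ltrDl.
  have /continuousP/(_ _ (@open_lt R (gamma u v + 1))) := cg; exact.
Qed.

(** Off a compact set of base points [A] is small; over that set [gamma] is bounded, so the Gaussian
    decays uniformly in the base point. *)
Lemma Gker_section_C0 (MA : R) (q : Y) : (forall u v, normc (A u v) <= MA) ->
  C0_funs R X (fun u => A u q.1) -> C0_funs R Y (fun p => G p q).
Proof.
move=> AM [_ A0]; split.
  exact: (continuous_section (q := q) (@Gker_cont R m X gamma A gamma_gt0 gamma_cont A_cont)).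
move=> e e0; have [B cB HB] := A0 _ e0.
have [M M0 HM] := gamma_bounded_compact q.1 cB.
have MA0 : 0 <= MA by apply: le_trans (AM q.1 q.1); exact: normc_ge0.
(* Outside the cube of half-side [S] the squared distance [r] is at least [S], as [S >= 1]. Hence
   [r / gamma > MA / e], and [MA exp (- r / gamma) < e] follows from [exp y >= 1 + y]. *)
pose S := 1 + M * (MA / e); have S1 : 1 <= S by rewrite lerDl mulr_ge0 ?divr_ge0// ltW.
pose D : set 'rV[R]_m := [set x | forall i, `[q.2 0 i - S, q.2 0 i + S]%classic (x 0 i)].
have cD : compact D.
  by apply: (@rV_compact R m (fun i => `[q.2 0 i - S, q.2 0 i + S]%classic)) => i; exact: segment_compact.
exists (B `*` D); first exact: compact_setX.
move=> p nBD; have [pB|pB] := pselect (B p.1); last first.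
  by apply: le_lt_trans (Gker_le _ _) (HB _ pB).
have /existsNP[i nD] : ~ D p.2 by move=> pD; apply: nBD.
have Si : S < `|p.2 0 i - q.2 0 i|.
  rewrite ltNge; apply/negP => h; apply: nD; rewrite /= in_itv/=.
  by move: h; rewrite ler_norml => /andP[h1 h2]; apply/andP; split; lra.
rewrite /Gker normcM normc_real ger0_norm ?expR_ge0//.
set r := \sum_(i < m) _.
have rS : S <= r.
  rewrite /r (bigD1 i)//= ler_wpDr//; first by apply: sumr_ge0 => j _; exact: sqr_ge0.
  rewrite -[leRHS]ger0_norm ?sqr_ge0// normrX expr2.
  by apply: le_trans (ltW Si) _; rewrite ler_peMl// (le_trans S1)// ltW.
have g0 := gamma_gt0 p.1 q.1; have gM := HM _ pB.
have rg : MA / e < r / gamma p.1 q.1.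
  rewrite ltr_pdivlMr//; apply: lt_le_trans rS; rewrite /S.
  apply: le_lt_trans (_ : MA / e * M < _); last by rewrite mulrC ltrDr.
  by rewrite ler_wpM2l// divr_ge0// ltW.
apply: le_lt_trans (_ : MA * expR (- (r / gamma p.1 q.1)) < _).
  by rewrite ler_wpM2r ?expR_ge0.
rewrite expRN ltr_pdivrMr ?expR_gt0// mulrC -ltr_pdivrMr//; apply: (lt_trans rg).
by apply: lt_le_trans (expR_ge1Dx _); rewrite ltrDr.
Qed.

(** The section of [A] is that of [Gker] restricted to the slice [x = 0], and compact sets project
    to compact sets. *)
Lemma A_section_C0 (v : X) : C0_funs R Y (fun p => G p (v, 0)) -> C0_funs R X (fun u => A u v).
Proof.
move=> [_ G0]; split; first exact: (continuous_section (q := v) A_cont).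
move=> e e0; have [B cB HB] := G0 _ e0; exists (fst @` B).
  apply: continuous_compact cB; apply: continuous_subspaceT; exact: cont_fst1.
move=> u nu; rewrite -Gker_zero; apply: HB => Bu; apply: nu.
by exists (u, 0).
Qed.

Lemma rkhs_C0_iff : rkhs G `<=` C0_funs R Y <-> rkhs A `<=` C0_funs R X.
Proof.
have pG := psd_Gker gamma_gt0 gamma_cnd C_pd; have pA := psd_A gamma_gt0 gamma_cnd C_pd.
have sec (Z : Type) (K : Z -> Z -> R[i]) z : psd K -> rkhs K (fun x => K x z).
  by move=> pK; rewrite section_combo; apply: hspace_rkhs => //; exact: hspace_combo.
split=> H.
  have [F FG|M HM] := rkhs_bounded_diag pG; first exact: C0_funs_bounded (H _ FG).
  apply: (rkhs_subset (@C0_funs0 _ _) (@C0_funs_lin _ _) (@C0_funs_uniform _ _) (M := M)).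
    by move=> u; rewrite -Gker_zero.
  by move=> v; apply: A_section_C0; apply: H; exact: sec.
have [F FA|M HM] := rkhs_bounded_diag pA; first exact: C0_funs_bounded (H _ FA).
have AM := kernel_le_diag pA HM.
apply: (rkhs_subset (@C0_funs0 _ _) (@C0_funs_lin _ _) (@C0_funs_uniform _ _) (M := M)).
  move=> p; apply: le_trans (ler_norm _) (le_trans (normc_Re _) _).
  exact: le_trans (Gker_le _ _) (AM _ _).
by move=> q; apply: Gker_section_C0 AM _; apply: H; exact: sec.
Qed.

End vanishing_at_infinity.

(** * Strict positive definiteness *)

Section point_mass.
Variables (R : realType) (Y : topologicalType) (p0 : Y).
Hypothesis Y_hausdorff : hausdorff_space Y.
Local Notation T := (borel p0).

Lemma real_complex_continuous : continuous (@real_complex R : R^o -> R[i]^o).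
Proof.
apply/ccontP; split; first by move=> x; exact: cvg_id.
by move=> x; exact: cvg_cst.
Qed.

Definition point_mass : {charge set T -> \bar R[i]} :=
  charge_map (charge_of_finite_measure (@dirac _ T (p0 : T) R)) real_complex_continuous.

Lemma point_massE (E : set T) : fine (point_mass E) = (\1_E (p0 : T) : R)%:C.
Proof. by []. Qed.

Lemma point_mass_variation (E : set T) : measurable E ->
  Defs.total_variation point_mass E = (\1_E (p0 : T))%:E.
Proof.
move=> mE; rewrite /Defs.total_variation.
have val (F : (set T)^nat) : (forall k, measurable (F k)) -> trivIset setT F -> \bigcup_k F k = E ->
    (\sum_(0 <= k <oo) (normc (fine (point_mass (F k))))%:E)%E = (\1_E (p0 : T))%:E.
  move=> mF tF FE; have := @measure_bigcup _ _ _ (@dirac _ T (p0 : T) R) setT F (fun k _ => mF k) tF.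
  rewrite FE => H; transitivity (@dirac _ T (p0 : T) R E); last by [].
  rewrite H; under [in RHS]eq_eseriesl do rewrite in_setT.
  apply: eq_eseriesr => k _; rewrite point_massE normc_real ger0_norm//.
rewrite -[RHS]ereal_sup1; congr ereal_sup; apply/seteqP; split => x /=.
  by move=> [F [mF tF FE] <-]; exact: val.
move=> ->; exists (fun k => if k is 0%N then E else set0).
  split.
  - by case.
  - by apply/trivIsetP => -[|i] [|j]//= _ _ _; rewrite ?setI0 ?set0I.
  - by apply/seteqP; split => [y [[|k] _ //]|y Ey]; exists 0%N.
apply: val.
- by case.
- by apply/trivIsetP => -[|i] [|j]//= _ _ _; rewrite ?setI0 ?set0I.
- by apply/seteqP; split => [y [[|k] _ //]|y Ey]; exists 0%N.
Qed.

Lemma indic_le_subset (B E : set T) : B `<=` E -> ((\1_B (p0 : T))%:E <= (\1_E (p0 : T))%:E :> \bar R)%E.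
Proof.
move=> BE; rewrite lee_fin !indicE; case: (boolP (_ \in B)) => // /set_mem/BE pE.
by rewrite mem_set.
Qed.

Lemma point_mass_radon : finite_radon point_mass.
Proof.
have m1 : measurable ([set p0] : set T) by apply: borel_compact => //; exact: compact_set1.
split.
- by rewrite point_mass_variation ?indicT ?ltry.
- move=> E mE; rewrite point_mass_variation//; apply/eqP; rewrite eq_le; apply/andP; split.
    (* The supremum is attained: at the singleton if [E] contains the point, at the empty set
       otherwise. *)
    apply: ereal_sup_ubound; exists (if p0 \in (E : set Y) then [set p0] else set0).
      case: ifPn => [/set_mem pE|_]; last by split => //; exact: compact0.
      by split; [exact: compact_set1|move=> _ ->].
    case: ifPn => pE; rewrite point_mass_variation// !indicE.
      by rewrite mem_set// pE.
    by rewrite in_set0 (negPf pE).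
  apply: ge_ereal_sup => _ [B [cB BE] <-].
  rewrite point_mass_variation; first exact: indic_le_subset.
  exact: borel_compact.
- move=> E mE; rewrite point_mass_variation//; apply/eqP; rewrite eq_le; apply/andP; split.
    apply: le_ereal_inf_tmp => _ [U [oU EU] <-].
    rewrite point_mass_variation; first exact: indic_le_subset.
    exact: borel_open.
  apply: ereal_inf_lbound; exists (if p0 \in (E : set Y) then setT else ~` [set p0]).
    case: ifPn => [//|pE]; first by split => //; exact: openT.
    split; first by apply: closed_openC; apply: compact_closed => //; exact: compact_set1.
    by move=> y Ey /= yp; move/negP : pE; apply; rewrite mem_set// -yp.
  case: ifPn => pE; rewrite point_mass_variation ?indicE//; last exact: measurableC.
    by rewrite in_setT pE.
  by rewrite memNset ?(negPf pE)//= => /(_ erefl).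
Qed.

(** Stated for any charge that vanishes off [p0], so that it covers the point mass and its
    conjugate. *)
Lemma cintegral_concentrated (lambda : {charge set T -> \bar R[i]}) (g : T -> R[i]) :
  (forall F : set T, measurable F -> ~ F p0 -> fine (lambda F) = 0) -> bcmeas g ->
  cintegral lambda g = g p0 * fine (lambda [set p0]).
Proof.
move=> l0 bg; have m1 : measurable ([set p0] : set T) by apply: borel_compact => //; exact: compact_set1.
have b1 : bcmeas ((fun x => (\1_[set p0] x)%:C) : T -> R[i]) by apply: bcmeas_real; exact: bmeas_indic.
have b2 : bcmeas (fun x : T => g p0 * (\1_[set p0] x)%:C) by apply: bcmeasM => //; exact: bcmeas_cst.
have b3 := bcmeasB bg b2.
have [M M0 HM] := bcmeas_bound b3.
rewrite -(cintegral_indic lambda m1) -cintegralZ//.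
apply/eqP; rewrite -subr_eq0 -cintegralB//; apply/eqP; apply: eq0_normc; apply/eqP.
rewrite eq_le normc_ge0 andbT.
apply: le_trans (cintegral_bound (eps := 0) (measurableC m1) b3 HM _ _) _.
- move=> x /contrapT /= ->; rewrite indicE mem_set// mulr1 subrr//.
- by move=> F mF FC; rewrite l0 ?normc0// => /FC; apply.
- by rewrite !mulr0.
Qed.

End point_mass.

Section ispd_gaussian.
Variables (R : realType) (m : nat) (X : topologicalType).
Hypothesis m_gt0 : (0 < m)%N.
Hypothesis X_hausdorff : hausdorff_space X.
Variables (gamma : X -> X -> R) (A : X -> X -> R[i]).
Hypothesis gamma_gt0 : forall u v, 0 < gamma u v.
Hypothesis gamma_cont : continuous (fun p : X * X => gamma p.1 p.2).
Hypothesis gamma_cnd : cond_neg_def_kernel gamma.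
Hypothesis A_cont : continuous_kernel A.
Hypothesis C_pd : pos_def_kernel (Cker m A gamma).
Local Notation Y := (X * 'rV[R]_m)%type.
Local Notation G := (Gker m A gamma).

Lemma ISPD_diag_gt0 u : ISPD G -> 0 < A u u.
Proof.
move=> [[M GM] _ _ strict]; have pA := psd_A gamma_gt0 gamma_cnd C_pd.
rewrite lt_def (psd_diag u pA) andbT; apply/eqP => Au0.
pose p0 : Y := (u, 0); have hY := @Y_hausdorff R m X X_hausdorff.
have cG := @Gker_cont R m X gamma A gamma_gt0 gamma_cont A_cont.
have m1 : measurable ([set p0] : set (borel p0)) by apply: borel_compact => //; exact: compact_set1.
have bG q : bcmeas ((fun p => G p q) : borel p0 -> R[i]).
  by apply: (@bcmeas_continuous _ _ _ _ M) => //; exact: (continuous_section (q := q) cG).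
have bG' : bcmeas ((fun q => G p0 q) : borel p0 -> R[i]).
  apply: (@bcmeas_continuous _ _ _ _ M) => //.
  apply: (@cont_compT Y (Y * Y)%type R[i]^o (fun q => (p0, q)) (fun w => G w.1 w.2)) => //.
  by apply: cont_pair => x; [exact: cvg_cst|exact: cvg_id].
have pm (F : set (borel p0)) : measurable F -> ~ F p0 -> fine (@point_mass R Y p0 F) = 0.
  by move=> mF nF; rewrite point_massE indicE memNset.
have inner q : cintegral (@point_mass R Y p0) (fun p => G p q) = G p0 q.
  rewrite (cintegral_concentrated hY pm)// point_massE indicE mem_set// mulr1//.
have := strict p0 _ (point_mass_radon R p0 hY) _ _ m1.
have -> : cintegral (conj_charge (@point_mass R Y p0))
    (fun q => cintegral (@point_mass R Y p0) (fun p => G p q)) = 0.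
  under eq_fun do rewrite inner.
  rewrite (cintegral_concentrated hY _ bG'); last first.
    by move=> F mF nF; rewrite -[LHS]/((fine (@point_mass R Y p0 F))^c) pm// conjc0.
  by rewrite Gker_zero Au0 mul0r.
move=> /(_ erefl) /(congr1 fine); rewrite point_massE indicE mem_set//=.
by move/eqP; rewrite oner_eq0.
Qed.

Lemma ISPD_gaussian (c MC : R) : metrizable_kernel gamma -> 0 < c ->
  (forall u, c <= gamma u u) -> (forall u v, normc (Cker m A gamma u v) <= MC) ->
  (forall u, 0 < A u u) -> ISPD G.
Proof.
move=> gm c0 gc CM Apos.
have gamma_ge u v : c <= gamma u v.
  by have := cnd_diag_le gamma_cnd u v; have := gc u; have := gc v; lra.
have GM := Gker_bounded gamma_gt0 c0 gamma_ge CM.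
have cG := @Gker_cont R m X gamma A gamma_gt0 gamma_cont A_cont.
have pG := psd_Gker gamma_gt0 gamma_cnd C_pd.
split.
- by eexists => p q; exact: GM.
- exact/psd_pos_def.
- apply: (rkhs_subset (@cont_funs0 _ _) (@cont_funs_lin _ _) (@cont_funs_uniform _ _)).
    by move=> p; apply: le_trans (ler_norm _) (le_trans (normc_Re _) (GM p p)).
  by move=> q; exact: (continuous_section (q := q) cG).
- move=> y0 lambda rad en E mE.
  by apply: (@measure_null R m X X_hausdorff gamma A gamma_gt0 gamma_cont gamma_cnd A_cont C_pd c MC) => //.
Qed.

End ispd_gaussian.

Theorem theorem5p2 (R : realType) (m : nat) (m_gt0 : (0 < m)%N)
    (X : topologicalType) (X_hausdorff : hausdorff_space X)
    (gamma : X -> X -> R) (A : X -> X -> R[i])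
    (gamma_gt0 : forall u v, 0 < gamma u v)
    (gamma_cont : continuous (fun p : X * X => gamma p.1 p.2))
    (gamma_cnd : cond_neg_def_kernel gamma)
    (A_cont : continuous_kernel A)
    (C_pd : pos_def_kernel (Cker m A gamma)) :
  (metrizable_kernel gamma ->
   (exists2 c : R, 0 < c & forall u, c <= gamma u u) ->
   bounded_kernel (Cker m A gamma) ->
   (ISPD (Gker m A gamma) <-> forall u, 0 < A u u)) /\
  (locally_compact [set: X] ->
   (rkhs (Gker m A gamma) `<=` C0_funs R (X * 'rV[R]_m)%type <->
    rkhs A `<=` C0_funs R X)).
Proof.
split=> [gamma_metr [c c_gt0 gamma_ge] [MC C_le]|_].
  split=> [G_ispd u|A_pos].
    exact: ISPD_diag_gt0 gamma_gt0 gamma_cont gamma_cnd A_cont C_pd u G_ispd.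
  exact: (ISPD_gaussian m_gt0 X_hausdorff gamma_gt0 gamma_cont gamma_cnd A_cont C_pd
    gamma_metr c_gt0 gamma_ge C_le A_pos).
exact: rkhs_C0_iff.
Qed.
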